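(* Let $k$ be an algebraically closed field of characteristic zero, let $n\in\mathbb{N}$, and let $A=\mathbf{A}_n(k)$ be the $n$-th Weyl algebra over $k$. Let $H$ be a finite dimensional semisimple Hopf algebra over $k$ acting on $A$. Then the action of $H$ on $A$ factors through a group action.
   Context: For a commutative ring $R$, the Weyl algebra $\mathbf{A}_n(R)$ is the $R$-algebra generated by $x_i,y_i$ ($i=1,\dots,n$) subject to the relations $[x_i,x_j]=[y_i,y_j]=0$ and $[y_i,x_j]=\delta_{ij}$. An action of a Hopf algebra $H$ on an algebra $A$ means that $A$ is a (left) $H$-module algebra: $A$ is an $H$-module with $h\cdot(ab)=\sum (h_{(1)}\cdot a)(h_{(2)}\cdot b)$ and $h\cdot 1=\varepsilon(h)1$. The action of $H$ on $A$ factors through a group action if there is a Hopf ideal $I\subset H$ with $I\cdot A=0$ such that $H/I$ is isomorphic, as a Hopf algebra, to a group algebra $kG$ of a (finite) group $G$. *)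

(* Defs.v *)
From HB Require Import structures.
From mathcomp Require Import all_boot all_order all_algebra all_fingroup.
From mathcomp Require Import falgebra generic_quotient ring_quotient boolp.

Set Implicit Arguments.
Unset Strict Implicit.
Unset Printing Implicit Defensive.

Import GRing.Theory.
Local Open Scope ring_scope.
Local Open Scope quotient_scope.

(* [idealr] supplies properness and stability under left multiplication (its
   documentation says "right ideal", its axiom is u \in S -> a * u \in S). *)
HB.mixin Record isRightStable (A : nzRingType) (S : A -> bool) := {
  idealMl_subproof : forall a u, S u -> S (u * a)
}.

#[short(type="bideal")]
HB.structure Definition Bideal (A : nzRingType) :=
  {S of Idealr A S & isRightStable A S}.

Lemma bidealMl (A : nzRingType) (I : bideal A) (a u : A) :
  u \in (I : pred A) -> u * a \in (I : pred A).
Proof. exact: idealMl_subproof. Qed.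

Definition quot_alg (A : nzRingType) (I : bideal A) := Quotient.quot I.

Section QuotAlgRing.
Variables (A : nzRingType) (I : bideal A).
Local Notation Q := (quot_alg I).

HB.instance Definition _ := GRing.Zmodule.on Q.
HB.instance Definition _ : EqQuotient A (Quotient.equiv I) Q :=
  EqQuotient.on Q.
HB.instance Definition _ := ZmodQuotient.on Q.

Lemma quot_algP (x y : A) :
  reflect (\pi_Q x = \pi_Q y) (x - y \in (I : pred A)).
Proof. by rewrite (Quotient.idealrBE I); apply: eqP. Qed.

Lemma quot_alg_repr (x : Q) : {a | x = \pi_Q a}.
Proof. by exists (repr x); rewrite reprK. Qed.

Definition quot_one : Q := \pi_Q 1.
Definition quot_mul : Q -> Q -> Q := lift_op2 Q *%R.

Lemma pi_quot_mul x y : \pi_Q (x * y) = quot_mul (\pi_Q x) (\pi_Q y).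
Proof.
rewrite /quot_mul; unlock; apply/quot_algP; set x' := repr _; set y' := repr _.
have -> : x * y - x' * y' = x * (y - y') + (x - x') * y'.
  by rewrite mulrBr mulrBl addrA subrK.
rewrite rpredD //; first by rewrite idealMr //; apply/quot_algP; rewrite reprK.
by rewrite bidealMl //; apply/quot_algP; rewrite reprK.
Qed.

Lemma quot_mulA : associative quot_mul.
Proof.
move=> x y z; have [a ->] := quot_alg_repr x; have [b ->] := quot_alg_repr y.
have [c ->] := quot_alg_repr z.
by rewrite -!pi_quot_mul mulrA.
Qed.

Lemma quot_mul1 : left_id quot_one quot_mul.
Proof.
by move=> x; have [a ->] := quot_alg_repr x; rewrite -pi_quot_mul mul1r.
Qed.

Lemma quot_mulr1 : right_id quot_one quot_mul.
Proof.
by move=> x; have [a ->] := quot_alg_repr x; rewrite -pi_quot_mul mulr1.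
Qed.

Lemma quot_piD (x y : A) : \pi_Q (x + y) = \pi_Q x + \pi_Q y.
Proof. exact: pi_addr. Qed.

Lemma quot_mulDl : left_distributive quot_mul +%R.
Proof.
move=> x y z; have [a ->] := quot_alg_repr x; have [b ->] := quot_alg_repr y.
have [c ->] := quot_alg_repr z.
by rewrite -quot_piD -!pi_quot_mul mulrDl quot_piD.
Qed.

Lemma quot_mulDr : right_distributive quot_mul +%R.
Proof.
move=> x y z; have [a ->] := quot_alg_repr x; have [b ->] := quot_alg_repr y.
have [c ->] := quot_alg_repr z.
by rewrite -quot_piD -!pi_quot_mul mulrDr quot_piD.
Qed.

Lemma quot_oner_neq0 : quot_one != 0.
Proof.
apply/eqP; rewrite -[0](pi_zeror (s := Q)) => /quot_algP.
by rewrite subr0 idealr1.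
Qed.

HB.instance Definition _ := GRing.Zmodule_isNzRing.Build Q
  quot_mulA quot_mul1 quot_mulr1 quot_mulDl quot_mulDr quot_oner_neq0.

HB.instance Definition _ := isNzRingQuotient.Build
  A (Quotient.equiv I) 0 -%R +%R 1 *%R Q erefl pi_quot_mul.

End QuotAlgRing.

Section QuotAlgAlgebra.
Variables (R : comNzRingType) (A : algType R) (I : bideal A).
Local Notation Q := (quot_alg I).

Definition quot_scale (c : R) : Q -> Q := lift_op1 Q ( *:%R c).

Lemma pi_quot_scale c x : \pi_Q (c *: x) = quot_scale c (\pi_Q x).
Proof.
rewrite /quot_scale; unlock; apply/quot_algP; rewrite -scalerBr -mulr_algl idealMr //.
by apply/quot_algP; rewrite reprK.
Qed.

Lemma quot_scaleA a b (v : Q) :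
  quot_scale a (quot_scale b v) = quot_scale (a * b) v.
Proof. by have [v' ->] := quot_alg_repr v; rewrite -!pi_quot_scale scalerA. Qed.

Lemma quot_scale1 : left_id 1 quot_scale.
Proof. by move=> v; have [v' ->] := quot_alg_repr v; rewrite -pi_quot_scale scale1r. Qed.

Lemma quot_scaleDr : right_distributive quot_scale +%R.
Proof.
move=> a u v; have [u' ->] := quot_alg_repr u; have [v' ->] := quot_alg_repr v.
by rewrite -quot_piD -!pi_quot_scale scalerDr quot_piD.
Qed.

Lemma quot_scaleDl (v : Q) : {morph quot_scale^~ v : a b / a + b}.
Proof.
by move=> a b; have [v' ->] := quot_alg_repr v; rewrite -!pi_quot_scale scalerDl quot_piD.
Qed.

HB.instance Definition _ := GRing.Zmodule_isLmodule.Build R Q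
  quot_scaleA quot_scale1 quot_scaleDr quot_scaleDl.

Lemma quot_piZ c (x : A) : \pi_Q (c *: x) = c *: \pi_Q x.
Proof. exact: pi_quot_scale. Qed.

Lemma quot_piM (x y : A) : \pi_Q (x * y) = \pi_Q x * \pi_Q y.
Proof. exact: pi_quot_mul. Qed.

Lemma quot_scaleAl a (u v : Q) : a *: (u * v) = (a *: u) * v.
Proof.
have [u' ->] := quot_alg_repr u; have [v' ->] := quot_alg_repr v.
by rewrite -quot_piZ -!quot_piM -quot_piZ scalerAl.
Qed.

HB.instance Definition _ := GRing.Lmodule_isLalgebra.Build R Q quot_scaleAl.

Lemma quot_scaleAr a (u v : Q) : a *: (u * v) = u * (a *: v).
Proof.
have [u' ->] := quot_alg_repr u; have [v' ->] := quot_alg_repr v.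
by rewrite -quot_piZ -!quot_piM -quot_piZ scalerAr.
Qed.

HB.instance Definition _ := GRing.Lalgebra_isAlgebra.Build R Q quot_scaleAr.

End QuotAlgAlgebra.

Section QuotProj.
Variables (R : comNzRingType) (A : algType R) (I : bideal A).

Definition quot_proj (a : A) : quot_alg I := \pi_(quot_alg I) a.

Lemma quot_projP (x y : A) :
  reflect (quot_proj x = quot_proj y) (x - y \in (I : pred A)).
Proof. exact: quot_algP. Qed.

Lemma quot_proj_linear : linear quot_proj.
Proof. by move=> c x y; rewrite /quot_proj quot_piD quot_piZ. Qed.

HB.instance Definition _ :=
  GRing.isLinear.Build R A (quot_alg I) *:%R quot_proj quot_proj_linear.

Lemma quot_proj_monoid : monoid_morphism quot_proj.
Proof. by split=> // x y; rewrite /quot_proj quot_piM. Qed.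

HB.instance Definition _ :=
  GRing.isMonoidMorphism.Build A (quot_alg I) quot_proj quot_proj_monoid.

Lemma quot_proj_repr (q : quot_alg I) : quot_proj (repr q) = q.
Proof. exact: reprK. Qed.

End QuotProj.

(* A sequence [:: (u_1, v_1); ...; (u_m, v_m)] stands for the element
   \sum_i u_i (x) v_i of the tensor product of U and V over R.  By the universal
   property, two such sequences stand for the same element if and only if every
   bilinear map sends them to the same value.  Likewise for triples and
   trilinear maps. *)
Section Tensors.
Variables (R : comNzRingType) (U V T : lmodType R).

Definition eq_tens (s t : seq (U * V)) : Prop :=
  forall (W : lmodType R) (f : U -> V -> W), bilinear_for *:%R *:%R f ->
  \sum_(p <- s) f p.1 p.2 = \sum_(p <- t) f p.1 p.2.

Definition trilinear (W : lmodType R) (f : U -> V -> T -> W) : Prop :=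
  [/\ forall v w, linear (fun u => f u v w),
      forall u w, linear (fun v => f u v w) &
      forall u v, linear (fun w => f u v w)].

Definition eq_tens3 (s t : seq (U * V * T)) : Prop :=
  forall (W : lmodType R) (f : U -> V -> T -> W), trilinear f ->
  \sum_(p <- s) f p.1.1 p.1.2 p.2 = \sum_(p <- t) f p.1.1 p.1.2 p.2.

End Tensors.

Definition tens_map (A B C D : Type) (f : A -> C) (g : B -> D)
  (s : seq (A * B)) : seq (C * D) := [seq (f p.1, g p.2) | p <- s].

Definition tens_mul (A B : nzRingType) (s t : seq (A * B)) : seq (A * B) :=
  [seq (p.1 * q.1, p.2 * q.2) | p <- s, q <- t].

HB.mixin Record isHopfAlgebra (k : fieldType) (H : Type) of GRing.Algebra k H := {
  comul : H -> seq (H * H);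
  counit : H -> k;
  antipode : H -> H;
  comul_is_linear : forall c x y,
    eq_tens (comul (c *: x + y)) (tens_map ( *:%R c) idfun (comul x) ++ comul y);
  comul_1 : eq_tens (comul 1) [:: (1, 1)];
  comul_M : forall x y, eq_tens (comul (x * y)) (tens_mul (comul x) (comul y));
  comul_A : forall x,
    eq_tens3 [seq (q.1, q.2, p.2) | p <- comul x, q <- comul p.1]
             [seq (p.1, q.1, q.2) | p <- comul x, q <- comul p.2];
  counit_is_scalar : scalar counit;
  counit_is_monoid_morphism : monoid_morphism counit;
  counitl : forall x, \sum_(p <- comul x) counit p.1 *: p.2 = x;
  counitr : forall x, \sum_(p <- comul x) counit p.2 *: p.1 = x;
  antipode_is_linear : linear antipode;
  antipodel : forall x,
    \sum_(p <- comul x) antipode p.1 * p.2 = (counit x)%:A;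
  antipoder : forall x,
    \sum_(p <- comul x) p.1 * antipode p.2 = (counit x)%:A
}.

#[short(type="hopfAlgType")]
HB.structure Definition HopfAlgebra (k : fieldType) :=
  {H of isHopfAlgebra k H & GRing.Algebra k H}.

#[short(type="finHopfAlgType")]
HB.structure Definition FinHopfAlgebra (k : fieldType) :=
  {H of isHopfAlgebra k H & Falgebra k H}.

Definition hopf_morphism (k : fieldType) (H1 H2 : hopfAlgType k)
    (phi : {lrmorphism H1 -> H2}) : Prop :=
  [/\ forall x, eq_tens (comul (phi x)) (tens_map phi phi (comul x)),
      forall x, counit (phi x) = counit x &
      forall x, antipode (phi x) = phi (antipode x)].

Definition hopf_isomorphic (k : fieldType) (H1 H2 : hopfAlgType k) : Prop :=
  exists2 phi : {lrmorphism H1 -> H2}, hopf_morphism phi & bijective phi.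

Definition left_ideal (k : fieldType) (A : falgType k) (V : {vspace A}) :=
  (fullv * V <= V)%VS.

(* The regular left module is semisimple: every left ideal is a direct
   summand. *)
Definition semisimple (k : fieldType) (A : falgType k) : Prop :=
  forall V : {vspace A}, left_ideal V ->
  exists W : {vspace A}, [/\ left_ideal W, (V + W = fullv)%VS & (V :&: W = 0)%VS].

HB.mixin Record isHopfIdeal (k : fieldType) (H : hopfAlgType k)
    (S : H -> bool) := {
  comul_hopf_ideal : forall x, S x -> exists s t : seq (H * H),
    [/\ all (fun p => S p.1) s, all (fun p => S p.2) t &
        eq_tens (comul x) (s ++ t)];
  counit_hopf_ideal : forall x, S x -> counit x = 0;
  antipode_hopf_ideal : forall x, S x -> S (antipode x)
}.

#[short(type="hopfIdeal")]
HB.structure Definition HopfIdeal (k : fieldType) (H : hopfAlgType k) :=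
  {S of Bideal H S & isHopfIdeal k H S}.

Section HopfTheory.
Variables (k : fieldType) (H : hopfAlgType k).

HB.instance Definition _ :=
  GRing.isLinear.Build k H k *%R (@counit k H) counit_is_scalar.
HB.instance Definition _ :=
  GRing.isMonoidMorphism.Build H k (@counit k H) counit_is_monoid_morphism.
HB.instance Definition _ :=
  GRing.isLinear.Build k H H *:%R (@antipode k H) antipode_is_linear.

Lemma sum_comul_linear (W : lmodType k) (f : H -> H -> W) :
  bilinear_for *:%R *:%R f ->
  linear (fun x => \sum_(p <- comul x) f p.1 p.2).
Proof.
move=> bf c x y; rewrite (comul_is_linear c x y _ _ bf) big_cat big_map /=.
congr (_ + _); rewrite scaler_sumr; apply: eq_bigr => p _.
have -> := scalable_linear (bf.1 p.2); by [].
Qed.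

End HopfTheory.

Section QuotHopf.
Variables (k : fieldType) (H : hopfAlgType k) (I : hopfIdeal H).
Local Notation Q := (quot_alg I).
Local Notation pr := (@quot_proj k H I).

Definition quot_comul (q : Q) : seq (Q * Q) := tens_map pr pr (comul (repr q)).
Definition quot_counit (q : Q) : k := counit (repr q).
Definition quot_antipode (q : Q) : Q := pr (antipode (repr q)).

Lemma bilin_pr (W : lmodType k) (f : Q -> Q -> W) :
  bilinear_for *:%R *:%R f ->
  bilinear_for *:%R *:%R (fun u v : H => f (pr u) (pr v)).
Proof.
case=> f1 f2; split=> u c x y; rewrite linearP; first exact: (f1 (pr u)).
exact: (f2 (pr u)).
Qed.

Lemma bilin0l (U V W : lmodType k) (f : U -> V -> W) v :
  bilinear_for *:%R *:%R f -> f 0 v = 0.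
Proof.
case=> f1 _; rewrite -[RHS](scale0r (f 0 v)) -(scalable_linear (f1 v)).
by rewrite scale0r.
Qed.

Lemma bilin0r (U V W : lmodType k) (f : U -> V -> W) u :
  bilinear_for *:%R *:%R f -> f u 0 = 0.
Proof.
case=> _ f2; rewrite -[RHS](scale0r (f u 0)) -(scalable_linear (f2 u)).
by rewrite scale0r.
Qed.

Lemma pr0 (x : H) : x \in (I : pred H) -> pr x = 0.
Proof. by move=> Ix; rewrite -(linear0 pr); apply/quot_projP; rewrite subr0. Qed.

Lemma repr_prB (x : H) : repr (pr x) - x \in (I : pred H).
Proof. by apply/quot_projP; rewrite quot_proj_repr. Qed.

Lemma quot_comul_pr x : eq_tens (quot_comul (pr x)) (tens_map pr pr (comul x)).
Proof.
move=> W f bf; rewrite /quot_comul !big_map /=.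
have bg := bilin_pr bf; set g := fun u v : H => f (pr u) (pr v) in bg.
have lg := sum_comul_linear bg.
apply/eqP; rewrite -subr_eq0; apply/eqP.
have /= := lg (-1) x (repr (pr x)); rewrite !scaleN1r.
rewrite [X in comul X]addrC [RHS]addrC => {lg}lg.
transitivity (\sum_(p <- comul (repr (pr x) - x)) g p.1 p.2); first by rewrite lg.
have [s [t [/allP sI /allP tI e]]] := comul_hopf_ideal _ (repr_prB x).
rewrite (e _ _ bg) big_cat /= !big_seq !big1 ?addr0 // => p.
  by move=> /tI Ip; rewrite /g (pr0 Ip) bilin0r.
by move=> /sI Ip; rewrite /g (pr0 Ip) bilin0l.
Qed.

Lemma quot_counit_pr x : quot_counit (pr x) = counit x.
Proof.
apply/eqP; rewrite -subr_eq0 -raddfB; apply/eqP.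
exact: counit_hopf_ideal _ (repr_prB x).
Qed.

Lemma quot_antipode_pr x : quot_antipode (pr x) = pr (antipode x).
Proof.
apply/quot_projP; rewrite -raddfB.
exact: antipode_hopf_ideal _ (repr_prB x).
Qed.

Lemma sum_quot_comul_pr (W : lmodType k) (f : Q -> Q -> W) x :
  bilinear_for *:%R *:%R f ->
  \sum_(p <- quot_comul (pr x)) f p.1 p.2 =
  \sum_(p <- comul x) f (pr p.1) (pr p.2).
Proof. by move=> bf; rewrite (@quot_comul_pr x _ _ bf) big_map. Qed.

Lemma quot_comul_is_linear c x y :
  eq_tens (quot_comul (c *: x + y))
          (tens_map ( *:%R c) idfun (quot_comul x) ++ quot_comul y).
Proof.
rewrite -(quot_proj_repr x) -(quot_proj_repr y) -linearP => W f bf.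
rewrite sum_quot_comul_pr // big_cat /= [X in _ = _ + X]sum_quot_comul_pr //.
rewrite (sum_comul_linear (bilin_pr bf)); congr (_ + _).
rewrite -[X in _ *: X]sum_quot_comul_pr // [RHS]big_map scaler_sumr.
by apply: eq_bigr => p _ /=; rewrite (scalable_linear (bf.1 p.2)).
Qed.

Lemma sum_quot_comul_linear (W : lmodType k) (f : Q -> Q -> W) :
  bilinear_for *:%R *:%R f ->
  linear (fun x => \sum_(p <- quot_comul x) f p.1 p.2).
Proof.
move=> bf c x y; rewrite (quot_comul_is_linear c x y bf) big_cat big_map /=.
congr (_ + _); rewrite scaler_sumr; apply: eq_bigr => p _.
by rewrite (scalable_linear (bf.1 p.2)).
Qed.

Lemma quot_comul_1 : eq_tens (quot_comul 1) [:: (1, 1)].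
Proof.
move=> W f bf; rewrite -(rmorph1 pr) sum_quot_comul_pr //.
by rewrite (@comul_1 k H _ _ (bilin_pr bf)) !big_seq1.
Qed.

Lemma quot_comul_M x y :
  eq_tens (quot_comul (x * y)) (tens_mul (quot_comul x) (quot_comul y)).
Proof.
rewrite -(quot_proj_repr x) -(quot_proj_repr y) -rmorphM => W f bf.
rewrite sum_quot_comul_pr // (@comul_M k H _ _ _ _ (bilin_pr bf)) /tens_mul.
rewrite !big_allpairs_dep /=.
have bm1 v : bilinear_for *:%R *:%R (fun a b : Q => f (a * v.1) (b * v.2)).
  split=> u c a b /=.
    by rewrite mulrDl -scalerAl; apply: (bf.1 (u * v.2)).
  by rewrite mulrDl -scalerAl; apply: (bf.2 (u * v.1)).
have bm2 v : bilinear_for *:%R *:%R (fun a b : Q => f (v.1 * a) (v.2 * b)).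
  split=> u c a b /=.
    by rewrite mulrDr -scalerAr; apply: (bf.1 (v.2 * u)).
  by rewrite mulrDr -scalerAr; apply: (bf.2 (v.1 * u)).
transitivity (\sum_(p <- comul (repr x)) \sum_(q <- quot_comul (pr (repr y)))
  f (pr p.1 * q.1) (pr p.2 * q.2)).
  apply: eq_bigr => p _.
  rewrite (sum_quot_comul_pr (f := fun a b => f (pr p.1 * a) (pr p.2 * b))).
    by apply: eq_bigr => q _; rewrite !rmorphM.
  exact: (bm2 (pr p.1, pr p.2)).
rewrite exchange_big [RHS]exchange_big; apply: eq_bigr => q _ /=.
by rewrite (sum_quot_comul_pr (f := fun a b => f (a * q.1) (b * q.2))).
Qed.

Lemma quot_comul_A x :
  eq_tens3 [seq (q.1, q.2, p.2) | p <- quot_comul x, q <- quot_comul p.1]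
           [seq (p.1, q.1, q.2) | p <- quot_comul x, q <- quot_comul p.2].
Proof.
rewrite -(quot_proj_repr x) => W f [f1 f2 f3].
rewrite !big_allpairs_dep /=.
have b12 w : bilinear_for *:%R *:%R (fun a b => f a b w).
  by split=> u c a b; [apply: f1 | apply: f2].
have b23 u : bilinear_for *:%R *:%R (f u).
  by split=> v c a b; [apply: f2 | apply: f3].
rewrite (sum_quot_comul_pr
  (f := fun a w => \sum_(q <- quot_comul a) f q.1 q.2 w)); last first.
  split=> u c a b; first exact: (sum_quot_comul_linear (b12 u)).
  by rewrite /= scaler_sumr -big_split; apply: eq_bigr => q _; apply: f3.
rewrite (sum_quot_comul_pr
  (f := fun u a => \sum_(q <- quot_comul a) f u q.1 q.2)); last first.
  split=> u c a b; last exact: (sum_quot_comul_linear (b23 u)).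
  by rewrite /= scaler_sumr -big_split; apply: eq_bigr => q _; apply: f1.
have tf : trilinear (fun a b c : H => f (pr a) (pr b) (pr c)).
  by split=> u v c a b; rewrite linearP; [apply: f1 | apply: f2 | apply: f3].
have := @comul_A k H (repr x) _ _ tf; rewrite !big_allpairs_dep /= => e.
transitivity (\sum_(p <- comul (repr x)) \sum_(q <- comul p.1)
  f (pr q.1) (pr q.2) (pr p.2)).
  by apply: eq_bigr => p _; rewrite (sum_quot_comul_pr _ (b12 _)).
rewrite e; apply: eq_bigr => p _.
by rewrite (sum_quot_comul_pr _ (b23 _)).
Qed.

Lemma quot_counit_is_scalar : scalar quot_counit.
Proof.
move=> c x y; rewrite -(quot_proj_repr x) -(quot_proj_repr y) -linearP.
by rewrite !quot_counit_pr linearP.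
Qed.

Lemma quot_counit_is_monoid_morphism : monoid_morphism quot_counit.
Proof.
split=> [|x y]; first by rewrite -(rmorph1 pr) quot_counit_pr rmorph1.
rewrite -(quot_proj_repr x) -(quot_proj_repr y) -rmorphM.
by rewrite !quot_counit_pr rmorphM.
Qed.

Lemma quot_antipode_is_linear : linear quot_antipode.
Proof.
move=> c x y; rewrite -(quot_proj_repr x) -(quot_proj_repr y) -linearP.
by rewrite !quot_antipode_pr !linearP.
Qed.

Lemma quot_counitl x : \sum_(p <- quot_comul x) quot_counit p.1 *: p.2 = x.
Proof.
rewrite -(quot_proj_repr x) (sum_quot_comul_pr (f := fun a b => quot_counit a *: b)).
  rewrite -[in RHS](counitl (repr x)) raddf_sum; apply: eq_bigr => p _.
  by rewrite quot_counit_pr /= linearZ.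
split=> u c a b; last by rewrite /= scalerDr !scalerA mulrC.
by rewrite /= quot_counit_is_scalar scalerDl scalerA.
Qed.

Lemma quot_counitr x : \sum_(p <- quot_comul x) quot_counit p.2 *: p.1 = x.
Proof.
rewrite -(quot_proj_repr x) (sum_quot_comul_pr (f := fun a b => quot_counit b *: a)).
  rewrite -[in RHS](counitr (repr x)) raddf_sum; apply: eq_bigr => p _.
  by rewrite quot_counit_pr /= linearZ.
split=> u c a b; first by rewrite /= scalerDr !scalerA mulrC.
by rewrite /= quot_counit_is_scalar scalerDl scalerA.
Qed.

Lemma quot_antipodel x :
  \sum_(p <- quot_comul x) quot_antipode p.1 * p.2 = (quot_counit x)%:A.
Proof.
rewrite -(quot_proj_repr x) (sum_quot_comul_pr (f := fun a b => quot_antipode a * b)).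
  rewrite quot_counit_pr -(rmorph1 pr) -linearZ -antipodel raddf_sum.
  by apply: eq_bigr => p _; rewrite quot_antipode_pr /= rmorphM.
split=> u c a b; last by rewrite /= mulrDr scalerAr.
by rewrite /= quot_antipode_is_linear mulrDl scalerAl.
Qed.

Lemma quot_antipoder x :
  \sum_(p <- quot_comul x) p.1 * quot_antipode p.2 = (quot_counit x)%:A.
Proof.
rewrite -(quot_proj_repr x) (sum_quot_comul_pr (f := fun a b => a * quot_antipode b)).
  rewrite quot_counit_pr -(rmorph1 pr) -linearZ -antipoder raddf_sum.
  by apply: eq_bigr => p _; rewrite quot_antipode_pr /= rmorphM.
split=> u c a b; first by rewrite /= mulrDl scalerAl.
by rewrite /= quot_antipode_is_linear mulrDr scalerAr.
Qed.

HB.instance Definition _ := isHopfAlgebra.Build k Q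
  quot_comul_is_linear quot_comul_1 quot_comul_M quot_comul_A
  quot_counit_is_scalar quot_counit_is_monoid_morphism quot_counitl quot_counitr
  quot_antipode_is_linear quot_antipodel quot_antipoder.

End QuotHopf.

Definition group_alg (k : fieldType) (gT : finGroupType) := {ffun gT -> k^o}.

Section GroupAlg.
Variables (k : fieldType) (gT : finGroupType).
Local Notation kG := (group_alg k gT).

HB.instance Definition _ := GRing.Lmodule.on kG.

Definition group_alg_elt (g : gT) : kG := [ffun h => (h == g)%:R].
Local Notation delta := group_alg_elt.

Definition group_alg_mul (a b : kG) : kG :=
  [ffun g => \sum_h a h * b (h^-1 * g)%g].

Lemma group_algE (a : kG) : a = \sum_g a g *: (delta g).
Proof.
apply/ffunP=> h; rewrite sum_ffunE (bigD1 h) //= big1 => [|g ng].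
  by rewrite !ffunE eqxx addr0 /GRing.scale /= mulr1.
by rewrite !ffunE eq_sym (negPf ng) /GRing.scale /= mulr0.
Qed.

Lemma group_alg_mulDl : left_distributive group_alg_mul +%R.
Proof.
move=> a b c; apply/ffunP=> g; rewrite !ffunE -big_split.
by apply: eq_bigr => h _; rewrite ffunE mulrDl.
Qed.

Lemma group_alg_mulDr : right_distributive group_alg_mul +%R.
Proof.
move=> a b c; apply/ffunP=> g; rewrite !ffunE -big_split.
by apply: eq_bigr => h _; rewrite ffunE mulrDr.
Qed.

Lemma group_alg_mulA : associative group_alg_mul.
Proof.
move=> a b c; apply/ffunP=> g; rewrite !ffunE.
under eq_bigr do rewrite ffunE mulr_sumr.
under [RHS]eq_bigr do rewrite ffunE mulr_suml.
rewrite [RHS]exchange_big; apply: eq_bigr => h _ /=.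
rewrite [RHS](reindex_inj (mulgI h)); apply: eq_bigr => l _ /=.
by rewrite mulrA mulKg invMg mulgA.
Qed.

Lemma group_alg_mul1 : left_id (delta 1%g) group_alg_mul.
Proof.
move=> a; apply/ffunP=> g; rewrite !ffunE (bigD1 1%g) //= big1 => [|h nh].
  by rewrite ffunE eqxx mul1r invg1 mul1g addr0.
by rewrite ffunE (negPf nh) mul0r.
Qed.

Lemma group_alg_mulr1 : right_id (delta 1%g) group_alg_mul.
Proof.
move=> a; apply/ffunP=> g; rewrite !ffunE (bigD1 g) //= big1 => [|h nh].
  by rewrite ffunE mulVg eqxx mulr1 addr0.
by rewrite ffunE -eq_mulVg1 (negPf nh) mulr0.
Qed.

Lemma group_alg_oner_neq0 : (delta 1%g) != 0 :> kG.
Proof.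
by apply/eqP=> /ffunP/(_ 1%g); rewrite !ffunE eqxx => /eqP; rewrite oner_eq0.
Qed.

HB.instance Definition _ := GRing.Zmodule_isNzRing.Build kG
  group_alg_mulA group_alg_mul1 group_alg_mulr1 group_alg_mulDl group_alg_mulDr
  group_alg_oner_neq0.

Lemma group_alg_scaleAl (c : k) (a b : kG) : c *: (a * b) = (c *: a) * b.
Proof.
apply/ffunP=> g; rewrite !ffunE /GRing.scale /= mulr_sumr.
by apply: eq_bigr => h _; rewrite ffunE mulrA.
Qed.

HB.instance Definition _ :=
  GRing.Lmodule_isLalgebra.Build k kG group_alg_scaleAl.

Lemma group_alg_scaleAr (c : k) (a b : kG) : c *: (a * b) = a * (c *: b).
Proof.
apply/ffunP=> g; rewrite !ffunE /GRing.scale /= mulr_sumr.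
by apply: eq_bigr => h _; rewrite ffunE mulrCA.
Qed.

HB.instance Definition _ := GRing.Lalgebra_isAlgebra.Build k kG group_alg_scaleAr.

Lemma group_alg_eltM g h : (delta g) * (delta h) = (delta (g * h)%g) :> kG.
Proof.
apply/ffunP=> l; rewrite !ffunE (bigD1 g) //= big1 => [|x nx].
  rewrite !ffunE eqxx mul1r addr0; congr (nat_of_bool _)%:R.
  by apply/eqP/eqP=> [<-|->]; rewrite ?mulKVg ?mulKg.
by rewrite ffunE (negPf nx) mul0r.
Qed.

Definition group_alg_comul (a : kG) : seq (kG * kG) :=
  [seq (a g *: (delta g), (delta g)) | g <- enum gT].
Definition group_alg_counit (a : kG) : k := \sum_g a g.
Definition group_alg_antipode (a : kG) : kG := [ffun g => a g^-1%g].

Lemma sum_group_alg_comul (W : lmodType k) (f : kG -> kG -> W) a :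
  bilinear_for *:%R *:%R f ->
  \sum_(p <- group_alg_comul a) f p.1 p.2 = \sum_g a g *: f (delta g) (delta g).
Proof.
move=> bf; rewrite big_map big_enum; apply: eq_bigr => g _ /=.
exact: (scalable_linear (bf.1 _)).
Qed.

Lemma sum_group_algM (W : lmodType k) (F : gT -> W) (a b : kG) :
  \sum_g (a * b) g *: F g = \sum_g \sum_h (a g * b h) *: F (g * h)%g.
Proof.
under eq_bigr do rewrite ffunE scaler_suml.
rewrite exchange_big; apply: eq_bigr => g _ /=.
rewrite (reindex_inj (mulgI g)); apply: eq_bigr => h _ /=.
by rewrite mulKg.
Qed.

Lemma sum_group_alg1 (W : lmodType k) (F : gT -> W) :
  \sum_g (1 : kG) g *: F g = F 1%g.
Proof.
rewrite (bigD1 1%g) //= big1 => [|g ng].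
  by rewrite ffunE eqxx scale1r addr0.
by rewrite ffunE (negPf ng) scale0r.
Qed.

Lemma group_alg_comul_is_linear c x y :
  eq_tens (group_alg_comul (c *: x + y))
    (tens_map ( *:%R c) idfun (group_alg_comul x) ++ group_alg_comul y).
Proof.
move=> W f bf; rewrite sum_group_alg_comul // big_cat /=.
rewrite [X in _ = _ + X]sum_group_alg_comul // /tens_map -map_comp big_map /=.
rewrite big_enum -big_split; apply: eq_bigr => g _ /=.
by rewrite !ffunE scalerDl scalerA -(scalable_linear (bf.1 _)).
Qed.

Lemma group_alg_comul_1 : eq_tens (group_alg_comul 1) [:: (1, 1)].
Proof.
move=> W f bf; rewrite sum_group_alg_comul // big_seq1 /=.
exact: (sum_group_alg1 (fun g => f (delta g) (delta g))).
Qed.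

Lemma group_alg_comul_M x y :
  eq_tens (group_alg_comul (x * y))
          (tens_mul (group_alg_comul x) (group_alg_comul y)).
Proof.
move=> W f bf; rewrite sum_group_alg_comul // big_allpairs_dep /=.
rewrite (sum_group_algM (fun g => f (delta g) (delta g))) big_map big_enum.
apply: eq_bigr => g _ /=; rewrite big_map big_enum; apply: eq_bigr => h _ /=.
rewrite -scalerAl -scalerAr scalerA !group_alg_eltM.
by rewrite -(scalable_linear (bf.1 _)).
Qed.

Lemma group_alg_comul_elt (W : lmodType k) (f : kG -> kG -> W) g c :
  bilinear_for *:%R *:%R f ->
  \sum_(p <- group_alg_comul (c *: (delta g))) f p.1 p.2 = c *: f (delta g) (delta g).
Proof.
have E h : (c *: delta g) h = c * (h == g)%:R by rewrite !ffunE.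
move=> bf; rewrite sum_group_alg_comul // (bigD1 g) //= big1 => [|h nh].
  by rewrite E eqxx mulr1 addr0.
by rewrite E (negPf nh) mulr0 scale0r.
Qed.

Lemma group_alg_comul_A x :
  eq_tens3 [seq (q.1, q.2, p.2) | p <- group_alg_comul x, q <- group_alg_comul p.1]
           [seq (p.1, q.1, q.2) | p <- group_alg_comul x, q <- group_alg_comul p.2].
Proof.
move=> W f [f1 f2 f3]; rewrite !big_allpairs_dep /= !big_map.
apply: eq_bigr => g _ /=.
have b12 w : bilinear_for *:%R *:%R (fun a b => f a b w).
  by split=> u c a b; [apply: f1 | apply: f2].
have b23 u : bilinear_for *:%R *:%R (f u).
  by split=> v c a b; [apply: f2 | apply: f3].
rewrite (group_alg_comul_elt _ _ (b12 _)).
have := group_alg_comul_elt g 1 (b23 (x g *: delta g)).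
rewrite !scale1r => ->.
by rewrite (scalable_linear (f1 _ _)).
Qed.

Lemma group_alg_counit_is_scalar : scalar group_alg_counit.
Proof.
move=> c a b; rewrite /group_alg_counit mulr_sumr -big_split.
by apply: eq_bigr => g _; rewrite !ffunE.
Qed.

Lemma group_alg_counit_is_monoid_morphism : monoid_morphism group_alg_counit.
Proof.
have E a : group_alg_counit a = \sum_g a g *: (1 : k^o).
  by apply: eq_bigr => g _; rewrite /GRing.scale /= mulr1.
split=> [|a b]; first by rewrite E (sum_group_alg1 (fun=> 1 : k^o)).
rewrite E (sum_group_algM (fun=> 1 : k^o)) /group_alg_counit mulr_suml.
apply: eq_bigr => g _; rewrite mulr_sumr; apply: eq_bigr => h _.
by rewrite /GRing.scale /= mulr1.
Qed.

Lemma group_alg_counit_elt c g : group_alg_counit (c *: (delta g)) = c.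
Proof.
rewrite /group_alg_counit (bigD1 g) //= big1 => [|h nh].
  by rewrite !ffunE eqxx /GRing.scale /= mulr1 addr0.
by rewrite !ffunE (negPf nh) /GRing.scale /= mulr0.
Qed.

Lemma group_alg_counitl x :
  \sum_(p <- group_alg_comul x) group_alg_counit p.1 *: p.2 = x.
Proof.
rewrite [RHS]group_algE big_map big_enum; apply: eq_bigr => g _ /=.
by rewrite group_alg_counit_elt.
Qed.

Lemma group_alg_counitr x :
  \sum_(p <- group_alg_comul x) group_alg_counit p.2 *: p.1 = x.
Proof.
rewrite [RHS]group_algE big_map big_enum; apply: eq_bigr => g _ /=.
by rewrite -[X in group_alg_counit X]scale1r group_alg_counit_elt scale1r.
Qed.

Lemma group_alg_antipode_is_linear : linear group_alg_antipode.
Proof. by move=> c a b; apply/ffunP=> g; rewrite !ffunE. Qed.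

Lemma group_alg_antipode_elt c g :
  group_alg_antipode (c *: (delta g)) = c *: (delta (g^-1)%g).
Proof. by apply/ffunP=> h; rewrite !ffunE -eq_invg_sym eq_sym. Qed.

Lemma group_alg_antipodel x :
  \sum_(p <- group_alg_comul x) group_alg_antipode p.1 * p.2 =
  (group_alg_counit x)%:A.
Proof.
rewrite /group_alg_counit scaler_suml big_map big_enum; apply: eq_bigr => g _ /=.
by rewrite group_alg_antipode_elt -scalerAl group_alg_eltM mulVg.
Qed.

Lemma group_alg_antipoder x :
  \sum_(p <- group_alg_comul x) p.1 * group_alg_antipode p.2 =
  (group_alg_counit x)%:A.
Proof.
rewrite /group_alg_counit scaler_suml big_map big_enum; apply: eq_bigr => g _ /=.
rewrite -[X in group_alg_antipode X]scale1r group_alg_antipode_elt scale1r.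
by rewrite -scalerAl group_alg_eltM mulgV.
Qed.

HB.instance Definition _ := isHopfAlgebra.Build k kG
  group_alg_comul_is_linear group_alg_comul_1 group_alg_comul_M group_alg_comul_A
  group_alg_counit_is_scalar group_alg_counit_is_monoid_morphism
  group_alg_counitl group_alg_counitr
  group_alg_antipode_is_linear group_alg_antipodel group_alg_antipoder.

End GroupAlg.

From mathcomp Require Import finmap mpoly monalg.
Import GRing.Theory.

Definition free_alg (R : comNzRingType) (I : choiceType) :=
  malg (fmonom I) R.

Section FreeAlg.
Variables (R : comNzRingType) (I : choiceType).

HB.instance Definition _ := GRing.Lalgebra.on (free_alg R I).

Lemma free_alg_scalerAr (c : R) (a b : free_alg R I) :
  c *: (a * b) = a * (c *: b).
Proof.
apply/malgP=> w; rewrite [LHS]mcoeffZ [in LHS]mcoeffMl.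
rewrite [RHS](mcoeffMlw _ (fsubset_refl _) (msuppZ_le c b)).
rewrite mulr_sumr; apply: eq_bigr => u _; rewrite mulr_sumr.
by apply: eq_bigr => v _; rewrite mcoeffZ mulrnAr mulrCA.
Qed.

HB.instance Definition _ :=
  GRing.Lalgebra_isAlgebra.Build R (free_alg R I) free_alg_scalerAr.

Definition free_gen (i : I) : free_alg R I := mkmalgU (fmu i) 1.

End FreeAlg.

Definition ideal_gen (A : nzRingType) (S : A -> Prop) (a : A) : Prop :=
  forall J : A -> Prop,
    J 0 -> (forall u v, J u -> J v -> J (u + v)) ->
    (forall b u, J u -> J (b * u)) -> (forall u b, J u -> J (u * b)) ->
    (forall u, S u -> J u) -> J a.

Definition bracket (A : nzRingType) (a b : A) : A := a * b - b * a.

(* The Weyl algebra is the free algebra on 'I_n + 'I_n, with x_i = inl i and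
   y_i = inr i, modulo the ideal generated by the following elements. *)
Section Weyl.
Variables (R : comNzRingType) (n : nat).
Local Notation F := (free_alg R ('I_n + 'I_n)%type).
Local Notation x i := (@free_gen R ('I_n + 'I_n)%type (inl i)).
Local Notation y i := (@free_gen R ('I_n + 'I_n)%type (inr i)).

Definition weyl_relator (a : F) : Prop :=
  exists i j : 'I_n, [\/ a = bracket (x i) (x j), a = bracket (y i) (y j) |
                         a = bracket (y i) (x j) - (i == j)%:R].

Definition weyl_ideal (a : F) : bool := `[< ideal_gen weyl_relator a >].

(* Properness of the ideal comes from the action on polynomials in which x_i
   is multiplication by 'X_i and y_i is the i-th partial derivative. *)
Local Notation P := (mpoly n R).

Definition weyl_letter (l : 'I_n + 'I_n) (p : P) : P :=
  match l with
  | inl i => mpolyX R (mnm1 i) * p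
  | inr i => mderiv i p
  end.

Definition weyl_op (a : F) (p : P) : P :=
  mmap (@mpolyC n R) (fun w => foldr weyl_letter p (fmonom_val w)) a.

Lemma weyl_word_is_linear (w : seq ('I_n + 'I_n)) :
  linear (fun p => foldr weyl_letter p w).
Proof.
elim: w => [//|l w IHw] c p q /=; rewrite IHw; case: l => i /=.
  by rewrite mulrDr scalerAr.
by rewrite linearP.
Qed.

Lemma weyl_opD a b p : weyl_op (a + b) p = weyl_op a p + weyl_op b p.
Proof. exact: raddfD. Qed.

Lemma weyl_opB a b p : weyl_op (a - b) p = weyl_op a p - weyl_op b p.
Proof. exact: raddfB. Qed.

Lemma weyl_op0 p : weyl_op 0 p = 0.
Proof. exact: raddf0. Qed.

Lemma weyl_op1 p : weyl_op 1 p = p.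
Proof. by rewrite /weyl_op mmapU /= mpolyC1 mul1r fm1. Qed.

Lemma weyl_op_r0 a : weyl_op a 0 = 0.
Proof.
rewrite /weyl_op mmapE big1 // => w _.
have := weyl_word_is_linear (fmonom_val w) (-1) 0 0; rewrite scaler0 addr0.
by rewrite scaleN1r addNr => ->; rewrite mulr0.
Qed.

Lemma weyl_opM a b p : weyl_op (a * b) p = weyl_op a (weyl_op b p).
Proof.
rewrite [in LHS]/weyl_op malgME raddf_sum /= [RHS]mmapE.
apply: eq_bigr => u _; rewrite raddf_sum /=.
pose lw := GRing.isLinear.Build R P P *:%R _
  (weyl_word_is_linear (fmonom_val u)).
pose L : {linear P -> P} := HB.pack (fun p : P => foldr weyl_letter p (fmonom_val u)) lw.
rewrite -[foldr _ (weyl_op b p) _]/(L (weyl_op b p)) /weyl_op mmapE raddf_sum.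
rewrite mulr_sumr; apply: eq_bigr => v _; rewrite mmapU /=.
rewrite mpoly.mpolyCM -mulrA !mul_mpolyC.
rewrite (scalable_linear (weyl_word_is_linear (fmonom_val u))).
by rewrite -foldr_cat [mmul u v]fmmulE.
Qed.

Lemma weyl_op_gen l p : weyl_op (free_gen R l) p = weyl_letter l p.
Proof. by rewrite /weyl_op mmapU /= mpolyC1 mul1r fmuE. Qed.

Lemma weyl_op_bracket l m p :
  weyl_op (bracket (free_gen R l) (free_gen R m)) p =
  weyl_letter l (weyl_letter m p) - weyl_letter m (weyl_letter l p).
Proof.
have E a b : weyl_op (free_gen R a * free_gen R b) p =
    weyl_letter a (weyl_letter b p).
  by apply: etrans (weyl_opM _ _ _) _; rewrite (weyl_op_gen b) weyl_op_gen.
by rewrite /bracket weyl_opB; congr (_ - _); apply: E.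
Qed.

Lemma weyl_op_relator a p : weyl_relator a -> weyl_op a p = 0.
Proof.
case=> i [j] [] ->; last rewrite weyl_opB; rewrite weyl_op_bracket /=.
- by rewrite mulrCA subrr.
- by rewrite mderiv_comm subrr.
rewrite mderivM addrK mderivX mnm1E eq_sym; case: eqVneq => [->|_] /=.
  have -> : (mnm1 j - mnm1 j)%MM = 0%MM.
    by apply/mnmP=> l; rewrite mnmBE mnm0E subnn.
  by rewrite weyl_op1 scale1r mpolyX0 mul1r subrr.
by rewrite weyl_op0 scale0r mul0r subr0.
Qed.

Lemma weyl_ideal_op a p : weyl_ideal a -> weyl_op a p = 0.
Proof.
move=> /asboolP/(_ (fun u => forall q, weyl_op u q = 0)); apply.
- by move=> q; rewrite weyl_op0.
- by move=> u v Ju Jv q; rewrite weyl_opD Ju Jv addr0.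
- by move=> b u Ju q; rewrite weyl_opM Ju weyl_op_r0.
- by move=> u b Ju q; rewrite weyl_opM Ju.
by move=> u Ru q; apply: weyl_op_relator.
Qed.

Lemma weyl_ideal_closed : idealr_closed weyl_ideal.
Proof.
split.
- by apply/asboolP.
- apply/negP=> /(weyl_ideal_op 1)/eqP.
  by rewrite weyl_op1 oner_eq0.
move=> a u v /asboolP Iu /asboolP Iv; apply/asboolP=> J J0 JD JMl JMr JS.
by apply: (JD); [apply: (JMl); apply: (Iu J) | apply: (Iv J)].
Qed.

Lemma weyl_ideal_right a u : weyl_ideal u -> weyl_ideal (u * a).
Proof.
move=> /asboolP Iu; apply/asboolP=> J J0 JD JMl JMr JS.
by apply: (JMr); apply: (Iu J).
Qed.

HB.instance Definition _ := isIdealr.Build F weyl_ideal weyl_ideal_closed.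
HB.instance Definition _ := isRightStable.Build F weyl_ideal weyl_ideal_right.

Definition weyl_alg := quot_alg weyl_ideal.

HB.instance Definition _ := GRing.Algebra.on weyl_alg.

Definition weyl_x (i : 'I_n) : weyl_alg := quot_proj weyl_ideal (x i).
Definition weyl_y (i : 'I_n) : weyl_alg := quot_proj weyl_ideal (y i).

Lemma weyl_relator0 a : weyl_relator a -> quot_proj weyl_ideal a = 0.
Proof.
move=> Ra; rewrite -(linear0 (quot_proj weyl_ideal)); apply/quot_projP.
by rewrite subr0; apply/asboolP=> J _ _ _ _; apply.
Qed.

Lemma weyl_xx i j : bracket (weyl_x i) (weyl_x j) = 0.
Proof.
rewrite /bracket /weyl_x -!rmorphM -rmorphB; apply: weyl_relator0.
by exists i, j; constructor 1.
Qed.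

Lemma weyl_yy i j : bracket (weyl_y i) (weyl_y j) = 0.
Proof.
rewrite /bracket /weyl_y -!rmorphM -rmorphB; apply: weyl_relator0.
by exists i, j; constructor 2.
Qed.

Lemma weyl_yx i j : bracket (weyl_y i) (weyl_x j) = (i == j)%:R.
Proof.
apply/eqP; rewrite -subr_eq0 -(rmorph_nat (quot_proj weyl_ideal)); apply/eqP.
rewrite /bracket /weyl_x /weyl_y -!rmorphM -!rmorphB; apply: weyl_relator0.
by exists i, j; constructor 3.
Qed.

End Weyl.

Section Actions.
Variables (k : fieldType) (H : hopfAlgType k) (A : algType k).

Record hopf_action (act : H -> A -> A) : Prop := HopfAction {
  act_linearl : forall a, linear (act^~ a);
  act_linearr : forall h, linear (act h);
  act_1 : forall a, act 1 a = a;
  act_M : forall g h a, act (g * h) a = act g (act h a);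
  act_mul : forall h a b,
    act h (a * b) = \sum_(p <- comul h) act p.1 a * act p.2 b;
  act_unit : forall h, act h 1 = (counit h)%:A
}.

Definition factors_through_group (act : H -> A -> A) : Prop :=
  exists I : hopfIdeal H,
    (forall h a, h \in (I : pred H) -> act h a = 0) /\
    exists gT : finGroupType, hopf_isomorphic (quot_alg I) (group_alg k gT).

End Actions.

(* Main.v *)
(* Let K be the convolution algebra dual to H.  For a in A and a normal ordered
   monomial m, the coefficient of m in h . a is a functional of h, an element of K.
   Everything rests on the fact that the coefficients of the generators x_i, y_i
   commute with each other in K.

   This is proved by reduction modulo a large prime p: only finitely many constants
   are involved, so the action descends to a finitely generated subring of k, which
   specializes to an algebraically closed field F of characteristic p > dim H.  Over
   F the Weyl algebra has the central subring of p-th powers, and localizing there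
   gives a division algebra D of dimension p^2n over its center Z.  The action
   extends to D; the index of the division subalgebra spanned over Z by the
   invariants is at most dim H < p and divides a power of p, so it is all of D.
   Since Z is stable and commutative, the coefficients of all elements of D are
   combinations of the pairwise commuting coefficients of elements of Z.

   Back over k, let L be the commutative subalgebra of K generated by all coefficients
   and I its annihilator in H, a Hopf ideal killing A.  L is reduced: the trace form
   is H-equivariant, hence its radical is stable under translation, and functions in
   it vanish at 1 because in characteristic 0 a nonzero idempotent has nonzero trace.
   So the characters of L separate L; they are the group-like elements of H / I,
   which therefore form a basis of H / I. *)

From HB Require Import structures.
Require Import Defs.
From mathcomp Require Import all_boot all_algebra all_fingroup all_field.
From mathcomp Require Import generic_quotient ring_quotient boolp.
From mathcomp Require Import finmap monalg ssrcomplements mpoly ring zify.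

Set Implicit Arguments.
Unset Strict Implicit.
Unset Printing Implicit Defensive.

Import GRing.Theory.
Local Open Scope ring_scope.

(* monalg and mpoly both define this notation; mpoly's is meant throughout. *)
Local Notation "{ 'mpoly' T [ n ] }" := (mpoly n T) : type_scope.

(** * Normal ordering in the Weyl algebra *)

(** In characteristic zero the center of the Weyl algebra consists of scalars, so the action sees
    nothing commutative; modulo p the algebra is finite over a large center, which is the reason for
    the detour. What is transported is not a Hopf algebra but finitely many structure constants and
    operators with identities between them, hence [sconsts] and [measuring], which make sense over
    any field and survive specialization. The commutation sought is an equation in the finitely
    generated subring: if it failed, a specialization keeping the nonzero difference alive would
    contradict the case of characteristic p. Besides dim H, the prime must exceed the degrees of the
    symbols involved, since only then are the coefficients of a normal ordered symbol coordinates
    over the center. As the action does not come from a group, the index is bounded by a version of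
    Artin's argument on linear relations of least support, in which the antipode replaces the
    inverse automorphisms. *)

Section WeylModule.
Variables (R k : comNzRingType) (s : {rmorphism R -> k}) (n : nat).
Variables (V : lmodType k) (op : 'I_n + 'I_n -> V -> V).
Hypothesis op_lin : forall l, linear (op l).
Hypothesis op_xx : forall i j v,
  op (inl i) (op (inl j) v) = op (inl j) (op (inl i) v).
Hypothesis op_yy : forall i j v,
  op (inr i) (op (inr j) v) = op (inr j) (op (inr i) v).
Hypothesis op_yx : forall i j v,
  op (inr i) (op (inl j) v) = op (inl j) (op (inr i) v) + (i == j)%:R *: v.

Local Notation F := (free_alg R ('I_n + 'I_n)%type).
Local Notation word w v := (foldr op v (fmonom_val w)).

Lemma foldr_op_linear (w : seq ('I_n + 'I_n)) : linear (fun v => foldr op v w).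
Proof. by elim: w => [//|l w IHw] c u v /=; rewrite IHw op_lin. Qed.

Definition free_act (f : F) (v : V) : V :=
  \sum_(w <- monalg.msupp f) s (monalg.mcoeff w f) *: word w v.

Lemma free_actEw (d : {fset fmonom ('I_n + 'I_n)%type}) f v :
  (monalg.msupp f `<=` d)%fset ->
  free_act f v = \sum_(w <- d) s (monalg.mcoeff w f) *: word w v.
Proof.
move=> sd; rewrite /free_act (big_fset_incl _ sd) //= => w _ nw.
by rewrite mcoeff_outdom // rmorph0 scale0r.
Qed.

Lemma free_actP c f g v :
  free_act (c *: f + g) v = s c *: free_act f v + free_act g v.
Proof.
pose d := (monalg.msupp f `|` monalg.msupp g)%fset.
rewrite (@free_actEw d f) ?fsubsetUl // (@free_actEw d g) ?fsubsetUr //.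
rewrite (@free_actEw d); last first.
  apply: fsubset_trans (monalg.msuppD_le _ _) _.
  by apply: fsetSU; apply: monalg.msuppZ_le.
rewrite scaler_sumr -big_split; apply: eq_bigr => w _ /=.
by rewrite monalg.mcoeffD monalg.mcoeffZ rmorphD rmorphM scalerDl scalerA.
Qed.

Lemma free_act_linear f : linear (free_act f).
Proof.
move=> c u v; rewrite /free_act scaler_sumr -big_split; apply: eq_bigr => w _ /=.
by rewrite foldr_op_linear scalerDr !scalerA mulrC.
Qed.

Lemma free_act0 v : free_act 0 v = 0.
Proof. by rewrite /free_act monalg.msupp0 big_nil. Qed.

Lemma free_actU c w v : free_act (mkmalgU w c) v = s c *: word w v.
Proof.
rewrite (@free_actEw [fset w]%fset) ?msuppU_le // big_seq_fset1.
by rewrite mcoeffUU.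
Qed.

Lemma free_actD f g v : free_act (f + g) v = free_act f v + free_act g v.
Proof. by rewrite -[f]scale1r free_actP rmorph1 !scale1r. Qed.

Lemma free_actZ c f v : free_act (c *: f) v = s c *: free_act f v.
Proof. by rewrite -[_ *: f]addr0 free_actP free_act0 addr0. Qed.

Lemma free_actB f g v : free_act (f - g) v = free_act f v - free_act g v.
Proof. by rewrite free_actD -[- g]scaleN1r free_actZ rmorphN1 scaleN1r. Qed.

Lemma free_act_sum (I : Type) (r : seq I) (f : I -> F) v :
  free_act (\sum_(i <- r) f i) v = \sum_(i <- r) free_act (f i) v.
Proof.
elim: r => [|i r IHr]; first by rewrite !big_nil free_act0.
by rewrite !big_cons -{1}[f i]scale1r free_actP IHr rmorph1 scale1r.
Qed.

Lemma free_actM f g v : free_act (f * g) v = free_act f (free_act g v).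
Proof.
rewrite malgME free_act_sum [RHS]/free_act; apply: eq_bigr => u _.
rewrite free_act_sum /free_act.
pose L : {linear V -> V} := HB.pack (fun v : V => word u v)
  (GRing.isLinear.Build k V V *:%R _ (foldr_op_linear (fmonom_val u))).
rewrite -[foldr _ _ _]/(L _) linear_sum scaler_sumr.
apply: eq_bigr => w _; rewrite -/(free_act _ _) free_actU linearZ /= scalerA.
by rewrite rmorphM [mmul u w]fmmulE -foldr_cat.
Qed.

Lemma free_act_gen l v : free_act (free_gen R l) v = op l v.
Proof. by rewrite /free_gen free_actU rmorph1 scale1r fmuE. Qed.

Lemma free_act1 v : free_act 1 v = v.
Proof. by rewrite free_actU rmorph1 scale1r fm1. Qed.

Lemma free_act_bracket l m v :
  free_act (bracket (free_gen R l) (free_gen R m)) v =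
  op l (op m v) - op m (op l v).
Proof.
rewrite /bracket free_actB; congr (_ - _);
by apply: etrans (free_actM _ _ _) _; rewrite !free_act_gen.
Qed.

Lemma free_act_relator f v : weyl_relator f -> free_act f v = 0.
Proof.
case=> i [j] [] ->; last rewrite free_actB; rewrite free_act_bracket.
- by rewrite op_xx subrr.
- by rewrite op_yy subrr.
rewrite op_yx (addrAC (op _ _)) subrr add0r; case: (i == j).
  by rewrite free_act1 scale1r subrr.
by rewrite free_act0 scale0r subrr.
Qed.

Lemma free_act_ideal f v : weyl_ideal f -> free_act f v = 0.
Proof.
move=> /asboolP/(_ (fun u => forall w, free_act u w = 0)); apply.
- exact: free_act0.
- by move=> u w Ju Jw t; rewrite free_actD Ju Jw addr0.
- move=> b u Ju w; rewrite free_actM Ju.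
  by have := free_act_linear b (-1) 0 0; rewrite scaler0 addr0 scaleN1r addNr.
- by move=> u b Ju w; rewrite free_actM Ju.
by move=> u Ru w; apply: free_act_relator.
Qed.

Definition weyl_act (a : weyl_alg R n) (v : V) : V := free_act (repr a) v.

Lemma weyl_act_proj f v : weyl_act (quot_proj (@weyl_ideal R n) f) v = free_act f v.
Proof.
apply/eqP; rewrite -subr_eq0 -free_actB; apply/eqP; apply: free_act_ideal.
by apply/quot_projP; rewrite quot_proj_repr.
Qed.

Local Notation act := (weyl_act).

Lemma weyl_projE (a : weyl_alg R n) : exists f, a = quot_proj (@weyl_ideal R n) f.
Proof. by exists (repr a); rewrite quot_proj_repr. Qed.

Lemma weyl_actD a b v : act (a + b) v = act a v + act b v.
Proof.
have [f ->] := weyl_projE a; have [g ->] := weyl_projE b.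
by rewrite -rmorphD !weyl_act_proj free_actD.
Qed.

Lemma weyl_actZ c a v : act (c *: a) v = s c *: act a v.
Proof.
by have [f ->] := weyl_projE a; rewrite -linearZ /= !weyl_act_proj free_actZ.
Qed.

Lemma weyl_actM a b v : act (a * b) v = act a (act b v).
Proof.
have [f ->] := weyl_projE a; have [g ->] := weyl_projE b.
by rewrite -rmorphM !weyl_act_proj free_actM.
Qed.

Lemma weyl_act1 v : act 1 v = v.
Proof. by rewrite -(rmorph1 (quot_proj (@weyl_ideal R n))) weyl_act_proj free_act1. Qed.

Lemma weyl_act_x i v : act (weyl_x R i) v = op (inl i) v.
Proof. by rewrite weyl_act_proj free_act_gen. Qed.

Lemma weyl_act_y i v : act (weyl_y R i) v = op (inr i) v.
Proof. by rewrite weyl_act_proj free_act_gen. Qed.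

Lemma weyl_act_linear a : linear (act a).
Proof. exact: free_act_linear. Qed.

End WeylModule.

Opaque weyl_act.

Section WeylInduction.
Variables (R : comNzRingType) (n : nat).

Lemma weyl_ind (P : weyl_alg R n -> Prop) :
  P 1 -> (forall a b, P a -> P b -> P (a + b)) -> (forall c a, P a -> P (c *: a)) ->
  (forall i a, P a -> P (weyl_x R i * a)) ->
  (forall i a, P a -> P (weyl_y R i * a)) -> forall a, P a.
Proof.
move=> P1 PD PZ Px Py a; have [f ->] := weyl_projE a.
have P0 : P 0 by rewrite -(scale0r 1); apply: PZ.
rewrite (monalgE f) raddf_sum /=; elim/big_ind: _ => // w _.
rewrite -[monalg.mcoeff w f]mulr1 -[monalg.mcoeff w f * 1]/(_ *: (1 : R^o)).
have -> : mkmalgU w (monalg.mcoeff w f *: (1 : R^o)) =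
    monalg.mcoeff w f *: (mkmalgU w 1 : free_alg R ('I_n + 'I_n)%type).
  by apply/malgP => u; rewrite monalg.mcoeffZ !mcoeffU mulrnAr.
rewrite linearZ; apply: PZ; case: w => w.
elim: w => [|l w IHw]; first by rewrite -fmoneE rmorph1.
have -> : mkmalgU (FMonom (l :: w)) 1 =
    free_gen R l * mkmalgU (FMonom w) 1 :> free_alg R ('I_n + 'I_n)%type.
  rewrite /free_gen malgM_def fgmulUU mulr1; congr (mkmalgU _ _).
  by rewrite [mmul _ _]fmmulE !fmuE.
by rewrite rmorphM; case: l => i; [apply: Px | apply: Py].
Qed.

End WeylInduction.

(** * Symbols: normal ordered elements as polynomials in 2n variables *)

Section Symbol.
Variables (R : comNzRingType) (n : nat).
Local Notation P := {mpoly R[n + n]}.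
Local Notation A := (weyl_alg R n).
Implicit Types (i j : 'I_n) (w : P) (a b : A).

Local Notation xi i := ('X_(lshift n i) : P).
Local Notation eta i := ('X_(rshift n i) : P).

(** Left multiplication by a generator, read on normal ordered polynomials: moving [y_i] to the
    right past the x-part of a monomial leaves behind its derivative in [x_i]. *)
Definition symbol_op (l : 'I_n + 'I_n) (w : P) : P :=
  match l with
  | inl i => xi i * w
  | inr i => eta i * w + mderiv (lshift n i) w
  end.

Lemma mderiv_var (u v : 'I_(n + n)) : mderiv u ('X_v : P) = (u == v)%:R.
Proof.
rewrite mderivX mnm1E eq_sym; case: eqP => [->|_]; last by rewrite scale0r.
suff -> : (U_(v) - U_(v))%MM = 0%MM :> 'X_{1..n + n} by rewrite scale1r mpolyX0.
by apply/mnmP => l; rewrite mnmBE mnm0E subnn.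
Qed.

Lemma symbol_op_lin l : linear (symbol_op l).
Proof.
case: l => i c u v /=; rewrite mulrDr -scalerAr // linearP /= scalerDr.
by rewrite !addrA (addrAC _ _ (c *: _)).
Qed.

Lemma symbol_op_xx i j w :
  symbol_op (inl i) (symbol_op (inl j) w) = symbol_op (inl j) (symbol_op (inl i) w).
Proof. exact: mulrCA. Qed.

Lemma symbol_op_yy i j w :
  symbol_op (inr i) (symbol_op (inr j) w) = symbol_op (inr j) (symbol_op (inr i) w).
Proof.
rewrite /= !mderivD !mderivM !mderiv_var !eq_lrshift !mul0r !add0r !mulrDr.
rewrite (mderiv_comm (lshift n i)) !addrA; congr (_ + _).
by rewrite mulrCA addrAC.
Qed.

Lemma symbol_op_yx i j w :
  symbol_op (inr i) (symbol_op (inl j) w) =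
  symbol_op (inl j) (symbol_op (inr i) w) + (i == j)%:R *: w.
Proof.
rewrite /= mderivM mderiv_var eq_lshift -mul_mpolyC mpolyC_nat; ring.
Qed.

Definition symbol_act : A -> P -> P := weyl_act (@idfun R) symbol_op.
Definition symbol (a : A) : P := symbol_act a 1.

Lemma symbol_actD a b w : symbol_act (a + b) w = symbol_act a w + symbol_act b w.
Proof.
exact: (weyl_actD _ symbol_op_lin symbol_op_xx symbol_op_yy symbol_op_yx).
Qed.

Lemma symbol_actZ c a w : symbol_act (c *: a) w = c *: symbol_act a w.
Proof.
exact: (weyl_actZ _ symbol_op_lin symbol_op_xx symbol_op_yy symbol_op_yx).
Qed.

Lemma symbol_actM a b w : symbol_act (a * b) w = symbol_act a (symbol_act b w).
Proof.
exact: (weyl_actM _ symbol_op_lin symbol_op_xx symbol_op_yy symbol_op_yx).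
Qed.

Lemma symbol_act1 w : symbol_act 1 w = w.
Proof.
exact: (weyl_act1 _ symbol_op_lin symbol_op_xx symbol_op_yy symbol_op_yx).
Qed.

Lemma symbol_act_x i w : symbol_act (weyl_x R i) w = xi i * w.
Proof.
exact: (weyl_act_x _ symbol_op_lin symbol_op_xx symbol_op_yy symbol_op_yx).
Qed.

Lemma symbol_act_y i w :
  symbol_act (weyl_y R i) w = eta i * w + mderiv (lshift n i) w.
Proof.
exact: (weyl_act_y _ symbol_op_lin symbol_op_xx symbol_op_yy symbol_op_yx).
Qed.

Lemma symbol_act_linear a : linear (symbol_act a).
Proof. exact: weyl_act_linear symbol_op_lin a. Qed.

HB.instance Definition _ a :=
  GRing.isLinear.Build R P P *:%R (symbol_act a) (symbol_act_linear a).

Lemma symbol_linear : linear symbol.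
Proof. by move=> c a b; rewrite /symbol symbol_actD symbol_actZ. Qed.

HB.instance Definition _ := GRing.isLinear.Build R A P *:%R symbol symbol_linear.

Lemma symbolD a b : symbol (a + b) = symbol a + symbol b.
Proof. exact: symbol_actD. Qed.

Lemma symbolZ c a : symbol (c *: a) = c *: symbol a.
Proof. exact: symbol_actZ. Qed.

Lemma symbolM a b : symbol (a * b) = symbol_act a (symbol b).
Proof. exact: symbol_actM. Qed.

Lemma symbol1 : symbol 1 = 1.
Proof. exact: symbol_act1. Qed.

(** Meant for right multiplications, which commute with left ones: once an operator on polynomials
    commutes with the generators, its value at 1 determines it on all symbols. This yields
    [symbol_My] and [symbol_Mx]. *)
Lemma symbol_act_comm (T : {additive P -> P}) :
  (forall (c : R) w, T (c *: w) = c *: T w) ->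
  (forall l w, T (symbol_op l w) = symbol_op l (T w)) ->
  forall a w, T (symbol_act a w) = symbol_act a (T w).
Proof.
move=> TZ Tl a; elim/weyl_ind: a => [|a b IHa IHb|c a IH|i a IH|i a IH] w.
- by rewrite !symbol_act1.
- by rewrite !symbol_actD raddfD IHa IHb.
- by rewrite !symbol_actZ TZ IH.
- by rewrite !symbol_actM !symbol_act_x -IH; apply: (Tl (inl i)).
- by rewrite !symbol_actM !symbol_act_y -IH; apply: (Tl (inr i)).
Qed.

Definition weyl_gen (u : 'I_(n + n)) : A :=
  match split u with inl i => weyl_x R i | inr i => weyl_y R i end.

(* Normal ordering: the variables x stand to the left of the variables y. *)
Definition weyl_quant (w : P) : A := mmap (GRing.in_alg A) weyl_gen w.

Lemma weyl_quant_linear : linear weyl_quant.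
Proof. by move=> c u w; rewrite /weyl_quant raddfD /= mmapZ mulr_algl. Qed.

HB.instance Definition _ :=
  GRing.isLinear.Build R P A *:%R weyl_quant weyl_quant_linear.

Lemma weyl_quantD u w : weyl_quant (u + w) = weyl_quant u + weyl_quant w.
Proof. exact: linearD. Qed.

Lemma weyl_quantZ c w : weyl_quant (c *: w) = c *: weyl_quant w.
Proof. exact: linearZ. Qed.

Definition xpow (m : 'X_{1..n}) : A := mmap1 (@weyl_x R n) m.
Definition ypow (m : 'X_{1..n}) : A := mmap1 (@weyl_y R n) m.
Definition mnm_l (m : 'X_{1..n + n}) : 'X_{1..n} := [multinom m (lshift n i) | i < n].
Definition mnm_r (m : 'X_{1..n + n}) : 'X_{1..n} := [multinom m (rshift n i) | i < n].

Lemma weyl_quantX m : weyl_quant 'X_[m] = xpow (mnm_l m) * ypow (mnm_r m).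
Proof.
rewrite /weyl_quant mmapX /mmap1 big_split_ord /=; congr (_ * _);
  apply: eq_bigr => i _; rewrite mnmE /weyl_gen.
  by rewrite -[lshift n i]/(unsplit (inl i)) unsplitK.
by rewrite -[rshift n i]/(unsplit (inr i)) unsplitK.
Qed.

Lemma mmap1D (B : nzRingType) (g : 'I_n -> B) (m1 m2 : 'X_{1..n}) :
  (forall i j, GRing.comm (g i) (g j)) ->
  mmap1 g (m1 + m2) = mmap1 g m1 * mmap1 g m2.
Proof.
move=> cg; rewrite /mmap1 -prodrM_comm.
  by apply: eq_bigr => i _; rewrite mnmDE exprD.
by move=> i j _ _; apply/commrX/commr_sym/commrX/cg.
Qed.

Lemma weyl_x_comm i j : GRing.comm (weyl_x R i) (weyl_x R j).
Proof. by apply/eqP; rewrite -subr_eq0; apply/eqP/weyl_xx. Qed.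

Lemma weyl_y_comm i j : GRing.comm (weyl_y R i) (weyl_y R j).
Proof. by apply/eqP; rewrite -subr_eq0; apply/eqP/weyl_yy. Qed.

Lemma weyl_yxE i j : weyl_y R i * weyl_x R j = weyl_x R j * weyl_y R i + (i == j)%:R.
Proof. by apply/eqP; rewrite addrC -subr_eq; apply/eqP/weyl_yx. Qed.

Lemma xpowS i m : xpow (U_(i) + m) = weyl_x R i * xpow m.
Proof. by rewrite /xpow mmap1D ?mmap1U //; apply: weyl_x_comm. Qed.

Lemma ypowS i m : ypow (U_(i) + m) = weyl_y R i * ypow m.
Proof. by rewrite /ypow mmap1D ?mmap1U //; apply: weyl_y_comm. Qed.

Lemma mnm_ind (Q : 'X_{1..n} -> Prop) :
  Q 0%MM -> (forall i m, Q m -> Q (U_(i) + m)%MM) -> forall m, Q m.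
Proof.
move=> Q0 QS m; have [d] := ubnP (mdeg m); elim: d m => // d IHd m lt_md.
have [-> //|m0] := eqVneq m 0%MM; have [i mi] : exists i, m i != 0%N.
  apply/existsP; apply: contraNT m0; rewrite negb_exists => /forallP z.
  by apply/eqP/mnmP => i; rewrite mnm0E; apply/eqP; have := z i; rewrite negbK.
have e : (U_(i) + (m - U_(i)) = m)%MM by rewrite addmC submK // lep1mP.
rewrite -e; apply: QS; apply: IHd.
by move: lt_md; rewrite -{1}e mdegD mdeg1 add1n ltnS.
Qed.

Lemma weyl_y_xpow i m :
  weyl_y R i * xpow m = xpow m * weyl_y R i + (m i)%:R *: xpow (m - U_(i)).
Proof.
elim/mnm_ind: m => [|j m IHm].
  by rewrite mnm0E scale0r addr0 /xpow !mmap11 mulr1 mul1r.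
rewrite xpowS mulrA weyl_yxE mulrDl -!mulrA IHm mulrDr -addrA; congr (_ + _).
rewrite mnmDE mnm1E -scalerAr eq_sym; case: eqVneq => [->|nji].
  rewrite mul1r [(U_(i) + m)%MM]addmC addmK natrD scalerDl scale1r addrC.
  congr (_ + _); have [-> | mi] := eqVneq (m i) 0%N; first by rewrite !scale0r.
  by rewrite -xpowS addmC submK // lep1mP.
rewrite mul0r addr0 add0n; have [-> | mi] := eqVneq (m i) 0%N; first by rewrite !scale0r.
by rewrite -xpowS addmBA // lep1mP.
Qed.

Lemma weyl_quant_x i w : weyl_quant (xi i * w) = weyl_x R i * weyl_quant w.
Proof.
elim/mpolyind: w => [|c m w _ _ IHw]; first by rewrite !(mulr0, linear0).
rewrite mulrDr !weyl_quantD IHw mulrDr -scalerAr !weyl_quantZ -scalerAr.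
congr (_ *: _ + _).
rewrite -mpolyXD !weyl_quantX mulrA -xpowS; congr (_ * _).
  by congr xpow; apply/mnmP => j; rewrite !(mnmE, mnmDE, mnm1E) eq_lshift.
by congr ypow; apply/mnmP => j; rewrite !(mnmE, mnmDE, mnm1E) eq_lrshift.
Qed.

Lemma weyl_quant_y i w :
  weyl_quant (eta i * w + mderiv (lshift n i) w) = weyl_y R i * weyl_quant w.
Proof.
elim/mpolyind: w => [|c m w _ _ IHw]; first by rewrite !(mulr0, addr0, linear0).
rewrite mulrDr linearP addrACA -scalerAr -scalerDr weyl_quantD IHw.
rewrite [weyl_quant (_ + w)]weyl_quantD mulrDr.
congr (_ + _); rewrite !weyl_quantZ -scalerAr; congr (_ *: _).
rewrite /= mderivX weyl_quantD weyl_quantZ -mpolyXD !weyl_quantX mulrA weyl_y_xpow mulrDl.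
rewrite -mulrA -ypowS -scalerAl; congr (_ * _ + _); first 1 last.
- by congr ypow; apply/mnmP => j; rewrite !(mnmE, mnmDE, mnm1E) eq_rshift.
- rewrite mnmE; congr (_ *: (_ * _)).
    by congr xpow; apply/mnmP => j; rewrite !(mnmE, mnmBE, mnm1E) eq_lshift.
  by congr ypow; apply/mnmP => j; rewrite !(mnmE, mnmBE, mnm1E) eq_lrshift subn0.
by congr xpow; apply/mnmP => j; rewrite !(mnmE, mnmDE, mnm1E) eq_rlshift.
Qed.

(** At [w = 1] this recovers [a] from its symbol. *)
Lemma weyl_quant_act a w : weyl_quant (symbol_act a w) = a * weyl_quant w.
Proof.
elim/weyl_ind: a w => [|a b IHa IHb|c a IH|i a IH|i a IH] w.
- by rewrite symbol_act1 mul1r.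
- by rewrite symbol_actD weyl_quantD IHa IHb mulrDl.
- by rewrite symbol_actZ weyl_quantZ IH scalerAl.
- by rewrite symbol_actM symbol_act_x weyl_quant_x IH mulrA.
- by rewrite symbol_actM symbol_act_y weyl_quant_y IH mulrA.
Qed.

Lemma weyl_quant1 : weyl_quant 1 = 1.
Proof. by rewrite -mpolyX0 /weyl_quant mmapX mmap11. Qed.

Lemma symbolK : cancel symbol weyl_quant.
Proof. by move=> a; rewrite weyl_quant_act weyl_quant1 mulr1. Qed.

Lemma symbol_xpow m w :
  symbol_act (xpow m) w = \prod_(i < n) xi i ^+ m i * w.
Proof.
elim/mnm_ind: m => [|i m IHm].
  by rewrite /xpow mmap11 symbol_act1 big1 ?mul1r // => i _; rewrite mnm0E.
rewrite xpowS symbol_actM symbol_act_x IHm mulrA; congr (_ * _).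
rewrite [RHS](bigD1 i) //= mnmDE mnm1E eqxx exprS -mulrA; congr (_ * _).
rewrite (bigD1 i) //=; congr (_ * _); apply: eq_bigr => j nj.
by rewrite mnmDE mnm1E eq_sym (negPf nj).
Qed.

Lemma symbol_ypow m : symbol (ypow m) = \prod_(i < n) eta i ^+ m i.
Proof.
elim/mnm_ind: m => [|i m IHm].
  by rewrite /ypow mmap11 symbol1 big1 // => i _; rewrite mnm0E.
rewrite ypowS symbolM symbol_act_y IHm.
have -> : (\prod_(j < n) eta j ^+ m j)^`M(lshift n i) = 0 :> P.
  apply: (big_ind (fun u : P => u^`M(lshift n i) = 0)) => [|u v Hu Hv|j _].
  - by rewrite -mpolyC1 mderivC.
  - by rewrite mderivM Hu Hv mul0r mulr0 addr0.
  elim: (m j) => [|d IHd]; first by rewrite expr0 -mpolyC1 mderivC.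
  by rewrite exprS mderivM mderiv_var eq_lrshift mul0r add0r IHd mulr0.
rewrite addr0 [RHS](bigD1 i) //= mnmDE mnm1E eqxx exprS -mulrA; congr (_ * _).
rewrite (bigD1 i) //=; congr (_ * _); apply: eq_bigr => j nj.
by rewrite mnmDE mnm1E eq_sym (negPf nj).
Qed.

Lemma weyl_quantK : cancel weyl_quant symbol.
Proof.
move=> w; elim/mpolyind: w => [|c m w _ _ IHw]; first by rewrite !linear0.
rewrite weyl_quantD weyl_quantZ symbolD symbolZ.
apply: (congr2 (fun u v => c *: u + v)); last exact: IHw.
rewrite weyl_quantX symbolM symbol_xpow symbol_ypow mpolyXE_id big_split_ord /=.
by congr (_ * _); apply: eq_bigr => i _; rewrite mnmE.
Qed.

Lemma symbol_My a i : symbol (a * weyl_y R i) = eta i * symbol a.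
Proof.
rewrite symbolM /symbol symbol_act_y -mpolyC1 mderivC addr0 mpolyC1.
pose T : {linear P -> P} := HB.pack ( *%R (eta i)) (GRing.isLinear.Build R P P *:%R
  ( *%R (eta i)) (fun c u v => etrans (mulrDr _ _ _) (congr1 (+%R^~ _) (esym (scalerAr _ _ _))))).
apply/esym; apply: (@symbol_act_comm T) => [c u|l u]; first exact: linearZ.
case: l => j /=; first by rewrite mulrCA.
by rewrite mulrDr mulrCA mderivM mderiv_var eq_lrshift mul0r add0r.
Qed.

Lemma symbol_Mx a i :
  symbol (a * weyl_x R i) = xi i * symbol a + mderiv (rshift n i) (symbol a).
Proof.
pose r w := xi i * w + mderiv (rshift n i) w.
have rl : linear r.
  move=> c u v; rewrite /r linearP mulrDr -scalerAr scalerDr !addrA; congr (_ + _).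
  by rewrite addrAC.
pose T : {linear P -> P} := HB.pack r (GRing.isLinear.Build R P P *:%R r rl).
rewrite symbolM -[RHS]/(T (symbol_act a 1)) (@symbol_act_comm T) => [|c u|l u].
- by rewrite /symbol symbol_act_x /= /r mulr1 -mpolyC1 mderivC addr0.
- exact: linearZ.
rewrite /= /r; case: l => j /=.
  by rewrite mderivM mderiv_var eq_rlshift mul0r; ring.
rewrite !mderivD !mderivM !mderiv_var eq_rshift eq_lshift (eq_sym j i).
by rewrite (mderiv_comm (lshift n j)); ring.
Qed.

End Symbol.

(* Abstract interface to the Weyl algebra, so that unification never unfolds its
   construction as a quotient of the free algebra. *)
Record weyl_model (R : comNzRingType) (n : nat) := WeylModel {
  wm_alg :> algType R;
  wm_x : 'I_n -> wm_alg;
  wm_y : 'I_n -> wm_alg;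
  wm_symbol : {linear wm_alg -> {mpoly R[n + n]}};
  wm_quant : {linear {mpoly R[n + n]} -> wm_alg};
  wm_symbolK : cancel wm_symbol wm_quant;
  wm_quantK : cancel wm_quant wm_symbol;
  wm_symbol1 : wm_symbol 1 = 1;
  wm_symbol_xM : forall i a, wm_symbol (wm_x i * a) = 'X_(lshift n i) * wm_symbol a;
  wm_symbol_yM : forall i a, wm_symbol (wm_y i * a) =
    'X_(rshift n i) * wm_symbol a + mderiv (lshift n i) (wm_symbol a);
  wm_symbol_My : forall i a, wm_symbol (a * wm_y i) = 'X_(rshift n i) * wm_symbol a;
  wm_symbol_Mx : forall i a, wm_symbol (a * wm_x i) =
    'X_(lshift n i) * wm_symbol a + mderiv (rshift n i) (wm_symbol a);
  wm_ind : forall P : wm_alg -> Prop,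
    P 1 -> (forall a b, P a -> P b -> P (a + b)) -> (forall c a, P a -> P (c *: a)) ->
    (forall i a, P a -> P (wm_x i * a)) -> (forall i a, P a -> P (wm_y i * a)) ->
    forall a, P a
}.

Definition weyl_alg_model (R : comNzRingType) (n : nat) : weyl_model R n :=
  @WeylModel R n (weyl_alg R n) (@weyl_x R n) (@weyl_y R n)
    (@symbol R n) (@weyl_quant R n) (@symbolK R n) (@weyl_quantK R n)
    (@symbol1 R n)
    (fun i a => etrans (symbolM (weyl_x R i) a) (symbol_act_x i (symbol a)))
    (fun i a => etrans (symbolM (weyl_y R i) a) (symbol_act_y i (symbol a)))
    (fun i a => symbol_My a i) (fun i a => symbol_Mx a i) (@weyl_ind R n).

(** * Change of scalars and zero divisors *)

Section SymbolAct.
Variables (R : comNzRingType) (n : nat) (A : weyl_model R n).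
Local Notation P := {mpoly R[n + n]}.
Implicit Types (a b : A) (w : P).

Definition symact a w : P := wm_symbol A (a * wm_quant A w).

Lemma symactD a b w : symact (a + b) w = symact a w + symact b w.
Proof. by rewrite /symact mulrDl linearD. Qed.

Lemma symactZ c a w : symact (c *: a) w = c *: symact a w.
Proof. by rewrite /symact -scalerAl linearZ. Qed.

Lemma symact1 w : symact 1 w = w.
Proof. by rewrite /symact mul1r wm_quantK. Qed.

Lemma symactM a b w : symact (a * b) w = symact a (symact b w).
Proof. by rewrite /symact wm_symbolK mulrA. Qed.

Lemma symact_x i w : symact (wm_x A i) w = 'X_(lshift n i) * w.
Proof. by rewrite /symact wm_symbol_xM wm_quantK. Qed.

Lemma symact_y i w :
  symact (wm_y A i) w = 'X_(rshift n i) * w + mderiv (lshift n i) w.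
Proof. by rewrite /symact wm_symbol_yM wm_quantK. Qed.

Lemma symact_symbol a b : symact a (wm_symbol A b) = wm_symbol A (a * b).
Proof. by rewrite /symact wm_symbolK. Qed.

Lemma wm_quant1 : wm_quant A 1 = 1.
Proof. by rewrite -(wm_symbol1 A) wm_symbolK. Qed.

Lemma symact_one a : symact a 1 = wm_symbol A a.
Proof. by rewrite /symact wm_quant1 mulr1. Qed.

Lemma symact_linear a : linear (symact a).
Proof. by move=> c u w; rewrite /symact linearP mulrDr -scalerAr linearP. Qed.

HB.instance Definition _ a := GRing.isLinear.Build R P P *:%R (symact a) (symact_linear a).

Lemma wm_symbol_x i : wm_symbol A (wm_x A i) = 'X_(lshift n i).
Proof. by rewrite -symact_one symact_x mulr1. Qed.

Lemma wm_symbol_y i : wm_symbol A (wm_y A i) = 'X_(rshift n i).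
Proof. by rewrite -symact_one symact_y mulr1 -mpolyC1 mderivC addr0. Qed.

Lemma wm_symbol_inj : injective (wm_symbol A).
Proof. exact: can_inj (wm_symbolK (w := A)). Qed.

Lemma wm_symbolD a b : wm_symbol A (a + b) = wm_symbol A a + wm_symbol A b.
Proof. exact: linearD. Qed.

Lemma wm_symbolZ c a : wm_symbol A (c *: a) = c *: wm_symbol A a.
Proof. exact: linearZ. Qed.

End SymbolAct.

Section WeylMap.
Variables (R k : comNzRingType) (s : {rmorphism R -> k}) (n : nat).
Variables (A : weyl_model R n) (B : weyl_model k n).

Lemma map_mpoly_mderiv N (i : 'I_N) (w : {mpoly R[N]}) :
  map_mpoly s (mderiv i w) = mderiv i (map_mpoly s w).
Proof.
by apply/mpolyP => m; rewrite !(mcoeff_map_mpoly, mcoeff_deriv) raddfMn.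
Qed.

Lemma map_mpolyU N (i : 'I_N) : map_mpoly s 'X_i = 'X_i.
Proof. exact: map_mpolyX. Qed.

(** On symbols the change of scalars is coefficientwise, hence visibly additive; that it respects
    products is recovered through [symact_map], by induction on the left factor. *)
Definition wm_map (a : A) : B := wm_quant B (map_mpoly s (wm_symbol A a)).

Lemma wm_symbol_map a : wm_symbol B (wm_map a) = map_mpoly s (wm_symbol A a).
Proof. exact: wm_quantK. Qed.

Lemma wm_mapD a b : wm_map (a + b) = wm_map a + wm_map b.
Proof. by rewrite /wm_map linearD rmorphD linearD. Qed.

Lemma wm_mapZ c a : wm_map (c *: a) = s c *: wm_map a.
Proof. by rewrite /wm_map linearZ /= map_mpolyZ linearZ. Qed.

Lemma wm_map0 : wm_map 0 = 0.
Proof. by rewrite -(scale0r 0) wm_mapZ rmorph0 scale0r. Qed.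

Lemma wm_map1 : wm_map 1 = 1.
Proof. by rewrite /wm_map wm_symbol1 rmorph1 wm_quant1. Qed.

Lemma symact_map a w :
  symact (wm_map a) (map_mpoly s w) = map_mpoly s (symact a w).
Proof.
elim/wm_ind: a w => [|a b IHa IHb|c a IH|i a IH|i a IH] w.
- by rewrite wm_map1 !symact1.
- by rewrite wm_mapD !symactD IHa IHb rmorphD.
- by rewrite wm_mapZ !symactZ IH map_mpolyZ.
- have -> : wm_map (wm_x A i * a) = wm_x B i * wm_map a.
    apply: wm_symbol_inj; rewrite wm_symbol_xM !wm_symbol_map wm_symbol_xM.
    by rewrite rmorphM /= map_mpolyU.
  by rewrite !symactM !symact_x IH rmorphM /= map_mpolyU.
have -> : wm_map (wm_y A i * a) = wm_y B i * wm_map a.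
  apply: wm_symbol_inj; rewrite wm_symbol_yM !wm_symbol_map wm_symbol_yM.
  by rewrite rmorphD rmorphM /= map_mpolyU map_mpoly_mderiv.
rewrite !symactM !symact_y IH rmorphD rmorphM /= map_mpolyU.
by rewrite map_mpoly_mderiv.
Qed.

Lemma wm_mapM a b : wm_map (a * b) = wm_map a * wm_map b.
Proof.
apply: wm_symbol_inj; rewrite -symact_symbol !wm_symbol_map symact_map.
by rewrite symact_symbol.
Qed.

Lemma wm_map_x i : wm_map (wm_x A i) = wm_x B i.
Proof.
by apply: wm_symbol_inj; rewrite wm_symbol_map !wm_symbol_x map_mpolyU.
Qed.

Lemma wm_map_y i : wm_map (wm_y A i) = wm_y B i.
Proof.
by apply: wm_symbol_inj; rewrite wm_symbol_map !wm_symbol_y map_mpolyU.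
Qed.

End WeylMap.

(** * The Bernstein filtration *)

Section Graded.
Variables (R : idomainType) (n : nat) (A : weyl_model R n).
Local Notation P := {mpoly R[n + n]}.
Local Notation symbol := (wm_symbol A).
Implicit Types (a b : A) (w : P).

(** Filtration by total degree, all x and y having degree 1: up to lower degree, [a] acts as
    multiplication by its symbol. The offsets come from [msize], which is the degree plus one, and 0
    for the zero polynomial. *)
Definition symbol_filtered (a : A) (D : nat) : Prop :=
  (msize (symbol a) <= D.+1)%N /\
  forall (w : P) k, (msize w <= k)%N ->
    (msize (symact a w - symbol a * w) <= (D + k).-1)%N.

Lemma msize_gt0 (u : P) : u != 0 -> (0 < msize u)%N.
Proof. by rewrite lt0n msize_poly_eq0. Qed.

Lemma msizeM_leq (u w : P) d k :
  (msize u <= d.+1)%N -> (msize w <= k)%N -> (msize (u * w) <= d + k)%N.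
Proof.
have [-> _ _|u0] := eqVneq u 0; first by rewrite mul0r msize0.
have [-> _ _|w0 hu hw] := eqVneq w 0; first by rewrite mulr0 msize0.
rewrite msizeM // -subn1 leq_subLR addnA add1n.
exact: leq_add.
Qed.

Lemma msizeD_leq (u w : P) k :
  (msize u <= k)%N -> (msize w <= k)%N -> (msize (u + w) <= k)%N.
Proof. by move=> hu hw; apply: leq_trans (msizeD_le _ _) _; rewrite geq_max hu. Qed.

Lemma msize_mderiv (i : 'I_(n + n)) (w : P) : (msize (mderiv i w) <= msize w)%N.
Proof.
rewrite msizeE; apply/bigmax_leqP_seq => m; rewrite mcoeff_msupp mcoeff_deriv => nz _.
have : (m + U_(i))%MM \in msupp w.
  by rewrite mcoeff_msupp; apply: contraNneq nz => ->; rewrite mul0rn.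
by move/msize_mdeg_lt; rewrite mdegD mdeg1; lia.
Qed.

Lemma filtered_x i : symbol_filtered (wm_x A i) 1.
Proof.
split=> [|w k hw]; rewrite wm_symbol_x ?msizeX ?mdeg1 //.
by rewrite symact_x subrr msize0.
Qed.

Lemma filtered_y i : symbol_filtered (wm_y A i) 1.
Proof.
split=> [|w k hw]; rewrite wm_symbol_y ?msizeX ?mdeg1 //.
rewrite symact_y addrC addKr.
exact: leq_trans (msize_mderiv _ _) hw.
Qed.

Lemma filtered1 : symbol_filtered 1 0.
Proof.
by split=> [|w k hw]; rewrite ?wm_symbol1 ?msize1 // symact1 mul1r subrr msize0.
Qed.

Lemma filteredW a D D' : (D <= D')%N -> symbol_filtered a D -> symbol_filtered a D'.
Proof.
move=> leD [h1 h2]; split=> [|w k hw]; first exact: leq_trans h1 _.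
by apply: leq_trans (h2 w k hw) _; lia.
Qed.

Lemma filteredD a b D :
  symbol_filtered a D -> symbol_filtered b D -> symbol_filtered (a + b) D.
Proof.
move=> [a1 a2] [b1 b2]; split=> [|w k hw]; rewrite wm_symbolD; first exact: msizeD_leq.
by rewrite symactD mulrDl opprD addrACA msizeD_leq ?a2 ?b2.
Qed.

Lemma filteredZ c a D : symbol_filtered a D -> symbol_filtered (c *: a) D.
Proof.
move=> [a1 a2]; split=> [|w k hw]; rewrite wm_symbolZ.
  exact: leq_trans (msizeZ_le _ _) a1.
rewrite symactZ -scalerAl -scalerBr.
exact: leq_trans (msizeZ_le _ _) (a2 w k hw).
Qed.

Lemma filteredM a b D E :
  symbol_filtered a D -> symbol_filtered b E -> symbol_filtered (a * b) (D + E).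
Proof.
move=> [a1 a2] [b1 b2].
have main w k : (msize w <= k)%N ->
    (msize (symact (a * b) w - symbol a * (symbol b * w)) <= (D + E + k).-1)%N.
  move=> hw; rewrite symactM; set u := symact b w.
  have -> : symact a u - symbol a * (symbol b * w) =
      symbol a * (u - symbol b * w) + (symact a u - symbol a * u).
    by rewrite mulrBr [RHS]addrC addrA subrK.
  have hbw := msizeM_leq b1 hw; have hd := b2 w k hw.
  have hu : (msize u <= E + k)%N.
    rewrite -[u](subrK (symbol b * w)); apply: msizeD_leq => //.
    by apply: leq_trans hd _; lia.
  apply: msizeD_leq; last by have := a2 u _ hu; rewrite addnA.
  (* A nonzero error term makes [(E + k).-1] positive; only then is [D + (E + k).-1] bounded by
     [(D + E + k).-1]. *)
  have [-> |nz] := eqVneq (u - symbol b * w) 0; first by rewrite mulr0 msize0.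
  apply: leq_trans (msizeM_leq a1 hd) _.
  by have pos : (0 < (E + k).-1)%N := leq_trans (msize_gt0 nz) hd; lia.
have h1 : (msize (symbol (a * b)%R - symbol a * symbol b)%R <= D + E)%N.
  by have := main 1 1%N; rewrite msize1 mulr1 symact_one addn1; apply.
split=> [|w k hw].
  rewrite -[symbol (a * b)](subrK (symbol a * symbol b)); apply: msizeD_leq.
    by apply: leq_trans h1 _.
  by apply: leq_trans (msizeM_leq a1 b1) _; rewrite addnS.
have -> : symact (a * b) w - symbol (a * b) * w =
    (symact (a * b) w - symbol a * (symbol b * w)) +
    (- (symbol (a * b) - symbol a * symbol b)) * w.
  by rewrite mulNr mulrBl opprB -mulrA addrA subrK.
apply: msizeD_leq; first exact: main.
have [-> |nz] := eqVneq w 0; first by rewrite mulr0 msize0.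
have [-> |nz'] := eqVneq (symbol (a * b) - symbol a * symbol b) 0.
  by rewrite oppr0 mul0r msize0.
rewrite mulNr msizeN msizeM //; apply: leq_trans (_ : (D + E + k).-1 <= _)%N => //.
rewrite -!subn1 leq_sub2r //; exact: leq_add.
Qed.

Lemma filtered_sum I (r : seq I) (Q : pred I) (f : I -> A) D :
  (forall i, Q i -> symbol_filtered (f i) D) ->
  symbol_filtered (\sum_(i <- r | Q i) f i) D.
Proof.
move=> hf; elim/big_ind: _ => [|a b|i Qi]; [|exact: filteredD|exact: hf].
by split=> [|w k hw]; rewrite ?linear0 ?msize0 // /symact !mul0r linear0 subrr msize0.
Qed.

Lemma filteredN a D : symbol_filtered a D -> symbol_filtered (- a) D.
Proof. by rewrite -scaleN1r; apply: filteredZ. Qed.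

(* The monomial eta_i X^m is the symbol of y_i q(X^m) up to a term of degree
   smaller by two. *)
Lemma filtered_quantX m : symbol_filtered (wm_quant A 'X_[m]) (mdeg m).
Proof.
have [d] := ubnP (mdeg m); elim: d m => // d IHd m lt_md.
have [->|m0] := eqVneq m 0%MM.
  by rewrite mpolyX0 wm_quant1 mdeg0; apply: filtered1.
have [u mu] : exists u, m u != 0%N.
  apply/existsP; apply: contraNT m0; rewrite negb_exists => /forallP z.
  by apply/eqP/mnmP => i; rewrite mnm0E; apply/eqP; have := z i; rewrite negbK.
have e : (U_(u) + (m - U_(u)) = m)%MM by rewrite addmC submK // lep1mP.
move: (m - U_(u))%MM e => m' e; rewrite -e mdegD mdeg1.
have lt_m' : (mdeg m' < d)%N by move: lt_md; rewrite -e mdegD mdeg1; lia.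
rewrite mpolyXD; case: (split_ordP u) => i ->.
  have -> : wm_quant A ('X_(lshift n i) * 'X_[m']) = wm_x A i * wm_quant A 'X_[m'].
    by apply: wm_symbol_inj; rewrite wm_symbol_xM !wm_quantK.
  by apply: filteredM; [apply: filtered_x | apply: IHd].
have -> : wm_quant A ('X_(rshift n i) * 'X_[m']) =
    wm_y A i * wm_quant A 'X_[m'] - wm_quant A (mderiv (lshift n i) 'X_[m']).
  by apply: wm_symbol_inj; rewrite linearB wm_symbol_yM !wm_quantK addrK.
apply: filteredD; first by apply: filteredM; [apply: filtered_y | apply: IHd].
apply: filteredN; rewrite mderivX linearZ; apply: filteredZ.
have le_m : (mdeg (m' - U_(lshift n i)) <= mdeg m')%N by apply: mdegB.
apply: filteredW (IHd _ _); first by rewrite (leq_trans le_m) ?leq_addl.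
exact: leq_ltn_trans lt_m'.
Qed.

Lemma filtered_symbol a : symbol_filtered a (msize (symbol a)).-1.
Proof.
rewrite -{1}[a](wm_symbolK (w := A)) {1}(mpolyE (symbol a)) linear_sum big_seq.
apply: filtered_sum => m /msize_mdeg_lt lt_m; rewrite linearZ; apply: filteredZ.
by apply: filteredW (filtered_quantX m); move: lt_m; lia.
Qed.

(** Over a domain the degree of a product of polynomials is the sum of the degrees, while the error
    term has strictly smaller degree and cannot cancel the leading part. *)
Lemma symact_domain a w : symact a w = 0 -> a = 0 \/ w = 0.
Proof.
move=> e; have [->|a0] := eqVneq a 0; first by left.
right; apply/eqP; apply: contraTT isT => w0.
have sa0 : symbol a != 0.
  by apply: contraNneq a0 => sa; apply/eqP/wm_symbol_inj; rewrite sa linear0.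
have [_ /(_ w _ (leqnn _))] := filtered_symbol a.
rewrite e sub0r msizeN msizeM //.
move: (msize_gt0 sa0) (msize_gt0 w0).
case: (msize (symbol a)) => // x _; case: (msize w) => // y _.
by rewrite addnS /= addnS ltnn.
Qed.

Lemma wm_mul_eq0 a b : a * b = 0 -> a = 0 \/ b = 0.
Proof.
move=> e; have : symact a (symbol b) = 0 by rewrite symact_symbol e linear0.
case/symact_domain => [->|sb]; [by left | right].
by apply: wm_symbol_inj; rewrite sb linear0.
Qed.

End Graded.

(** * Algebras with given structure constants *)

(* Structure constants e_i e_j = \sum_l sc_c l i j e_l of an algebra with unit
   \sum_i sc_u i e_i; equivalently those of the dual coalgebra. *)
Record sconsts (B : fieldType) := SConsts {
  sc_I : finType;
  sc_c : sc_I -> sc_I -> sc_I -> B;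
  sc_u : sc_I -> B;
  sc_assoc : forall l i j k, \sum_s sc_c s i j * sc_c l s k = \sum_s sc_c s j k * sc_c l i s;
  sc_unitl : forall l j, \sum_i sc_u i * sc_c l i j = (l == j)%:R;
  sc_unitr : forall l i, \sum_j sc_u j * sc_c l i j = (l == i)%:R;
  sc_nontriv : exists i, sc_u i != 0
}.

Section SumLemmas.
Variables (B : fieldType) (S : sconsts B) (V : lmodType B).
Local Notation I := (sc_I S).
Local Notation c := (@sc_c B S).
Local Notation u := (@sc_u B S).

(** Coassociativity in the form used for iterated coproducts: [T] is an arbitrary family with values
    in a module. *)
Lemma sc_assoc_sum (T : I -> I -> I -> V) l :
  \sum_i \sum_s c l i s *: (\sum_j \sum_k c s j k *: T i j k) =
  \sum_s \sum_k c l s k *: (\sum_i \sum_j c s i j *: T i j k).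
Proof.
transitivity (\sum_i \sum_j \sum_k (\sum_s c s j k * c l i s) *: T i j k).
  apply: eq_bigr => i _.
  under eq_bigr => s _ do rewrite scaler_sumr; rewrite exchange_big.
  apply: eq_bigr => j _ /=.
  under eq_bigr => s _ do rewrite scaler_sumr; rewrite exchange_big.
  apply: eq_bigr => k _ /=; rewrite scaler_suml.
  by apply: eq_bigr => s _; rewrite scalerA mulrC.
transitivity (\sum_i \sum_j \sum_k (\sum_s c s i j * c l s k) *: T i j k).
  by do 3!(apply: eq_bigr => ? _); rewrite sc_assoc.
rewrite [RHS]exchange_big /=.
under [RHS]eq_bigr => k _.
  under eq_bigr => s _ do rewrite scaler_sumr.
  rewrite exchange_big /=.
  under eq_bigr => i _.
    under eq_bigr => s _ do rewrite scaler_sumr.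
    rewrite exchange_big /=.
    under eq_bigr => j _.
      under eq_bigr => s _ do rewrite scalerA mulrC.
      rewrite -scaler_suml.
      over.
    over.
  over.
rewrite [RHS]exchange_big; apply: eq_bigr => i _ /=.
by rewrite [RHS]exchange_big.
Qed.

Lemma sc_unitl_sum (t : I -> V) l : \sum_i \sum_j c l i j *: (u i *: t j) = t l.
Proof.
rewrite exchange_big (bigD1 l) //= [X in _ + X]big1 => [|j nj].
  under eq_bigr => i _ do rewrite scalerA mulrC.
  by rewrite -scaler_suml sc_unitl eqxx scale1r addr0.
under eq_bigr => i _ do rewrite scalerA mulrC.
by rewrite -scaler_suml sc_unitl eq_sym (negPf nj) scale0r.
Qed.

Lemma sc_unitr_sum (t : I -> V) l : \sum_i \sum_j c l i j *: (u j *: t i) = t l.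
Proof.
rewrite (bigD1 l) //= [X in _ + X]big1 => [|i ni].
  under eq_bigr => j _ do rewrite scalerA mulrC.
  by rewrite -scaler_suml sc_unitr eqxx scale1r addr0.
under eq_bigr => j _ do rewrite scalerA mulrC.
by rewrite -scaler_suml sc_unitr eq_sym (negPf ni) scale0r.
Qed.

End SumLemmas.

(** One product with two readings. For [A] the ground field it is the algebra with the given
    structure constants; in general it is the convolution algebra of linear maps from the dual
    coalgebra to [A], a map being given by its values on the basis. *)
Definition scalg (B : fieldType) (S : sconsts B) (A : algType B) := {ffun sc_I S -> A}.

Section ScAlgebra.
Variables (B : fieldType) (S : sconsts B) (A : algType B).
Local Notation I := (sc_I S).
Local Notation c := (@sc_c B S).
Local Notation u := (@sc_u B S).
Local Notation T := (scalg S A).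

HB.instance Definition _ := GRing.Lmodule.on T.

Definition scalg_one : T := [ffun i => (u i)%:A].
Definition scalg_mul (f g : T) : T := [ffun l => \sum_i \sum_j c l i j *: (f i * g j)].

Lemma scalg_mulA : associative scalg_mul.
Proof.
move=> f g h; apply/ffunP => l; rewrite !ffunE.
transitivity (\sum_i \sum_s c l i s *: (\sum_j \sum_k c s j k *: (f i * g j * h k))).
  do 2!(apply: eq_bigr => ? _); congr (_ *: _); rewrite ffunE mulr_sumr.
  apply: eq_bigr => j _; rewrite mulr_sumr; apply: eq_bigr => k _.
  by rewrite -scalerAr mulrA.
rewrite sc_assoc_sum; do 2!(apply: eq_bigr => ? _); congr (_ *: _).
rewrite ffunE mulr_suml; apply: eq_bigr => i _; rewrite mulr_suml.
by apply: eq_bigr => j _; rewrite -scalerAl.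
Qed.

Lemma scalg_mul1r : left_id scalg_one scalg_mul.
Proof.
move=> f; apply/ffunP => l; rewrite ffunE -[RHS](sc_unitl_sum f).
by do 2!(apply: eq_bigr => ? _); rewrite ffunE mulr_algl.
Qed.

Lemma scalg_mulr1 : right_id scalg_one scalg_mul.
Proof.
move=> f; apply/ffunP => l; rewrite ffunE -[RHS](sc_unitr_sum f).
by do 2!(apply: eq_bigr => ? _); rewrite ffunE mulr_algr.
Qed.

Lemma scalg_mulDl : left_distributive scalg_mul +%R.
Proof.
move=> f g h; apply/ffunP => l; rewrite !ffunE -big_split; apply: eq_bigr => i _ /=.
by rewrite -big_split; apply: eq_bigr => j _ /=; rewrite ffunE mulrDl scalerDr.
Qed.

Lemma scalg_mulDr : right_distributive scalg_mul +%R.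
Proof.
move=> f g h; apply/ffunP => l; rewrite !ffunE -big_split; apply: eq_bigr => i _ /=.
by rewrite -big_split; apply: eq_bigr => j _ /=; rewrite ffunE mulrDr scalerDr.
Qed.

Lemma scalg_oner_neq0 : scalg_one != 0.
Proof.
have [i ui] := sc_nontriv S; apply/eqP => /ffunP/(_ i)/eqP.
by rewrite !ffunE scaler_eq0 (negPf ui) oner_eq0.
Qed.

HB.instance Definition _ := GRing.Zmodule_isNzRing.Build T
  scalg_mulA scalg_mul1r scalg_mulr1 scalg_mulDl scalg_mulDr scalg_oner_neq0.

Lemma scalgME (f g : T) l : (f * g) l = \sum_i \sum_j c l i j *: (f i * g j).
Proof. by rewrite ffunE. Qed.

Lemma scalg1E l : (1 : T) l = (u l)%:A.
Proof. by rewrite ffunE. Qed.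

Lemma scalgDE (f g : T) l : (f + g) l = f l + g l.
Proof. by rewrite ffunE. Qed.

Lemma scalgZE b (f : T) l : (b *: f) l = b *: f l.
Proof. by rewrite ffunE. Qed.

Lemma scalg_scaleAl b (f g : T) : b *: (f * g) = (b *: f) * g.
Proof.
apply/ffunP => l; rewrite !ffunE scaler_sumr; apply: eq_bigr => i _ /=.
rewrite scaler_sumr; apply: eq_bigr => j _; rewrite ffunE -scalerAl !scalerA.
by rewrite mulrC.
Qed.

Lemma scalg_scaleAr b (f g : T) : b *: (f * g) = f * (b *: g).
Proof.
apply/ffunP => l; rewrite !ffunE scaler_sumr; apply: eq_bigr => i _ /=.
rewrite scaler_sumr; apply: eq_bigr => j _; rewrite ffunE -scalerAr !scalerA.
by rewrite mulrC.
Qed.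

HB.instance Definition _ := GRing.Lmodule_isLalgebra.Build B T scalg_scaleAl.
HB.instance Definition _ := GRing.Lalgebra_isAlgebra.Build B T scalg_scaleAr.

End ScAlgebra.

Section ScFalgebra.
Variables (B : fieldType) (S : sconsts B) (A : falgType B).
Local Notation T := (scalg S A).

HB.instance Definition _ := Vector.copy T {ffun sc_I S -> A}.
HB.instance Definition _ := Algebra_isFalgebra.Build B T.

End ScFalgebra.

Lemma dim_scalg (B : fieldType) (S : sconsts B) (A : falgType B) :
  \dim {: scalg S A} = (#|sc_I S| * \dim {: A})%N.
Proof. by rewrite !dimvf. Qed.

(** * Localization at central elements *)

Record is_fraction_field (P : idomainType) (K : fieldType) (fr : {rmorphism P -> K}) : Prop :=
  IsFractionField {
    fr_inj : injective fr;
    fr_frac : forall x : K, exists z r, z != 0 /\ fr z * x = fr r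
  }.

Section FractionField.
Variables (P : idomainType) (K : fieldType) (fr : {rmorphism P -> K}).
Hypothesis frP : is_fraction_field fr.

Lemma fr_eq0 z : (fr z == 0) = (z == 0).
Proof. by rewrite -(rmorph0 fr) (inj_eq (fr_inj frP)). Qed.

Lemma common_denominator (J : finType) (x : J -> K) :
  exists2 z, z != 0 & exists r : J -> P, forall j, fr z * x j = fr (r j).
Proof.
have H (s : seq J) : exists2 z, z != 0 & forall j, j \in s -> exists r, fr z * x j = fr r.
  elim: s => [|j s [z z0 IHs]]; first by exists 1; rewrite ?oner_neq0.
  have [y [r [y0 yr]]] := fr_frac frP (x j).
  exists (y * z); first by rewrite mulf_neq0.
  move=> l; rewrite inE => /predU1P [->|/IHs [t zt]].
    by exists (z * r); rewrite !rmorphM mulrAC yr mulrC.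
  by exists (y * t); rewrite !rmorphM -mulrA zt.
have [z z0 Hz] := H (enum J); exists z => //.
have r j : {r | fr z * x j == fr r}.
  by apply: sigW; have [|r e] := Hz j; rewrite ?mem_enum //; exists r; apply/eqP.
by exists (fun j => sval (r j)) => j; apply/eqP; apply: (svalP (r j)).
Qed.

End FractionField.

Section CentralLocalization.
Variables (A : nzRingType) (P : idomainType) (zc : {rmorphism P -> A}).
Variables (J : finType) (mu : J -> A) (ka : J -> A -> P).
Hypothesis zcC : forall r a, zc r * a = a * zc r.
Hypothesis kaD : forall l a b, ka l (a + b) = ka l a + ka l b.
Hypothesis kaZ : forall l r a, ka l (zc r * a) = r * ka l a.
Hypothesis kaE : forall a, a = \sum_j zc (ka j a) * mu j.
Hypothesis ka_mu : forall l j, ka l (mu j) = (l == j)%:R.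
Hypothesis A_domain : forall a b : A, a * b = 0 -> a = 0 \/ b = 0.
Variables (K : fieldType) (fr : {rmorphism P -> K}).
Hypothesis frP : is_fraction_field fr.

Lemma ka0 l : ka l 0 = 0.
Proof. by rewrite -(mul0r 0) -(rmorph0 zc) kaZ mul0r. Qed.

Lemma ka_sum l I (r : seq I) (f : I -> A) :
  ka l (\sum_(i <- r) f i) = \sum_(i <- r) ka l (f i).
Proof.
by elim: r => [|i r IHr]; rewrite ?big_nil ?ka0 // !big_cons kaD IHr.
Qed.

Definition loc_c l i j : K := fr (ka l (mu i * mu j)).
Definition loc_u i : K := fr (ka i 1).

Lemma kaM l a b : ka l (a * b) = \sum_i \sum_j ka i a * ka j b * ka l (mu i * mu j).
Proof.
rewrite {1}[a]kaE mulr_suml ka_sum; apply: eq_bigr => i _.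
rewrite {1}[b]kaE mulr_sumr ka_sum; apply: eq_bigr => j _.
rewrite -mulrA kaZ [mu i * _]mulrA -zcC -!mulrA kaZ; congr (_ * _).
Qed.

Lemma ka_inj a b : (forall j, ka j a = ka j b) -> a = b.
Proof. by move=> e; rewrite [a]kaE [b]kaE; apply: eq_bigr => j _; rewrite e. Qed.

Lemma loc_assoc l i j k :
  \sum_s loc_c s i j * loc_c l s k = \sum_s loc_c s j k * loc_c l i s.
Proof.
pose g a b := \sum_s fr (ka s a) * fr (ka l (mu s * b)).
transitivity (fr (ka l (mu i * mu j * mu k))); last rewrite -mulrA.
  rewrite [mu i * mu j]kaE mulr_suml ka_sum rmorph_sum; apply: eq_bigr => s _ /=.
  by rewrite -mulrA kaZ rmorphM.
rewrite [mu j * mu k]kaE mulr_sumr ka_sum rmorph_sum; apply: eq_bigr => s _ /=.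
by rewrite mulrA -zcC -mulrA kaZ rmorphM.
Qed.

Lemma loc_unitl l j : \sum_i loc_u i * loc_c l i j = (l == j)%:R.
Proof.
rewrite -(rmorph_nat fr) -ka_mu -[mu j]mul1r [X in X * mu j]kaE mulr_suml ka_sum.
by rewrite rmorph_sum; apply: eq_bigr => i _; rewrite -rmorphM -mulrA kaZ.
Qed.

Lemma loc_unitr l i : \sum_j loc_u j * loc_c l i j = (l == i)%:R.
Proof.
rewrite -(rmorph_nat fr) -ka_mu -[mu i]mulr1 [X in _ * X]kaE mulr_sumr ka_sum.
rewrite rmorph_sum; apply: eq_bigr => j _.
by rewrite -rmorphM mulrA -zcC -mulrA kaZ.
Qed.

Lemma loc_nontriv : exists i, loc_u i != 0.
Proof.
apply/existsP; apply: contraT; rewrite negb_exists => /forallP z.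
have : 1 = 0 :> A.
  apply: ka_inj => j; rewrite ka0; apply/eqP; have := z j.
  by rewrite negbK fr_eq0.
by move/eqP; rewrite oner_eq0.
Qed.

Definition loc_sconsts : sconsts K := SConsts loc_assoc loc_unitl loc_unitr loc_nontriv.
(** This is the tensor product of [A] with [K] over [P]: since [A] is free over the central subring
    with basis [mu], it suffices to read the products of basis elements with coefficients in [K]. *)
Definition loc : falgType K := scalg loc_sconsts K^o.

Definition to_loc (a : A) : loc := [ffun j => fr (ka j a)] : scalg loc_sconsts K^o.
Local Notation lam := to_loc.

Lemma to_locE a j : (lam a : scalg loc_sconsts K^o) j = fr (ka j a).
Proof. by rewrite ffunE. Qed.

Definition loc_coord (j : J) (d : loc) : K := (d : scalg loc_sconsts K^o) j.

Lemma loc_coordD j d e : loc_coord j (d + e) = loc_coord j d + loc_coord j e.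
Proof. by rewrite /loc_coord scalgDE. Qed.

Lemma loc_coordZ j x d : loc_coord j (x *: d) = x * loc_coord j d.
Proof. by rewrite /loc_coord scalgZE. Qed.

Lemma loc_coord_lam j a : loc_coord j (lam a) = fr (ka j a).
Proof. exact: to_locE. Qed.

Lemma to_loc_zmod : zmod_morphism lam.
Proof.
move=> a b; apply/ffunP => j; rewrite !ffunE -rmorphB; congr (fr _).
have -> : - b = zc (-1) * b by rewrite rmorphN1 mulN1r.
by rewrite kaD kaZ mulN1r.
Qed.

Lemma to_loc_monoid : monoid_morphism lam.
Proof.
split=> [|a b]; apply/ffunP => j.
  by rewrite ffunE scalg1E /= /GRing.scale /= mulr1.
rewrite to_locE scalgME kaM rmorph_sum; apply: eq_bigr => i _ /=.
rewrite rmorph_sum; apply: eq_bigr => l _ /=.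
by rewrite !to_locE !rmorphM mulrC.
Qed.

HB.instance Definition _ := GRing.isZmodMorphism.Build A loc lam to_loc_zmod.
HB.instance Definition _ := GRing.isMonoidMorphism.Build A loc lam to_loc_monoid.

Lemma to_locM a b : lam (a * b) = lam a * lam b.
Proof. exact: rmorphM. Qed.

Lemma to_loc0 : lam 0 = 0.
Proof. exact: raddf0. Qed.

Lemma to_loc_inj : injective lam.
Proof.
move=> a b /ffunP e; apply: ka_inj => j; apply: (fr_inj frP).
by have := e j; rewrite !to_locE.
Qed.

Lemma to_locZ r a : lam (zc r * a) = fr r *: lam a.
Proof. by apply/ffunP => j; rewrite scalgZE !to_locE kaZ rmorphM. Qed.

Lemma to_loc_frac (J' : finType) (d : J' -> loc) :
  exists2 z, z != 0 & exists a : J' -> A, forall i, fr z *: d i = lam (a i).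
Proof.
pose x (ij : J' * J) : K := (d ij.1 : scalg loc_sconsts K^o) ij.2.
have [z z0 [r Hr]] := common_denominator frP x.
exists z => //; exists (fun i => \sum_j zc (r (i, j)) * mu j) => i.
apply/ffunP => j; rewrite scalgZE to_locE.
have -> : fr z *: (d i : scalg loc_sconsts K^o) j = fr (r (i, j)) by rewrite -Hr.
congr (fr _); rewrite ka_sum (bigD1 j) //= big1 => [|l nl].
  by rewrite kaZ ka_mu eqxx mulr1 addr0.
by rewrite kaZ ka_mu eq_sym (negPf nl) mulr0.
Qed.

Lemma to_loc_frac1 (d : loc) : exists z a, z != 0 /\ fr z *: d = lam a.
Proof.
have [z z0 [a Ha]] := to_loc_frac (fun _ : 'I_1 => d).
by exists z, (a ord0); split; rewrite ?Ha.
Qed.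

Lemma loc_domain (d e : loc) : d * e = 0 -> (d == 0) || (e == 0).
Proof.
move=> de; have [y [a [y0 ya]]] := to_loc_frac1 d.
have [z [b [z0 zb]]] := to_loc_frac1 e.
have ab : a * b = 0.
  apply: to_loc_inj; rewrite to_locM to_loc0 -ya -zb -scalerAl -scalerAr de.
  by rewrite !scaler0.
have [a0|b0] := A_domain ab; apply/orP; [left | right].
  by have := congr1 lam a0; rewrite -ya to_loc0 => /eqP; rewrite scaler_eq0 fr_eq0 // (negPf y0).
by have := congr1 lam b0; rewrite -zb to_loc0 => /eqP; rewrite scaler_eq0 fr_eq0 // (negPf z0).
Qed.

Lemma loc_field : GRing.field_axiom loc.
Proof. by apply: Falgebra_FieldMixin => d e /loc_domain. Qed.

Lemma dim_loc : \dim {: loc} = #|J|.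
Proof. by rewrite dim_scalg regular_fullv dimv1 muln1. Qed.

End CentralLocalization.

(** * Measurings and their invariants *)

(** A subspace of largest dimension inside [Q] exhausts [Q], since a further vector would enlarge
    it. *)
Lemma vspace_of_pred (K : fieldType) (V : vectType K) (Q : V -> Prop) :
  Q 0 -> (forall u v, Q u -> Q v -> Q (u + v)) -> (forall c u, Q u -> Q (c *: u)) ->
  exists U : {vspace V}, forall v, v \in U <-> Q v.
Proof.
move=> Q0 QD QZ.
pose T n := `[< exists2 U : {vspace V}, \dim U = n & forall v, v \in U -> Q v >].
have T0 : exists n, T n.
  by exists 0%N; apply/asboolP; exists 0%VS => [|v]; rewrite ?dimv0 // memv0 => /eqP ->.
have Tb n : T n -> (n <= \dim {: V})%N.
  by case/asboolP => U <- _; apply/dimvS/subvf.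
case: (ex_maxnP T0 Tb) => n /asboolP [U dU QU] maxn.
exists U => v; split=> [|Qv]; first exact: QU.
apply: contraT => nv; suff : (n < n)%N by rewrite ltnn.
apply: leq_trans (maxn (\dim (U + <[v]>)) _).
  rewrite -dU dimv_disjoint_sum; last first.
    apply/eqP; rewrite -subv0; apply/subvP => w /memv_capP [Uw /vlineP [c wc]].
    rewrite memv0 wc scaler_eq0; apply: contraR nv; rewrite negb_or => /andP [c0 _].
    by rewrite -[v](scalerK c0) -wc memvZ.
  by rewrite dim_vline; case: eqP nv => [->|_ _]; rewrite ?mem0v // addn1.
apply/asboolP; exists (U + <[v]>)%VS => // w /memv_addP [u Uu [_ /vlineP [c ->] ->]].
by apply: QD; [apply: QU | apply: QZ].
Qed.

Lemma dim_ffun (K : fieldType) (J : finType) (V : vectType K) :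
  \dim {: {ffun J -> V}} = (#|J| * \dim {: V})%N.
Proof. by rewrite !dimvf. Qed.

Lemma lker0_surj (K : fieldType) (V : vectType K) (f : 'End(V)) :
  lker f == 0%VS -> forall v, exists w, f w = v.
Proof.
move=> kf v; have /memv_imgP [w _ ->] : v \in limg f; last by exists w.
suff /eqP -> : limg f == fullv by rewrite memvf.
by rewrite -dimv_leqif_eq ?subvf ?limg_dim_eq // (eqP kf) capv0.
Qed.

(* Operators E_l, l a basis element of a coalgebra, measuring the algebra A, with
   a convolution inverse sigma (the operators of the antipode) and such that the
   span of the E_l contains the identity and is stable under left composition
   with the sigma_v. *)
Record measuring (F : fieldType) (S : sconsts F) (A : algType F) := Measuring {
  ms_E : sc_I S -> A -> A;
  ms_s : sc_I S -> sc_I S -> F;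
  ms_t : sc_I S -> sc_I S -> sc_I S -> F;
  ms_v : sc_I S -> F;
  ms_sigma := fun l a => \sum_h ms_s l h *: ms_E h a;
  ms_E_lin : forall l, linear (ms_E l);
  ms_mul : forall l a b, ms_E l (a * b) = \sum_i \sum_j sc_c l i j *: (ms_E i a * ms_E j b);
  ms_1 : forall l, ms_E l 1 = (sc_u l)%:A;
  ms_E_sigma : forall l a, \sum_i \sum_j sc_c l i j *: ms_E i (ms_sigma j a) = sc_u l *: a;
  ms_sigma_E : forall l a, \sum_i \sum_j sc_c l i j *: ms_sigma i (ms_E j a) = sc_u l *: a;
  ms_span_sigma : forall v h a, ms_sigma v (ms_E h a) = \sum_l ms_t v h l *: ms_E l a;
  ms_span_id : forall a, a = \sum_l ms_v l *: ms_E l a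
}.

Section BaseChange.
Variables (F K : fieldType) (io : {rmorphism F -> K}) (S : sconsts F).
Local Notation I := (sc_I S).

Lemma base_assoc (l i j k : I) :
  \sum_s io (sc_c s i j) * io (sc_c l s k) = \sum_s io (sc_c s j k) * io (sc_c l i s).
Proof.
transitivity (io (\sum_s sc_c s i j * sc_c l s k)); last rewrite sc_assoc;
  by rewrite rmorph_sum; apply: eq_bigr => s _ /=; rewrite rmorphM.
Qed.

Lemma base_unitl (l j : I) : \sum_i io (sc_u i) * io (sc_c l i j) = (l == j)%:R.
Proof.
rewrite -(rmorph_nat io) -sc_unitl rmorph_sum.
by apply: eq_bigr => s _ /=; rewrite rmorphM.
Qed.

Lemma base_unitr (l i : I) : \sum_j io (sc_u j) * io (sc_c l i j) = (l == i)%:R.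
Proof.
rewrite -(rmorph_nat io) -sc_unitr rmorph_sum.
by apply: eq_bigr => s _ /=; rewrite rmorphM.
Qed.

Lemma base_nontriv : exists i : I, io (sc_u i) != 0.
Proof. by have [i ui] := sc_nontriv S; exists i; rewrite fmorph_eq0. Qed.

Definition base_change : sconsts K := SConsts base_assoc base_unitl base_unitr base_nontriv.

End BaseChange.

(** * Extension of a measuring to the localization, and Artin's argument *)

Section Extension.
Variables (F : fieldType) (S : sconsts F) (A : algType F) (M : measuring S A).
Hypothesis A_domain : forall a b : A, a * b = 0 -> a = 0 \/ b = 0.
Variables (P : idomainType) (zc : {rmorphism P -> A}).
Hypothesis zcC : forall r a, zc r * a = a * zc r.
Variables (K : fieldType) (fr : {rmorphism P -> K}) (frP : is_fraction_field fr).
Variables (D : falgType K) (lam : {rmorphism A -> D}).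
Hypothesis lam_inj : injective lam.
Hypothesis lamZ : forall r a, lam (zc r * a) = fr r *: lam a.
Hypothesis lam_frac : forall (J : finType) (d : J -> D),
  exists2 z, z != 0 & exists a : J -> A, forall i, fr z *: d i = lam (a i).
Hypothesis D_field : GRing.field_axiom D.
Variable io : {rmorphism F -> K}.
Hypothesis lam_io : forall c a, lam (c *: a) = io c *: lam a.

Local Notation I := (sc_I S).
Local Notation c := (@sc_c F S).
Local Notation u := (@sc_u F S).
Local Notation E := (ms_E M).
Local Notation sigma := (ms_sigma M).
Local Notation SK := (base_change io S).
Local Notation RD := (scalg SK D).

Lemma lam_sumc (f : I -> I -> A) l :
  lam (\sum_i \sum_j c l i j *: f i j) = \sum_i \sum_j io (c l i j) *: lam (f i j).
Proof.
rewrite rmorph_sum; apply: eq_bigr => i _; rewrite rmorph_sum.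
by apply: eq_bigr => j _ /=; rewrite lam_io.
Qed.

Lemma ms_E0 l : E l 0 = 0.
Proof. by have := ms_E_lin M l (-1) 0 0; rewrite scaler0 addr0 scaleN1r addNr. Qed.

Lemma ms_sigma_lin l : linear (sigma l).
Proof.
move=> x a b; rewrite /ms_sigma scaler_sumr -big_split; apply: eq_bigr => h _ /=.
by rewrite ms_E_lin scalerDr !scalerA mulrC.
Qed.

Lemma ms_sigma0 l : sigma l 0 = 0.
Proof. by have := ms_sigma_lin l (-1) 0 0; rewrite scaler0 addr0 scaleN1r addNr. Qed.

Lemma ms_EZ l x a : E l (x *: a) = x *: E l a.
Proof. by rewrite -[_ *: a]addr0 ms_E_lin ms_E0 addr0. Qed.

Lemma ms_sigmaZ l x a : sigma l (x *: a) = x *: sigma l a.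
Proof. by rewrite -[_ *: a]addr0 ms_sigma_lin ms_sigma0 addr0. Qed.

Lemma ms_E_sum l (J : Type) (r : seq J) (f : J -> A) :
  E l (\sum_(i <- r) f i) = \sum_(i <- r) E l (f i).
Proof.
elim: r => [|i r IHr]; rewrite ?big_nil ?ms_E0 // !big_cons.
by rewrite -[f i]scale1r ms_E_lin IHr !scale1r.
Qed.

Lemma ms_sigma_sum l (J : Type) (r : seq J) (f : J -> A) :
  sigma l (\sum_(i <- r) f i) = \sum_(i <- r) sigma l (f i).
Proof.
elim: r => [|i r IHr]; rewrite ?big_nil ?ms_sigma0 // !big_cons.
by rewrite -[f i]scale1r ms_sigma_lin IHr !scale1r.
Qed.

(** The whole measuring as one map into a convolution algebra, where the product rule [ms_mul]
    becomes multiplicativity. *)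
Definition rho0 (a : A) : RD := [ffun l : I => lam (E l a)].

Lemma rho0E a l : rho0 a l = lam (E l a).
Proof. by rewrite ffunE. Qed.

Lemma rho0_zmod : zmod_morphism rho0.
Proof.
move=> a b; apply/ffunP => l; rewrite !ffunE -rmorphB addrC -scaleN1r ms_E_lin.
by rewrite scaleN1r addrC.
Qed.

Lemma rho0_monoid : monoid_morphism rho0.
Proof.
split=> [|a b]; apply/ffunP => l.
  by rewrite rho0E ms_1 lam_io rmorph1 scalg1E.
rewrite rho0E ms_mul lam_sumc scalgME; do 2!(apply: eq_bigr => ? _).
by rewrite !rho0E rmorphM.
Qed.

HB.instance Definition _ := GRing.isZmodMorphism.Build A RD rho0 rho0_zmod.
HB.instance Definition _ := GRing.isMonoidMorphism.Build A RD rho0 rho0_monoid.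

Lemma rho0B a b : rho0 (a - b) = rho0 a - rho0 b.
Proof. exact: raddfB. Qed.

Lemma lamB a b : lam (a - b) = lam a - lam b.
Proof. exact: raddfB. Qed.

Lemma rho0M a b : rho0 (a * b) = rho0 a * rho0 b.
Proof. exact: rmorphM. Qed.

(* Writing psi_l = \sum c E_i(t_j) with t_j = \sum c sigma(psi), the product
   rho0 s * psi becomes \sum c E_i(s t_j). *)
Lemma rho0_regularA s (psi : I -> A) : s != 0 ->
  (forall l, \sum_i \sum_j c l i j *: (E i s * psi j) = 0) -> forall l, psi l = 0.
Proof.
move=> s0 H; pose t l := \sum_i \sum_j c l i j *: sigma i (psi j).
have psiE l : psi l = \sum_i \sum_j c l i j *: E i (t j).
  transitivity (\sum_i \sum_s c l i s *: \sum_j \sum_k c s j k *: E i (sigma j (psi k))).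
    rewrite sc_assoc_sum -[LHS](sc_unitl_sum psi) exchange_big [RHS]exchange_big.
    apply: eq_bigr => k _; apply: eq_bigr => i _; congr (_ *: _).
    by rewrite ms_E_sigma.
  do 2!(apply: eq_bigr => ? _); congr (_ *: _); rewrite ms_E_sum.
  apply: eq_bigr => j _; rewrite ms_E_sum; apply: eq_bigr => k _.
  by rewrite ms_EZ.
have st l : \sum_i \sum_j c l i j *: E i (s * t j) = 0.
  rewrite -[RHS](H l).
  transitivity (\sum_v \sum_k c l v k *: \sum_i \sum_j c v i j *: (E i s * E j (t k))).
    by do 2!(apply: eq_bigr => ? _); rewrite ms_mul.
  rewrite -sc_assoc_sum; do 2!(apply: eq_bigr => ? _); congr (_ *: _).
  rewrite psiE mulr_sumr; apply: eq_bigr => j _; rewrite mulr_sumr.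
  by apply: eq_bigr => k _; rewrite scalerAr.
have t0 k : t k = 0.
  have : s * t k = 0.
    rewrite -[LHS](sc_unitl_sum (fun k => s * t k)).
    transitivity (\sum_v \sum_k' c k v k' *: \sum_i \sum_j c v i j *: sigma i (E j (s * t k'))).
      by do 2!(apply: eq_bigr => ? _); rewrite ms_sigma_E.
    rewrite -sc_assoc_sum big1 // => i _; rewrite big1 // => v _.
    transitivity (c k i v *: sigma i (\sum_j \sum_k' c v j k' *: E j (s * t k'))).
      congr (_ *: _); rewrite ms_sigma_sum; apply: eq_bigr => j _.
      by rewrite ms_sigma_sum; apply: eq_bigr => k' _; rewrite ms_sigmaZ.
    by rewrite st ms_sigma0 scaler0.
  by case/A_domain => // s00; rewrite s00 eqxx in s0.
move=> l; rewrite psiE big1 // => i _; rewrite big1 // => j _.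
by rewrite t0 ms_E0 scaler0.
Qed.

Lemma rho0_regular s (psi : RD) : s != 0 -> rho0 s * psi = 0 -> psi = 0.
Proof.
move=> s0 H; have [z z0 [a Ha]] := lam_frac psi.
have za l : a l = 0.
  apply: (rho0_regularA s0) l => l; apply: lam_inj; rewrite lam_sumc raddf0.
  have /ffunP/(_ l) := congr1 (GRing.scale (fr z)) H.
  rewrite scalgZE scalgME scaler0 ffunE scaler_sumr => e; rewrite -[RHS]e.
  apply: eq_bigr => i _; rewrite scaler_sumr; apply: eq_bigr => j _.
  by rewrite rho0E rmorphM -Ha -scalerAr !scalerA mulrC.
apply/ffunP => l; rewrite [RHS]ffunE; have /eqP := Ha l.
by rewrite za raddf0 scaler_eq0 fr_eq0 // (negPf z0) => /eqP.
Qed.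

Lemma zc_neq0 z : z != 0 -> zc z != 0.
Proof.
move=> z0; apply/eqP => e; have /eqP := lamZ z 1; rewrite e mul0r raddf0 rmorph1.
by rewrite eq_sym scaler_eq0 fr_eq0 // (negPf z0) oner_eq0.
Qed.

(** The extension must send the fraction [a / z] to a solution of [rho0 (zc z) * phi = rho0 a]. Left
    multiplication by a regular element is injective on a finite dimensional space, hence onto;
    centrality of [zc z] makes one solution serve all fractions that represent [d]. *)
Lemma rho_ex (d : D) : exists phi : RD, forall z a,
  fr z *: d = lam a -> rho0 (zc z) * phi = rho0 a.
Proof.
have [z0 nz0 [a0 Ha0]] := lam_frac (fun _ : 'I_1 => d).
have {Ha0}Ha0 := Ha0 ord0; move: {a0}(a0 ord0) Ha0 => a0 Ha0.
have ker0 : lker (amull (rho0 (zc z0))) == 0%VS.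
  apply/lker0P => x y; rewrite !lfunE /= => /eqP; rewrite -subr_eq0 -mulrBr => /eqP e.
  by apply/eqP; rewrite -subr_eq0; apply/eqP; apply: rho0_regular e; apply: zc_neq0.
have [phi] := lker0_surj ker0 (rho0 a0); rewrite lfunE /= => Hphi.
exists phi => z a Ha; apply/eqP; rewrite -subr_eq0; apply/eqP.
apply: (@rho0_regular (zc z0)); first exact: zc_neq0.
rewrite mulrBr mulrA -rho0M zcC rho0M -mulrA Hphi -!rho0M.
apply/eqP; rewrite subr_eq0; apply/eqP; congr (rho0 _); apply: lam_inj.
by rewrite !lamZ -Ha -Ha0 !scalerA mulrC.
Qed.

(** Only a ring morphism: the action may move the center [K], so linearity over [K] cannot be
    expected. *)
Definition rho (d : D) : RD := sval (cid (rho_ex d)).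

Lemma rhoP d z a : fr z *: d = lam a -> rho0 (zc z) * rho d = rho0 a.
Proof. exact: (svalP (cid (rho_ex d))). Qed.

Lemma rho_unique d phi z a :
  z != 0 -> fr z *: d = lam a -> rho0 (zc z) * phi = rho0 a -> phi = rho d.
Proof.
move=> z0 Ha H; apply/eqP; rewrite -subr_eq0; apply/eqP.
apply: (@rho0_regular (zc z)); first exact: zc_neq0.
by rewrite mulrBr H (rhoP Ha) subrr.
Qed.

Lemma lam_frac1 d : exists z a, z != 0 /\ fr z *: d = lam a.
Proof.
have [z z0 [a Ha]] := lam_frac (fun _ : 'I_1 => d).
by exists z, (a ord0); split; rewrite ?Ha.
Qed.

Lemma rho_lam a : rho (lam a) = rho0 a.
Proof.
by apply/esym/(@rho_unique _ _ 1 a); rewrite ?oner_neq0 ?rmorph1 ?scale1r ?mul1r.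
Qed.

Lemma rho_zmod : zmod_morphism rho.
Proof.
move=> d e; have [y [a [y0 ya]]] := lam_frac1 d; have [z [b [z0 zb]]] := lam_frac1 e.
apply/esym/(@rho_unique _ _ (y * z) (zc z * a - zc y * b)); first by rewrite mulf_neq0.
  by rewrite lamB !lamZ -ya -zb scalerBr !scalerA rmorphM [fr z * _]mulrC.
rewrite mulrBr rho0B !rho0M -(rhoP ya) -(rhoP zb) !mulrA -!rho0M.
by rewrite rmorphM [zc z * zc y]zcC.
Qed.

Lemma rho_monoid : monoid_morphism rho.
Proof.
split=> [|d e]; first by rewrite -(rmorph1 lam) rho_lam rmorph1.
have [y [a [y0 ya]]] := lam_frac1 d; have [z [b [z0 zb]]] := lam_frac1 e.
apply/esym/(@rho_unique _ _ (y * z) (a * b)); first by rewrite mulf_neq0.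
  by rewrite !rmorphM -ya -zb -scalerAl -scalerAr scalerA.
rewrite mulrC rmorphM rho0M mulrA -[X in X * _]mulrA (rhoP ya) -rho0M zcC !rho0M.
by rewrite -mulrA (rhoP zb).
Qed.

HB.instance Definition _ := GRing.isZmodMorphism.Build D RD rho rho_zmod.
HB.instance Definition _ := GRing.isMonoidMorphism.Build D RD rho rho_monoid.

Lemma rhoM d e : rho (d * e) = rho d * rho e.
Proof. exact: rmorphM. Qed.

Lemma rho_sum (J : Type) (r : seq J) (f : J -> D) :
  rho (\sum_(i <- r) f i) = \sum_(i <- r) rho (f i).
Proof. exact: raddf_sum. Qed.

Lemma rho1 : rho 1 = 1.
Proof. exact: rmorph1. Qed.

(** The trivial action through the counit; multiplication by such an element, on either side, is
    pointwise. *)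
Definition iota (d : D) : RD := [ffun l : I => io (u l) *: d].

Lemma iota_mull d (f : RD) l : (iota d * f) l = d * f l.
Proof.
rewrite scalgME -[RHS](@sc_unitl_sum _ SK _ (fun j => d * f j)).
by do 2!(apply: eq_bigr => ? _); rewrite ffunE -scalerAl.
Qed.

Lemma iota_mulr d (f : RD) l : (f * iota d) l = f l * d.
Proof.
rewrite scalgME -[RHS](@sc_unitr_sum _ SK _ (fun j => f j * d)).
by do 2!(apply: eq_bigr => ? _); rewrite ffunE -scalerAr.
Qed.

Lemma iotaM d e : iota (d * e) = iota d * iota e.
Proof. by apply/ffunP => l; rewrite iota_mull !ffunE scalerAr. Qed.

Lemma iotaD d e : iota (d + e) = iota d + iota e.
Proof. by apply/ffunP => l; rewrite !ffunE scalerDr. Qed.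

Lemma iotaZ x d : iota (x *: d) = x *: iota d.
Proof. by apply/ffunP => l; rewrite !ffunE !scalerA mulrC. Qed.

Lemma iota1 : iota 1 = 1.
Proof. by apply/ffunP => l; rewrite !ffunE. Qed.

Definition invariant d := rho d = iota d.

Definition inv_span d := exists (s : seq (K * D)),
  (forall p, p \in s -> invariant p.2) /\ d = \sum_(p <- s) p.1 *: p.2.

Lemma inv_span_vspace : exists B : {vspace D}, forall d, d \in B <-> inv_span d.
Proof.
apply: vspace_of_pred => [|d e [s [s1 ->]] [t [t1 ->]]|x d [s [s1 ->]]].
- by exists [::]; rewrite big_nil.
- exists (s ++ t); rewrite big_cat; split=> // p; rewrite mem_cat.
  by case/orP; [apply: s1 | apply: t1].
exists [seq (x * p.1, p.2) | p <- s]; split=> [q /mapP [p ps ->]|]; first exact: (s1 p ps).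
by rewrite big_map scaler_sumr; apply: eq_bigr => p _; rewrite scalerA.
Qed.

Lemma invariant1 : invariant 1.
Proof. by rewrite /invariant rho1 iota1. Qed.

Lemma invariantM d e : invariant d -> invariant e -> invariant (d * e).
Proof. by rewrite /invariant rhoM iotaM => -> ->. Qed.

Lemma inv_spanM d e : inv_span d -> inv_span e -> inv_span (d * e).
Proof.
move=> [s [s1 ->]] [t [t1 ->]].
exists [seq (p.1 * q.1, p.2 * q.2) | p <- s, q <- t]; split.
  by move=> _ /allpairsPdep [p [q [ps qt ->]]]; exact: invariantM (s1 p ps) (t1 q qt).
rewrite big_allpairs_dep mulr_suml; apply: eq_bigr => p _.
rewrite mulr_sumr; apply: eq_bigr => q _.
by rewrite -scalerAl -scalerAr scalerA.
Qed.

(* For b in D: \sum E_{g1}(b sigma_{g2}(a)) = E_g(b) a. *)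
Lemma rho_antipode b a g :
  \sum_v \sum_w io (c g v w) *: rho (b * lam (sigma w a)) v = rho b g * lam a.
Proof.
transitivity (\sum_v \sum_k sc_c (s := SK) g v k *: \sum_i \sum_j sc_c (s := SK) v i j *:
    (rho b i * lam (E j (sigma k a)))).
  do 2!(apply: eq_bigr => ? _); congr (_ *: _); rewrite rhoM scalgME.
  by do 2!(apply: eq_bigr => ? _); rewrite rho_lam rho0E.
rewrite -sc_assoc_sum.
rewrite -[RHS](@sc_unitr_sum _ SK _ (fun i => rho b i * lam a)).
do 2!(apply: eq_bigr => ? _); congr (_ *: _).
under eq_bigr => j _ do under eq_bigr => k _ do rewrite scalerAr.
under eq_bigr => j _ do rewrite -mulr_sumr.
by rewrite -mulr_sumr -(lam_sumc (fun j k => E j (sigma k a))) ms_E_sigma lam_io scalerAr.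
Qed.

Section Artin.
Variables (r : nat) (e : 'I_r -> A).
Local Notation Dr := {ffun 'I_r -> D}.

Definition artin_rel (b : Dr) : Prop := \sum_i iota (b i) * rho0 (e i) = 0.

Lemma artin_relE b : artin_rel b <-> forall l, \sum_i b i * lam (E l (e i)) = 0.
Proof.
have eE l : (\sum_i iota (b i) * rho0 (e i)) l = \sum_i b i * lam (E l (e i)).
  rewrite sum_ffunE; apply: eq_bigr => i _.
  by rewrite iota_mull rho0E.
split=> [H l|H]; first by rewrite -eE H ffunE.
by apply/ffunP => l; rewrite eE H ffunE.
Qed.

Lemma artin_mull d b : artin_rel b -> artin_rel [ffun i => d * b i].
Proof.
move=> /artin_relE H; apply/artin_relE => l.
transitivity (d * \sum_i b i * lam (E l (e i))); last by rewrite H mulr0.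
by rewrite mulr_sumr; apply: eq_bigr => i _; rewrite ffunE mulrA.
Qed.

(** By [rho_antipode], acting on the coefficients of a relation produces the terms
    [sigma w (E h (e i))]; by [ms_span_sigma] these are combinations of the [E l (e i)], to which
    the relation applies again. The new coefficients measure how far the old ones are from being
    invariant. *)
Lemma artin_rho g b : artin_rel b -> artin_rel [ffun i => rho (b i) g - io (u g) *: b i].
Proof.
move=> /artin_relE H; apply/artin_relE => h.
transitivity (\sum_i rho (b i) g * lam (E h (e i)) - io (u g) *: \sum_i b i * lam (E h (e i))).
  rewrite scaler_sumr -sumrB; apply: eq_bigr => i _.
  by rewrite ffunE mulrBl -scalerAl.
rewrite H scaler0 subr0.
under eq_bigr => i _ do rewrite -rho_antipode.
rewrite exchange_big big1 // => v _ /=; rewrite exchange_big big1 // => w _ /=.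
rewrite -scaler_sumr.
transitivity (io (c g v w) *: rho (\sum_i b i * lam (sigma w (E h (e i)))) v).
  by congr (_ *: _); rewrite rho_sum sum_ffunE.
have Ht := ms_span_sigma M w h.
have -> : \sum_i b i * lam (sigma w (E h (e i))) = 0.
  under eq_bigr => i _ do rewrite Ht rmorph_sum mulr_sumr.
  rewrite exchange_big big1 // => l _ /=.
  under eq_bigr => i _ do rewrite lam_io -scalerAr.
  by rewrite -scaler_sumr H scaler0.
by rewrite -(rmorph0 lam) rho_lam rho0E ms_E0 rmorph0 scaler0.
Qed.

(** A dimension count over [K]: [r] copies of [D] are mapped to [#|I|] copies. *)
Lemma artin_exists : (#|I| < r)%N -> exists2 b : Dr, b != 0 & artin_rel b.
Proof.
move=> lt_r; pose f (b : Dr) : RD := \sum_i iota (b i) * rho0 (e i).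
have lf : linear f.
  move=> x b b'; rewrite /f scaler_sumr -big_split; apply: eq_bigr => i _ /=.
  by rewrite !ffunE iotaD iotaZ mulrDl scalerAl.
pose f' : {linear Dr -> RD} := HB.pack f (GRing.isLinear.Build K Dr RD *:%R f lf).
have : lker (linfun f') != 0%VS.
  apply: contraTneq (lt_r) => k0; rewrite -leqNgt.
  have := limg_ker_dim (linfun f') fullv; rewrite k0 capv0 dimv0 add0n => dimE.
  have : (\dim (limg (linfun f')) <= \dim {: RD})%N by apply/dimvS/subvf.
  by rewrite dimE dim_scalg dim_ffun card_ord leq_pmul2r //; apply: (adim_gt0 {:D}%AS).
rewrite -subv0 => /subvPn [b bk b0].
exists b; first by rewrite memv0 in b0.
by move: bk; rewrite memv_ker lfunE => /eqP.
Qed.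

(** In a relation of least support normalize one coefficient to 1. The relation given by [artin_rho]
    then has smaller support, so it vanishes for every [g], and all coefficients are invariant.
    Finally [ms_span_id] turns the relations between the [E l (e i)] into one between the [e i]. *)
Lemma artin_invariant : (#|I| < r)%N ->
  exists b : Dr, [/\ b != 0, forall i, invariant (b i) & \sum_i b i * lam (e i) = 0].
Proof.
move=> /artin_exists [b0 nb0 rb0].
pose supp (b : Dr) := #|[set i | b i != 0]|.
pose T m := `[< exists b : Dr, [/\ b != 0, artin_rel b & supp b = m] >].
have T0 : exists m, T m by exists (supp b0); apply/asboolP; exists b0.
case: (ex_minnP T0) => m /asboolP [b [nb rb sb]] minm.
have [i0 bi0] : exists i, b i != 0.
  apply/existsP; apply: contraNT nb; rewrite negb_exists => /forallP z.
  by apply/eqP/ffunP => i; rewrite ffunE; apply/eqP; have := z i; rewrite negbK.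
have ub := D_field bi0.
pose b' : Dr := [ffun i => (b i0)^-1 * b i].
have b'i0 : b' i0 = 1 by rewrite ffunE mulVr.
have sb' i : b i = 0 -> b' i = 0 by rewrite ffunE => ->; rewrite mulr0.
have rb' : artin_rel b' by apply: artin_mull.
exists b'; split.
- by apply/eqP => /ffunP/(_ i0)/eqP; rewrite b'i0 ffunE oner_eq0.
- have b1 l : rho (b' i0) l = io (u l) *: b' i0 by rewrite b'i0 rho1 scalg1E.
  have inv0 g : [ffun i => rho (b' i) g - io (u g) *: b' i] = 0 :> Dr.
    set b2 := (X in X = _); apply/eqP; apply: contraT => nb2.
    have : (m <= supp b2)%N.
      by apply: minm; apply/asboolP; exists b2; split=> //; apply: artin_rho.
    rewrite leqNgt -sb => /negP []; apply: proper_card; apply/properP; split.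
      apply/subsetP => i; rewrite !inE; apply: contraNneq => /sb' bi.
      by rewrite ffunE bi -(rmorph0 lam) rho_lam rho0E ms_E0 rmorph0 scaler0 subrr.
    by exists i0; rewrite !inE // ffunE b1 subrr eqxx.
  move=> i; apply/ffunP => g; rewrite ffunE.
  by have /ffunP/(_ i) := inv0 g; rewrite !ffunE => /eqP; rewrite subr_eq0 => /eqP.
have Ht := ms_span_id M.
under eq_bigr => i _ do rewrite (Ht (e i)) rmorph_sum mulr_sumr.
rewrite exchange_big big1 // => l _ /=.
under eq_bigr => i _ do rewrite lam_io -scalerAr.
by rewrite -scaler_sumr (artin_relE b').1 // scaler0.
Qed.

End Artin.

Variables (p m : nat).
Hypothesis p_prime : prime p.
Hypothesis dimD : \dim {: D} = (p ^ m)%N.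
Hypothesis card_lt : (#|I| < p)%N.

(* The index of the division algebra spanned by the invariants divides p ^ m and
   is at most #|I| < p. *)
Lemma inv_span_full d : inv_span d.
Proof.
have [B HB] := inv_span_vspace.
have B1 : 1 \in B.
  apply/HB; exists [:: (1, 1)]; rewrite big_seq1 scale1r; split=> // q.
  by rewrite inE => /eqP ->; apply: invariant1.
have asB : is_aspace B.
  rewrite /is_aspace has_algid1 //=; apply/prodvP => x y Bx By.
  by apply/HB/inv_spanM; apply/HB.
pose BA := ASpace asB.
(* [D] is a free left module over the division algebra [BA] with basis [X], so [size X] is the
   index. *)
have [X [sX dX X0]] := @skew_field_module_semisimple K D D_field BA fullv (subvf _).
have dimB x : x != 0 -> \dim (B * <[x]>) = \dim B by move=> x0; rewrite dim_cosetv_unit ?D_field.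
have dimX : \dim {: D} = (size X * \dim B)%N.
  rewrite -sX (directvP dX) /= big_seq (eq_bigr (fun=> \dim B)); last first.
    by move=> x Xx; apply: dimB; apply: contraNneq X0 => <-.
  by rewrite -big_seq big_const_seq count_predT iter_addn_0 mulnC.
have sizeX : (size X <= #|I|)%N.
  rewrite leqNgt; apply/negP => lt_X.
  (* Artin's argument is about elements of [A]; a common central denominator moves the basis there
     and preserves relations. *)
  have [z z0 [a Ha]] := lam_frac (fun i : 'I_(size X) => X`_i).
  have [b [b0 bi be]] := artin_invariant a lt_X.
  have eb : \sum_(i < size X) b i * X`_i = 0.
    apply: (@scalerI _ _ (fr z)); first by rewrite fr_eq0.
    rewrite scaler0 -[RHS]be scaler_sumr; apply: eq_bigr => i _.
    by rewrite scalerAr Ha.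
  have dX' : directv (\sum_(i < size X) (B * <[X`_i]>)).
    move: dX; rewrite !directvE /= => /eqP.
    rewrite (big_nth 0) big_mkord => ->.
    by rewrite (big_nth 0) big_mkord.
  have bX i : b i * X`_i = 0.
    apply: (directv_sum_independent dX') eb i isT => i _.
    rewrite memv_mul ?memv_line //; apply/HB; exists [:: (1, b i)].
    by rewrite big_seq1 scale1r; split=> // q; rewrite inE => /eqP ->; apply: bi.
  case/eqP: b0; apply/ffunP => i; rewrite ffunE.
  have ux : X`_i \is a GRing.unit.
    by apply: D_field; apply: contraNneq X0 => e; have := mem_nth 0 (ltn_ord i); rewrite e.
  by rewrite -[b i](mulrK ux) bX mul0r.
have dvdX : (size X %| p ^ m)%N by rewrite -dimD dimX dvdn_mulr.
have X1 : size X = 1%N.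
  have /(dvdn_pfactor _ _ p_prime) [k _ ek] := dvdX.
  rewrite ek; case: k ek => // k ek; have : (p <= size X)%N.
    by rewrite ek expnS leq_pmulr // expn_gt0 prime_gt0.
  by rewrite leqNgt (leq_ltn_trans sizeX card_lt).
apply/HB; suff -> : B = fullv by rewrite memvf.
by apply/eqP; rewrite -dimv_leqif_eq ?subvf // dimX X1 mul1n.
Qed.

(** The scalar commutes with an invariant [w]. Applying [rho], with [rho w = iota w] acting
    pointwise, every value of [rho x%:A] commutes with [w], and the invariants span [D] over the
    center. *)
Lemma rho_scalar_central x l d : rho (x%:A) l * d = d * rho (x%:A) l.
Proof.
have [s [s1 ->]] := inv_span_full d; rewrite mulr_sumr mulr_suml big_seq [RHS]big_seq.
apply: eq_bigr => q /s1 inv_q; rewrite -scalerAr -scalerAl; congr (_ *: _).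
by rewrite -iota_mulr -iota_mull -inv_q -!rhoM mulr_algl mulr_algr.
Qed.

Hypothesis D_center : forall d : D, (forall e, d * e = e * d) -> exists x, d = x%:A.

Lemma rho_scalarE x : exists g : I -> K, forall l, rho x%:A l = (g l)%:A.
Proof.
have H l : exists y, rho x%:A l = y%:A.
  by apply: D_center => e; apply: rho_scalar_central.
by exists (fun l => sval (cid (H l))) => l; apply: svalP (cid (H l)).
Qed.

Local Notation KK := (scalg SK K^o).

Definition coefs (f : {linear D -> K^o}) (d : D) : KK := [ffun l : I => f (rho d l)].

Lemma scalar_coefs_comm x (g : KK) f d : (forall l, rho x%:A l = (g l)%:A) ->
  g * coefs f d = coefs f d * g.
Proof.
move=> Hg; have e : rho x%:A * rho d = rho d * rho x%:A.
  by rewrite -!rhoM mulr_algl mulr_algr.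
apply/ffunP => l; have := congr1 f (congr1 (fun h : RD => h l) e).
rewrite !scalgME !linear_sum => e'.
transitivity (\sum_i f (\sum_k sc_c (s := SK) l i k *: (rho x%:A i * rho d k))).
  apply: eq_bigr => i _; rewrite linear_sum; apply: eq_bigr => k _.
  by rewrite Hg mulr_algl ffunE [RHS]linearZ [f (g i *: _)]linearZ.
rewrite e'; apply: eq_bigr => i _; rewrite linear_sum; apply: eq_bigr => k _.
by rewrite Hg mulr_algr ffunE [LHS]linearZ [f (g k *: _)]linearZ /= [_ *: f _]mulrC.
Qed.

(* d is a combination of invariants w with coefficients x in K, so the
   coefficients of d are combinations of those of the scalars x, and rho x
   commutes with rho e. *)
Theorem coefs_comm f d g e : coefs f d * coefs g e = coefs g e * coefs f d.
Proof.
have [s [s1 s2]] := inv_span_full d.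
have Hh x := cid (rho_scalarE x).
pose h x : KK := [ffun l : I => sval (Hh x) l].
have hP x l : rho x%:A l = (h x l)%:A by rewrite ffunE; apply: (svalP (Hh x)).
have -> : coefs f d = \sum_(q <- s) (f q.2 : K) *: h q.1.
  apply/ffunP => l; rewrite ffunE s2 rho_sum sum_ffunE.
  rewrite sum_ffunE linear_sum big_seq [RHS]big_seq; apply: eq_bigr => q qs.
  rewrite scalgZE -[q.1 *: q.2]mulr_algl rhoM (s1 q qs) iota_mulr hP mulr_algl.
  by rewrite linearZ [LHS]mulrC.
rewrite mulr_suml mulr_sumr; apply: eq_bigr => q _.
by rewrite -scalerAl -scalerAr (scalar_coefs_comm g e (hP q.1)).
Qed.

Lemma coefs_comm_sum (f g : {linear D -> K^o}) a b l :
  \sum_i \sum_k io (c l i k) * ((f (lam (E i a)) : K) * g (lam (E k b))) =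
  \sum_i \sum_k io (c l i k) * ((g (lam (E i b)) : K) * f (lam (E k a))).
Proof.
have /ffunP/(_ l) := coefs_comm f (lam a) g (lam b); rewrite !scalgME => e.
transitivity (\sum_i \sum_k sc_c (s := SK) l i k *: (coefs f (lam a) i * coefs g (lam b) k)).
  by do 2!(apply: eq_bigr => ? _); rewrite !ffunE !rho_lam !rho0E.
rewrite e; do 2!(apply: eq_bigr => ? _).
by rewrite !ffunE !rho_lam !rho0E.
Qed.

End Extension.

(** * Weyl algebras in characteristic p *)

Lemma fraction_is_fraction_field (P : idomainType) :
  is_fraction_field (@FracField.tofrac P : {rmorphism P -> {fraction P}}).
Proof.
split=> [x y /eqP|]; first by rewrite tofrac_eq => /eqP.
elim/quotW => r; exists (\d_ r), (\n_ r); split; first exact: denom_ratioP.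
rewrite /=; unlock FracField.tofrac; rewrite -[LHS]FracField.pi_mul.
apply/eqmodP; rewrite /= FracField.equivfE /FracField.mulf.
rewrite !numden_Ratio ?(mulf_neq0, oner_neq0, denom_ratioP) //.
by rewrite mul1r mulr1.
Qed.

(** * Polynomials as a free module over the p-th powers of the variables *)

Section Digits.
Variables (F : comNzRingType) (N p : nat) (p_gt0 : (0 < p)%N).
Local Notation P := {mpoly F[N]}.
Local Notation J := {ffun 'I_N -> 'I_p}.
Implicit Types (w r : P) (m : 'X_{1..N}) (j l : J).

Local Notation theta := (mmap (@mpolyC N F) (fun i => 'X_i ^+ p : P)).

Definition mnm_mod m : J := [ffun i => Ordinal (ltn_pmod (m i) p_gt0)].
Definition mnm_div m : 'X_{1..N} := [multinom (m i %/ p)%N | i < N].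
Definition mnm_digit j : 'X_{1..N} := [multinom (j i : nat) | i < N].

Lemma mnm_divE m : (mnm_div m *+ p + mnm_digit (mnm_mod m))%MM = m.
Proof.
by apply/mnmP => i; rewrite mnmDE mulmnE !mnmE ffunE /= -divn_eq.
Qed.

Lemma mnm_modD m m' : mnm_mod (m *+ p + m')%MM = mnm_mod m'.
Proof. by apply/ffunP => i; apply/val_inj; rewrite !ffunE /= mnmDE mulmnE modnMDl. Qed.

Lemma mnm_divD m m' : mnm_div (m *+ p + m')%MM = (m + mnm_div m')%MM.
Proof. by apply/mnmP => i; rewrite !(mnmE, mnmDE) mulmnE divnMDl. Qed.

Lemma mnm_mod_digit j : mnm_mod (mnm_digit j) = j.
Proof. by apply/ffunP => i; apply/val_inj; rewrite !ffunE /= mnmE modn_small. Qed.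

Lemma mnm_div_digit j : mnm_div (mnm_digit j) = 0%MM.
Proof. by apply/mnmP => i; rewrite !mnmE divn_small // mnm0E. Qed.

(** Exponents are divided by [p] with remainder: this is the coordinate of [w] at the basis monomial
    with exponents [j], the p-th powers of the variables being renamed as the variables
    themselves. *)
Definition digit j w : P := \sum_(m <- msupp w) (w@_m * (mnm_mod m == j)%:R) *: 'X_[mnm_div m].

Lemma mcoeff_digit j w m : (digit j w)@_m = w@_(m *+ p + mnm_digit j).
Proof.
rewrite /digit raddf_sum [in RHS](mpolyE w) raddf_sum; apply: eq_bigr => m' _ /=.
rewrite !mcoeffZ !mcoeffX -mulrA -natrM mulnb; congr (_ * (nat_of_bool _)%:R).
apply/andP/eqP => [[/eqP <- /eqP <-]|->]; first by rewrite mnm_divE.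
by rewrite mnm_modD mnm_divD mnm_mod_digit mnm_div_digit addm0 !eqxx.
Qed.

Lemma digitD j w w' : digit j (w + w') = digit j w + digit j w'.
Proof. by apply/mpolyP => m; rewrite mcoeffD !mcoeff_digit mcoeffD. Qed.

Lemma digitZ j c w : digit j (c *: w) = c *: digit j w.
Proof. by apply/mpolyP => m; rewrite mcoeffZ !mcoeff_digit mcoeffZ. Qed.

Lemma digit0 j : digit j 0 = 0.
Proof. by rewrite -(scale0r 0) digitZ !scale0r. Qed.

Lemma digitX j m : digit j 'X_[m] = (mnm_mod m == j)%:R *: 'X_[mnm_div m].
Proof. by rewrite /digit msuppX big_seq1 mcoeffX eqxx mul1r. Qed.

Lemma thetaX m : theta 'X_[m] = 'X_[m *+ p].
Proof.
rewrite mmapX /mmap1 mpolyXE_id; apply: eq_bigr => i _.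
by rewrite mulmnE mulnC exprM.
Qed.

Lemma thetaZ c w : theta (c *: w) = c *: theta w.
Proof. by rewrite mmapZ mul_mpolyC. Qed.

Lemma digit_theta j r w : digit j (theta r * w) = r * digit j w.
Proof.
elim/mpolyind: r => [|c m r _ _ IHr]; first by rewrite rmorph0 !mul0r digit0.
rewrite rmorphD !mulrDl digitD IHr /=; congr (_ + _) => {r IHr}.
rewrite thetaZ thetaX -!scalerAl digitZ; congr (_ *: _).
elim/mpolyind: w => [|d m' w _ _ IHw]; first by rewrite !mulr0 digit0 mulr0.
rewrite mulrDr !digitD mulrDr IHw; congr (_ + _).
rewrite -scalerAr !digitZ -scalerAr; congr (_ *: _).
by rewrite -mpolyXD !digitX mnm_modD mnm_divD mpolyXD -scalerAr.
Qed.

Lemma digit_sum w : w = \sum_j theta (digit j w) * 'X_[mnm_digit j].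
Proof.
elim/mpolyind: w => [|c m w _ _ IHw].
  by rewrite big1 // => j _; rewrite digit0 rmorph0 mul0r.
under eq_bigr => j _ do rewrite digitD rmorphD mulrDl.
rewrite big_split /= -IHw; congr (_ + _).
rewrite (bigD1 (mnm_mod m)) //= big1 => [|j nj].
  rewrite addr0 digitZ digitX eqxx scale1r thetaZ thetaX -scalerAl -mpolyXD.
  by rewrite mnm_divE.
by rewrite digitZ digitX eq_sym (negPf nj) scale0r scaler0 rmorph0 mul0r.
Qed.

Lemma digit_digit l j : digit l 'X_[mnm_digit j] = (l == j)%:R.
Proof.
rewrite digitX mnm_mod_digit mnm_div_digit mpolyX0 eq_sym.
by case: eqP; rewrite ?scale1r ?scale0r.
Qed.

End Digits.

Section PCenter.
Variables (F : fieldType) (p : nat) (charF : p \in [pchar F]).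
Variables (n : nat) (A : weyl_model F n).
Local Notation N := (n + n)%N.
Local Notation P := {mpoly F[n + n]}.
Local Notation theta := (mmap (@mpolyC N F) (fun i => 'X_i ^+ p : P)).
Local Notation symbol := (wm_symbol A).
Local Notation quant := (wm_quant A).

Let p_prime : prime p := pcharf_prime charF.
Let p_gt0 : (0 < p)%N := prime_gt0 p_prime.

Lemma natrp0 (V : lmodType F) m (v : V) : (m * p)%:R *: v = 0.
Proof. by rewrite natrM (pcharf0 charF) mulr0 scale0r. Qed.

Lemma mderiv_theta i (r : P) : mderiv i (theta r) = 0.
Proof.
elim/mpolyind: r => [|c m r _ _ IHr]; first by rewrite rmorph0 linear0.
rewrite rmorphD mderivD IHr addr0 /= thetaZ mderivZ thetaX mderivX mulmnE.
by rewrite natrp0 scaler0.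
Qed.

Lemma mderiv_iter_p i (w : P) : iter p (mderiv i) w = 0.
Proof.
rewrite -mderivn_iter; elim/mpolyind: w => [|c m w _ _ IHw]; first by rewrite linear0.
rewrite linearP /= IHw addr0 mderivnX -bin_ffact.
have : (p %| p`!)%N by rewrite dvdn_fact // leqnn p_gt0.
by case/dvdnP => q ->; rewrite mulnA natrp0 scaler0.
Qed.

Lemma symact_theta a r w : symact (A := A) a (theta r * w) = theta r * symact a w.
Proof.
elim/wm_ind: a w => [|a b IHa IHb|c a IH|i a IH|i a IH] w.
- by rewrite !symact1.
- by rewrite !symactD IHa IHb mulrDr.
- by rewrite !symactZ IH scalerAr.
- by rewrite !symactM !symact_x IH mulrCA.
by rewrite !symactM !symact_y IH mderivM mderiv_theta mul0r add0r mulrDr mulrCA.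
Qed.

(** [y_i] acts as the sum of a multiplication and a derivation that commute with each other, so the
    binomial formula applies. *)
Lemma iter_y k i w : symact (wm_y A i ^+ k) w =
  \sum_(j < k.+1) ('C(k, j)%:R : F) *:
    ('X_(rshift n i) ^+ (k - j) * iter j (mderiv (lshift n i)) w).
Proof.
set X := 'X_(rshift n i) : P; pose d := mderiv (lshift n i) : P -> P.
elim: k => [|k IHk].
  by rewrite expr0 symact1 big_ord1 bin0 scale1r expr0 mul1r.
rewrite exprS symactM IHk symact_y -/X mulr_sumr linear_sum /=.
have dX e v : d (X ^+ e * v) = X ^+ e * d v.
  elim: e v => [|e IHe] v; first by rewrite !expr0 !mul1r.
  by rewrite exprS -mulrA /d mderivM mderiv_var eq_lrshift mul0r add0r -/d IHe mulrA.
rewrite [RHS]big_ord_recl /= bin0 subn0 scale1r.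
have -> : \sum_(j < k.+1) X * (('C(k, j)%:R : F) *: (X ^+ (k - j) * iter j d w)) =
    X ^+ k.+1 * w + \sum_(j < k.+1) ('C(k, j.+1)%:R : F) *: (X ^+ (k - j) * iter j.+1 d w).
  rewrite big_ord_recl bin0 subn0 scale1r /= mulrA -exprS; congr (_ + _).
  rewrite [RHS]big_ord_recr /= bin_small // scale0r addr0; apply: eq_bigr => j _.
  rewrite /bump /= add1n -scalerAr mulrA -exprS; congr (_ *: (X ^+ _ * _)).
  by rewrite -subSn ?subSS // ltnW.
rewrite -addrA -big_split; congr (_ + _); apply: eq_bigr => j _ /=.
rewrite linearZ /= -/d dX -scalerDl -natrD -/(bump 0 j) /bump /= add1n binS.
by rewrite subSS.
Qed.

(** In the binomial formula for [y_i ^+ p] the middle coefficients vanish modulo [p], and so does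
    the p-th derivative in the last term. *)
Lemma symact_gen_p (l : 'I_N) : exists g : A, forall w, symact g w = 'X_l ^+ p * w.
Proof.
case: (split_ordP l) => i ->.
  exists (wm_x A i ^+ p) => w; elim: (p) w => [|k IHk] w.
    by rewrite !expr0 symact1 mul1r.
  by rewrite !exprS symactM symact_x IHk mulrA.
exists (wm_y A i ^+ p) => w; rewrite iter_y big_ord_recl big1 => [|j _].
  by rewrite bin0 subn0 scale1r addr0.
rewrite lift0; have [lt_j|le_j] := ltnP j.+1 p.
  have : (p %| 'C(p, j.+1))%N by rewrite prime_dvd_bin.
  by case/dvdnP => q ->; rewrite natrp0.
have -> : j.+1 = p by apply/eqP; rewrite eqn_leq le_j ltn_ord.
by rewrite mderiv_iter_p mulr0 scaler0.
Qed.

Definition pcenter (r : P) : A := quant (theta r).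

Lemma symact_pcenter r w : symact (pcenter r) w = theta r * w.
Proof.
suff [g Hg] : exists g : A, forall w, symact g w = theta r * w.
  have -> // : pcenter r = g.
  by apply: wm_symbol_inj; rewrite wm_quantK -[in RHS]symact_one Hg mulr1.
elim/mpolyind: r => [|c m r _ _ [g Hg]].
  by exists 0 => v; rewrite /symact mul0r !raddf0 mul0r.
have [h Hh] : exists h : A, forall w, symact h w = theta 'X_[m] * w.
  elim/mnm_ind: m => [|u m [h Hh]].
    by exists 1 => v; rewrite mpolyX0 rmorph1 symact1 mul1r.
  have [g' Hg'] := symact_gen_p u; exists (g' * h) => v.
  rewrite symactM Hg' Hh mpolyXD rmorphM /= mulrA; congr (_ * _ * _).
  by rewrite mmapX mmap1U.
exists (c *: h + g) => v.
by rewrite symactD symactZ Hh Hg rmorphD /= thetaZ mulrDl scalerAl.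
Qed.

Lemma symbol_pcenterM r a : symbol (pcenter r * a) = theta r * symbol a.
Proof. by rewrite -symact_symbol symact_pcenter. Qed.

Lemma pcenterC r a : pcenter r * a = a * pcenter r.
Proof.
apply: wm_symbol_inj; rewrite symbol_pcenterM -symact_symbol wm_quantK.
by rewrite -[theta r]mulr1 symact_theta mulr1 symact_one.
Qed.

Lemma pcenter_zmod : zmod_morphism pcenter.
Proof. by move=> r s; rewrite /pcenter rmorphB linearB. Qed.

Lemma pcenter_monoid : monoid_morphism pcenter.
Proof.
split=> [|r s]; first by rewrite /pcenter rmorph1 wm_quant1.
by apply: wm_symbol_inj; rewrite symbol_pcenterM !wm_quantK rmorphM.
Qed.

HB.instance Definition _ := GRing.isZmodMorphism.Build P A pcenter pcenter_zmod.
HB.instance Definition _ := GRing.isMonoidMorphism.Build P A pcenter pcenter_monoid.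

Local Notation J := {ffun 'I_N -> 'I_p}.
Local Notation digit := (digit p_gt0).

Definition weyl_mu (j : J) : A := quant 'X_[mnm_digit j].
Definition weyl_ka (j : J) (a : A) : P := digit j (symbol a).

Lemma weyl_kaD l a b : weyl_ka l (a + b) = weyl_ka l a + weyl_ka l b.
Proof. by rewrite /weyl_ka wm_symbolD digitD. Qed.

Lemma weyl_kaZ l r a : weyl_ka l (pcenter r * a) = r * weyl_ka l a.
Proof. by rewrite /weyl_ka symbol_pcenterM digit_theta. Qed.

Lemma weyl_kaE a : a = \sum_j pcenter (weyl_ka j a) * weyl_mu j.
Proof.
apply: wm_symbol_inj; rewrite [LHS](digit_sum p_gt0) linear_sum.
by apply: eq_bigr => j _; rewrite symbol_pcenterM wm_quantK.
Qed.

Lemma weyl_ka_mu l j : weyl_ka l (weyl_mu j) = (l == j)%:R.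
Proof. by rewrite /weyl_ka wm_quantK digit_digit. Qed.

Local Notation K := {fraction P}.
Local Notation fr := (@FracField.tofrac P : {rmorphism P -> K}).
Local Notation frP := (@fraction_is_fraction_field P).
Definition weyl_loc := loc pcenterC weyl_kaD weyl_kaZ weyl_kaE weyl_ka_mu frP.
Definition weyl_lam : A -> weyl_loc :=
  to_loc pcenterC weyl_kaD weyl_kaZ weyl_kaE weyl_ka_mu frP.
HB.instance Definition _ := GRing.RMorphism.on weyl_lam.


Definition weyl_io : F -> K := fr \o @mpolyC N F.
HB.instance Definition _ := GRing.RMorphism.on weyl_io.

Definition weyl_coord (j : J) (d : weyl_loc) : K := loc_coord j d.

Lemma weyl_coordD j d e : weyl_coord j (d + e) = weyl_coord j d + weyl_coord j e.
Proof. exact: loc_coordD. Qed.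

Lemma weyl_coordZ j x d : weyl_coord j (x *: d) = x * weyl_coord j d.
Proof. exact: loc_coordZ. Qed.

Lemma weyl_coord_lam j a : weyl_coord j (weyl_lam a) = fr (weyl_ka j a).
Proof. exact: loc_coord_lam. Qed.

Lemma weyl_lam_inj : injective weyl_lam.
Proof. exact: to_loc_inj. Qed.

Lemma weyl_lamZ r a : weyl_lam (pcenter r * a) = fr r *: weyl_lam a.
Proof. exact: to_locZ. Qed.

Lemma weyl_lam_frac (J' : finType) (d : J' -> weyl_loc) :
  exists2 z, z != 0 & exists a : J' -> A, forall i, fr z *: d i = weyl_lam (a i).
Proof. exact: to_loc_frac. Qed.

Lemma weyl_loc_field : GRing.field_axiom weyl_loc.
Proof. by apply: loc_field => a b; apply: wm_mul_eq0. Qed.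

Lemma dim_weyl_loc : \dim {: weyl_loc} = (p ^ N)%N.
Proof. by rewrite dim_loc card_ffun !card_ord. Qed.

Lemma weyl_lam_io c a : weyl_lam (c *: a) = weyl_io c *: weyl_lam a.
Proof.
rewrite -weyl_lamZ; congr weyl_lam; apply: wm_symbol_inj.
by rewrite symbol_pcenterM mmapC mul_mpolyC wm_symbolZ.
Qed.

Lemma weyl_lamM a b : weyl_lam (a * b) = weyl_lam a * weyl_lam b.
Proof. exact: rmorphM. Qed.

Lemma weyl_lam1 : weyl_lam 1 = 1.
Proof. exact: rmorph1. Qed.

(** Commuting with all generators kills every partial derivative of the symbol. In characteristic p
    the exponents that occur are then divisible by [p], so only the zero digit contributes. *)
Lemma symbol_pcenterE a :
  (forall i, wm_x A i * a = a * wm_x A i) -> (forall i, wm_y A i * a = a * wm_y A i) ->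
  exists r, a = pcenter r.
Proof.
move=> cx cy.
have d0 (u : 'I_N) : mderiv u (symbol a) = 0.
  case: (split_ordP u) => i ->.
    have /eqP := congr1 symbol (cy i); rewrite wm_symbol_yM wm_symbol_My.
    by rewrite -subr_eq0 addrC addKr => /eqP.
  have /eqP := congr1 symbol (cx i); rewrite wm_symbol_xM wm_symbol_Mx.
  by rewrite -subr_eq0 opprD addrA subrr add0r oppr_eq0 => /eqP.
pose j0 : J := mnm_mod p_gt0 0%MM.
have e0 : mnm_digit j0 = 0%MM.
  by apply/mnmP => i; rewrite mnmE ffunE /= mnm0E mod0n.
exists (weyl_ka j0 a); rewrite {1}[a]weyl_kaE (bigD1 j0) //= big1 => [|j nj].
  by rewrite addr0 /weyl_mu e0 mpolyX0 wm_quant1 mulr1.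
suff -> : weyl_ka j a = 0 by rewrite rmorph0 mul0r.
have [u ju] : exists u, j u != 0%N :> nat.
  apply/existsP; apply: contraNT nj; rewrite negb_exists => /forallP z.
  apply/eqP/ffunP => u; apply/val_inj; rewrite ffunE /= mnm0E mod0n.
  by apply/eqP; have := z u; rewrite negbK.
apply/mpolyP => m; rewrite mcoeff_digit mcoeff0.
set m' := (m *+ p + mnm_digit j)%MM.
have mu0 : m' u != 0%N by rewrite mnmDE mulmnE mnmE addn_eq0 (negPf ju) andbF.
have := congr1 (mcoeff (m' - U_(u))%MM) (d0 u).
rewrite mcoeff_deriv mcoeff0 submK ?lep1mP // mnmBE mnm1E eqxx subn1 prednK ?lt0n //.
rewrite -mulr_natr => /eqP; rewrite mulf_eq0 => /orP [/eqP //|].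
rewrite -(dvdn_pcharf charF) mnmDE mulmnE mnmE dvdn_addr ?dvdn_mull //.
by rewrite gtnNdvd // lt0n.
Qed.

Lemma weyl_loc_center (d : weyl_loc) : (forall e, d * e = e * d) -> exists x, d = x%:A.
Proof.
move=> cd; have [z z0 [a Ha]] := weyl_lam_frac (fun _ : 'I_1 => d).
have {Ha}Ha := Ha ord0; move: {a}(a ord0) Ha => a Ha.
have ca b : b * a = a * b.
  by apply: weyl_lam_inj; rewrite !weyl_lamM -Ha -scalerAl -scalerAr cd.
have [r ar] := @symbol_pcenterE a (fun i => ca _) (fun i => ca _).
have z0' : fr z != 0 by rewrite fr_eq0 //; apply: fraction_is_fraction_field.
exists ((fr z)^-1 * fr r); apply: (scalerI z0').
by rewrite Ha scalerA mulrA mulfV // mul1r ar -[pcenter r]mulr1 weyl_lamZ weyl_lam1.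
Qed.

(** Degree below [p] leaves no room for the p-th power of a variable, so the coordinates over the
    center are constants. This makes coefficients over [F] accessible to [K]-linear functionals on
    the localization. *)
Lemma weyl_coord_small a j : (msize (symbol a) <= p)%N ->
  weyl_coord j (weyl_lam a) = weyl_io (symbol a)@_(mnm_digit j).
Proof.
move=> sa; rewrite weyl_coord_lam /=; congr (fr _); apply/mpolyP => m.
rewrite mcoeff_digit mcoeffC; case: eqP => [->|/eqP m0].
  by rewrite mulr1; congr (_ @_ _); apply/mnmP => i; rewrite mnmDE mulmnE mnm0E add0n.
rewrite mulr0; apply: memN_msupp_eq0; apply: msize_mdeg_ge; apply: leq_trans sa _.
rewrite mdegD mdegMn; move: m0; rewrite -mdeg_eq0 -lt0n => m0.
by apply: leq_trans (leq_addr _ _); rewrite leq_pmull.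
Qed.

Lemma mcoeff_small a m : (msize (symbol a) <= p)%N -> (symbol a)@_m != 0 ->
  exists j : J, m = mnm_digit j.
Proof.
move=> sa; rewrite -mcoeff_msupp => /msize_mdeg_lt lt_m.
exists (mnm_mod p_gt0 m); apply/mnmP => i; rewrite mnmE ffunE /= modn_small //.
apply: leq_trans sa; apply: leq_ltn_trans lt_m.
by rewrite mdegE (bigD1 i) //= leq_addr.
Qed.

Variables (S : sconsts F) (M : measuring S A).
Hypothesis card_lt : (#|sc_I S| < p)%N.
Local Notation I := (sc_I S).
Local Notation c := (@sc_c F S).
Local Notation E := (ms_E M).
Local Notation SK := (base_change weyl_io S).

Definition small_coefs b := forall l, (msize (symbol (E l b)) <= p)%N.

Lemma weyl_coord_linear j : linear (weyl_coord j : weyl_loc -> K^o).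
Proof. by move=> x d e; rewrite weyl_coordD weyl_coordZ. Qed.

HB.instance Definition _ j := GRing.isLinear.Build K weyl_loc K^o *:%R (weyl_coord j)
  (weyl_coord_linear j).

Lemma weyl_coefs_comm_lam b1 b2 (j1 j2 : J) l :
  \sum_i \sum_k weyl_io (c l i k) *
    (weyl_coord j1 (weyl_lam (E i b1)) * weyl_coord j2 (weyl_lam (E k b2))) =
  \sum_i \sum_k weyl_io (c l i k) *
    (weyl_coord j2 (weyl_lam (E i b2)) * weyl_coord j1 (weyl_lam (E k b1))).
Proof.
exact: (coefs_comm_sum M (@wm_mul_eq0 F n A) pcenterC frP
  weyl_lam_inj weyl_lamZ weyl_lam_frac weyl_loc_field weyl_lam_io
  p_prime dim_weyl_loc card_lt weyl_loc_center
  (weyl_coord j1) (weyl_coord j2) b1 b2 l).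
Qed.

Theorem weyl_coefs_comm b1 b2 m1 m2 l : small_coefs b1 -> small_coefs b2 ->
  \sum_i \sum_k c l i k * ((symbol (E i b1))@_m1 * (symbol (E k b2))@_m2) =
  \sum_i \sum_k c l i k * ((symbol (E i b2))@_m2 * (symbol (E k b1))@_m1).
Proof.
move=> sb1 sb2.
(* A monomial whose coefficients all vanish need not have exponents below [p], but then both sides
   are zero. A nonzero coefficient forces the exponents to be digits. *)
have [/existsP [i1 n1]|] := boolP [exists i, (symbol (E i b1))@_m1 != 0]; last first.
  rewrite negb_exists => /forallP z.
  have {}z i : (symbol (E i b1))@_m1 = 0 by apply/eqP; have := z i; rewrite negbK.
  by rewrite !big1 // => i _; rewrite big1 // => k _; rewrite z ?mul0r ?mulr0.
have [/existsP [i2 n2]|] := boolP [exists i, (symbol (E i b2))@_m2 != 0]; last first.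
  rewrite negb_exists => /forallP z.
  have {}z i : (symbol (E i b2))@_m2 = 0 by apply/eqP; have := z i; rewrite negbK.
  by rewrite !big1 // => i _; rewrite big1 // => k _; rewrite z ?mul0r ?mulr0.
have [j1 ->] := mcoeff_small (sb1 i1) n1.
have [j2 ->] := mcoeff_small (sb2 i2) n2.
have ioE a1 a2 (u1 u2 : J) : small_coefs a1 -> small_coefs a2 ->
    weyl_io (\sum_i \sum_k c l i k *
      ((symbol (E i a1))@_(mnm_digit u1) * (symbol (E k a2))@_(mnm_digit u2))) =
    \sum_i \sum_k weyl_io (c l i k) *
      (weyl_coord u1 (weyl_lam (E i a1)) * weyl_coord u2 (weyl_lam (E k a2))).
  move=> sa1 sa2; rewrite rmorph_sum; apply: eq_bigr => i _.
  rewrite rmorph_sum; apply: eq_bigr => k _.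
  by rewrite !weyl_coord_small // -!rmorphM.
apply: (fmorph_inj (weyl_io : {rmorphism F -> K})).
by rewrite [LHS]ioE // [RHS]ioE // weyl_coefs_comm_lam.
Qed.

End PCenter.

(** * Specialization to positive characteristic *)

Section PseudoDivision.
Variables (R : comNzRingType) (k : fieldType) (io : {rmorphism R -> k}).
Local Notation "p ^io" := (map_poly io p) (at level 2, format "p ^io").
Implicit Types f g h q : {poly R}.

(* The generator is a member of least degree with nonzero image. *)
Lemma pseudo_generator (T : {poly R} -> Prop) :
  (forall f h, T f -> T h -> T (f + h)) -> (forall f h, T f -> T (h * f)) ->
  (forall f h, f^io = h^io -> T f -> T h) -> (exists2 f, T f & f^io != 0) ->
  exists q, [/\ T q, io (lead_coef q) != 0 &
    forall f, T f -> exists e h, (lead_coef q ^+ e *: f)^io = (h * q)^io].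
Proof.
move=> TD TM Tio [f0 Tf0 nf0].
pose Q n := `[< exists f, [/\ T f, f^io != 0 & size f = n] >].
have Qex : exists n, Q n by exists (size f0); apply/asboolP; exists f0.
case: (ex_minnP Qex) => n /asboolP [q [Tq nq sq]] minq.
(* A leading coefficient killed by [io] could be dropped without changing the image, against the
   choice of least degree. *)
have lq : io (lead_coef q) != 0.
  apply/eqP => lq0; pose q' := \poly_(i < n.-1) q`_i.
  have n0 : (0 < n)%N.
    by rewrite -sq size_poly_gt0; apply: contraNneq nq => ->; rewrite rmorph0.
  have eq' : q'^io = q^io.
    apply/polyP => i; rewrite !coef_map coef_poly; case: ltnP => // le_i.
    rewrite /= rmorph0; have [lt_i|ge_i] := ltnP i n; last by rewrite nth_default ?rmorph0 ?sq.
    have -> : i = n.-1 by apply/eqP; rewrite eqn_leq le_i -ltnS prednK // lt_i.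
    by rewrite -sq -lead_coefE lq0.
  have /minq : Q (size q').
    by apply/asboolP; exists q'; split=> //; rewrite ?eq' //; apply: Tio Tq; rewrite eq'.
  by rewrite leqNgt => /negP []; rewrite (leq_ltn_trans (size_poly _ _)) // prednK.
exists q; split=> // f Tf.
exists (Pdiv.Ring.rscalp f q), (Pdiv.Ring.rdivp f q).
rewrite Pdiv.ComRing.rdivp_eq rmorphD /=.
suff -> : (Pdiv.Ring.rmodp f q)^io = 0 by rewrite addr0.
apply/eqP; apply: contraT => nr.
have q0 : q != 0 by apply: contraNneq nq => ->; rewrite rmorph0.
have Tr : T (Pdiv.Ring.rmodp f q).
  have := Pdiv.ComRing.rdivp_eq q f; set r := Pdiv.Ring.rmodp f q => e.
  have -> : r = (lead_coef q ^+ Pdiv.Ring.rscalp f q)%:P * f + - Pdiv.Ring.rdivp f q * q.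
    by rewrite mul_polyC e mulNr addrAC subrr add0r.
  by apply: TD; apply: TM.
have /minq : Q (size (Pdiv.Ring.rmodp f q)) by apply/asboolP; exists (Pdiv.Ring.rmodp f q).
by rewrite -sq leqNgt Pdiv.Ring.ltn_rmodpN0.
Qed.

End PseudoDivision.

(* Killing the kernel of io makes phi a map out of the subring io R of k; the
   characteristic of F only has to avoid the divisors of m. *)
Definition specializes (R : comNzRingType) (k : fieldType) (io : {rmorphism R -> k}) : Prop :=
  forall g, io g != 0 -> exists2 m, (0 < m)%N &
    forall F : closedFieldType, m%:R != 0 :> F ->
    exists phi : {rmorphism R -> F}, (forall r, io r = 0 -> phi r = 0) /\ phi g != 0.

Section Specialize.
Variables (k : fieldType) (char0 : [pchar k] =i pred0).

Lemma specializes_int : specializes (intr : {rmorphism int -> k}).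
Proof.
have inj (F : fieldType) (z : int) : (z%:~R == 0 :> F) = (`|z|%N%:R == 0 :> F).
  by case: z => m //; rewrite NegzE mulrNz oppr_eq0.
move=> g g0; exists `|g|%N.
  by rewrite lt0n absz_eq0; apply: contraNneq g0 => ->; rewrite rmorph0.
move=> F gF; exists (intr : {rmorphism int -> F}); rewrite /= inj; split=> // r /eqP.
rewrite inj; have /pcharf0P -> := char0.
by rewrite absz_eq0 => /eqP ->; rewrite mulr0z.
Qed.

Section Step.
Variables (R : comNzRingType) (io : {rmorphism R -> k}) (ioS : specializes io) (s : k).
Local Notation "p ^io" := (map_poly io p) (at level 2, format "p ^io").

Definition adjoin_ev : {poly R} -> k := horner_eval s \o map_poly io.
HB.instance Definition _ := GRing.RMorphism.on adjoin_ev.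

Lemma adjoin_evE f : adjoin_ev f = (f^io).[s].
Proof. by []. Qed.

Lemma adjoin_evD f h : adjoin_ev (f + h) = adjoin_ev f + adjoin_ev h.
Proof. exact: rmorphD. Qed.

Lemma adjoin_evM f h : adjoin_ev (f * h) = adjoin_ev f * adjoin_ev h.
Proof. exact: rmorphM. Qed.

(** If [s] is transcendental over the image of [R], it may go to any point that is not a root of the
    specialized [g]. If it is algebraic, it has to go to a root of the specialized minimal
    polynomial [q], and a Bezout relation between [g] and [q] keeps [g] nonzero there. *)
Lemma specializes_adjoin : specializes adjoin_ev.
Proof.
move=> g g0'; have {g0'}g0 : adjoin_ev g != 0 := g0'.
have mg0 : g^io != 0 by apply: contraNneq g0 => e; rewrite adjoin_evE e horner0.
have map_ker (F : fieldType) (phi : {rmorphism R -> F}) f h :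
    (forall r, io r = 0 -> phi r = 0) -> f^io = h^io -> map_poly phi f = map_poly phi h.
  move=> kerphi /polyP e; apply/polyP => i; have := e i; rewrite !coef_map => /eqP.
  by rewrite -subr_eq0 -rmorphB => /eqP/kerphi/eqP; rewrite rmorphB subr_eq0 => /eqP.
have norm c e f h q : (c ^+ e *: f)^io = (h * q)^io -> (io c ^+ e)%:P * f^io = h^io * q^io.
  by rewrite -mul_polyC !rmorphM /= map_polyC /= rmorphXn.
have [[q0 q00 nq0]|trans] := pselect (exists2 q, adjoin_ev q = 0 & q^io != 0); last first.
  have {}trans q : adjoin_ev q = 0 -> q^io = 0.
    by move=> e; apply/eqP; apply: contraT => nq; case: trans; exists q.
  have li : io g`_(size g^io).-1 != 0.
    by rewrite -coef_map -lead_coefE lead_coef_eq0.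
  have [m m0 Hm] := ioS li; exists m => // F /Hm [phi [kerphi phig]].
  have ng : map_poly phi g != 0.
    apply: contraNneq phig => e; have := coef_map phi g (size g^io).-1.
    by rewrite e coef0 => <-.
  have /closed_nonrootP [u nu] := ng.
  exists (horner_eval u \o map_poly phi); split=> // r /trans e /=.
  have -> : map_poly phi r = map_poly phi 0.
    by apply: map_ker => //; rewrite e rmorph0.
  by rewrite rmorph0 /horner_eval horner0.
have [||||q [q_0 lq Hq]] := @pseudo_generator _ _ io (fun f => adjoin_ev f = 0).
- by move=> f h f_0 h_0; rewrite adjoin_evD f_0 h_0 addr0.
- by move=> f h f_0; rewrite adjoin_evM f_0 mulr0.
- by move=> f h e; rewrite !adjoin_evE e.
- by exists q0.
(* Bezout by pseudo-division: up to powers of its leading coefficient, [f0] generates the ideal of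
   [g] and [q] over [k]. It does not vanish at [s], since it divides [g]; as it also divides [q],
   the minimality of [q] forces it to be constant. *)
pose T f := exists a b, f^io = (a * g + b * q)^io.
have [||||f0 [Tf0 lf0 Hf0]] := @pseudo_generator _ _ io T.
- move=> f h [a [b e]] [a' [b' e']]; exists (a + a'), (b + b').
  by rewrite rmorphD /= e e' -[LHS]rmorphD !mulrDl addrACA.
- by move=> f h [a [b e]]; exists (h * a), (h * b); rewrite rmorphM /= e -[LHS]rmorphM mulrDr !mulrA.
- by move=> f h e [a [b e']]; exists a, b; rewrite -e.
- by exists g => //; exists 1, 0; rewrite mul1r mul0r addr0.
have nf0 : adjoin_ev f0 != 0.
  have [|e [h eh]] := Hf0 g; first by exists 1, 0; rewrite mul1r mul0r addr0.
  apply/eqP => f00; have /eqP := congr1 (horner^~ s) eh.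
  rewrite -mul_polyC !rmorphM /= !hornerM -[f0^io.[s]]/(adjoin_ev f0) f00 mulr0.
  by rewrite map_polyC hornerC /= rmorphXn mulf_eq0 expf_eq0 (negPf lf0) andbF (negPf g0).
have mq0 : q^io != 0.
  by rewrite -lead_coef_eq0 lead_coef_map_eq.
have [r0 [a [b r0E]]] : exists r0 a b, r0%:P^io = (a * g + b * q)^io /\ io r0 != 0.
  have [|e [h eh]] := Hf0 q; first by exists 0, 1; rewrite mul1r mul0r add0r.
  have h0 : adjoin_ev h = 0.
    have /eqP := congr1 (horner^~ s) eh.
    rewrite -mul_polyC !rmorphM /= !hornerM -[q^io.[s]]/(adjoin_ev q) q_0 mulr0 eq_sym.
    by rewrite mulf_eq0 (negPf nf0) orbF => /eqP.
  have [e' [h' eh']] := Hq h h0.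
  have : (h'^io * f0^io) * q^io = (io (lead_coef q) ^+ e' * io (lead_coef f0) ^+ e)%:P * q^io.
    by rewrite mulrAC -(norm _ _ _ _ _ eh') -mulrA -(norm _ _ _ _ _ eh) mulrA polyCM.
  move/(mulIf mq0) => hf.
  have sf0 : size f0^io = 1%N.
    have nz : h'^io * f0^io != 0.
      by rewrite hf polyC_eq0 mulf_neq0 // expf_neq0.
    have [n1 n2] : h'^io != 0 /\ f0^io != 0.
      by move: nz; rewrite mulf_eq0 negb_or => /andP.
    have : size (h'^io * f0^io) = 1%N.
      by rewrite hf size_polyC mulf_neq0 // expf_neq0.
    rewrite size_mul //; move: n1 n2; rewrite -!size_poly_gt0.
    by case: (size h'^io) => // x; case: (size f0^io) => // y _ _; rewrite addnS /=; case: x; case: y.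
  have [a [b e0]] := Tf0; exists f0`_0, a, b; rewrite -e0.
  have f0C : f0^io = (io f0`_0)%:P by rewrite [LHS]size1_polyC ?sf0 // coef_map.
  split; first by rewrite map_polyC f0C.
  by apply: contraNneq nf0 => z; rewrite adjoin_evE f0C z horner0.
have [e0 r00] := r0E.
(* Both factors have to survive: the leading coefficient, so that the specialized [q] has a root and
   still controls the kernel, and [r0] for the Bezout relation. *)
have lr : io (lead_coef q * r0) != 0 by rewrite rmorphM mulf_neq0.
have [m m0 Hm] := ioS lr; exists m => // F /Hm [phi [kerphi]].
rewrite rmorphM mulf_eq0 negb_or => /andP [phil phir].
have sq : size (map_poly phi q) = size q by rewrite size_map_poly_id0.
have /closed_rootP [u ru] : size (map_poly phi q) != 1%N.
  rewrite sq; apply/negP => /eqP s1; have := q_0; rewrite adjoin_evE.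
  have -> : q = (lead_coef q)%:P by rewrite lead_coefE s1 -size1_polyC // s1.
  by rewrite map_polyC hornerC => /eqP; rewrite (negPf lq).
have vu f h : f^io = h^io -> (map_poly phi f).[u] = (map_poly phi h).[u].
  by move=> /(map_ker F phi _ _ kerphi) ->.
have qu : (map_poly phi q).[u] = 0 by apply/eqP.
exists (horner_eval u \o map_poly phi); rewrite /= /horner_eval; split=> [f f_0|].
  have [e [h /vu]] := Hq f f_0; rewrite -mul_polyC !rmorphM /= !hornerM qu mulr0.
  by move/eqP; rewrite map_polyC hornerC /= rmorphXn mulf_eq0 expf_eq0 (negPf phil) andbF => /eqP.
apply: contraNneq phir => gu; have := vu _ _ e0.
by rewrite map_polyC hornerC rmorphD !rmorphM /= hornerD !hornerM gu qu !mulr0 addr0 => ->.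
Qed.

End Step.

Lemma specializes_exists (t : seq k) : exists (R : comNzRingType) (io : {rmorphism R -> k}),
  (forall x, x \in t -> exists r, io r = x) /\ specializes io.
Proof.
elim: t => [|s t [R [io [Ht ioS]]]].
  by exists int, intr; split=> //; apply: specializes_int.
exists {poly R}, (adjoin_ev io s); split; last exact: specializes_adjoin.
move=> x; rewrite inE => /predU1P [->|/Ht [r <-]].
  by exists 'X; apply: etrans (adjoin_evE io s 'X) _; rewrite map_polyX hornerX.
by exists r%:P; apply: etrans (adjoin_evE io s r%:P) _; rewrite map_polyC hornerC.
Qed.

End Specialize.

Lemma closed_field_pchar (p : nat) : prime p -> exists F : closedFieldType, p \in [pchar F].
Proof.
move=> pp; have [F [FtoK _]] := countable_algebraic_closure 'F_p.
by exists F; rewrite (fmorph_pchar FtoK) pchar_Fp.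
Qed.

(** * Reduction of a measuring modulo p *)

Section LinearExtension.
Variables (F : comNzRingType) (N : nat) (V : lmodType F) (g : 'X_{1..N} -> V).

Definition mpoly_ext (w : {mpoly F[N]}) : V := \sum_(m <- msupp w) w@_m *: g m.

Lemma mpoly_extE k w : (msize w <= k)%N ->
  mpoly_ext w = \sum_(m : 'X_{1..N < k}) w@_m *: g m.
Proof.
move=> le_k; set I : subFinType _ := 'X_{1..N < k}.
rewrite /mpoly_ext (big_mksub I) ?msupp_uniq //=; first last.
  by move=> x /msize_mdeg_lt /leq_trans; apply.
by rewrite big_rmcond //= => j /memN_msupp_eq0 ->; rewrite scale0r.
Qed.

Lemma mpoly_ext_linear : linear mpoly_ext.
Proof.
move=> c u w; pose k := maxn (msize (c *: u + w)) (maxn (msize u) (msize w)).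
rewrite !(@mpoly_extE k) ?leq_max ?leqnn ?orbT // scaler_sumr -big_split.
by apply: eq_bigr => m _ /=; rewrite mcoeffD mcoeffZ scalerDl scalerA.
Qed.

Lemma mpoly_extX m : mpoly_ext 'X_[m] = g m.
Proof. by rewrite /mpoly_ext msuppX big_seq1 mcoeffX eqxx scale1r. Qed.

End LinearExtension.

Section Reduction.
Variables (k F : fieldType) (R : comNzRingType).
Variables (io : {rmorphism R -> k}) (phi : {rmorphism R -> F}).
Hypothesis ker_phi : forall r, io r = 0 -> phi r = 0.
Variables (n : nat) (Ak : weyl_model k n) (AR : weyl_model R n) (AF : weyl_model F n).
Variables (S : sconsts k) (M : measuring S Ak).
Local Notation I := (sc_I S).
Local Notation toK := (wm_map io (A := AR) Ak).
Local Notation toF := (wm_map phi (A := AR) AF).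
Local Notation E := (ms_E M).

Variables (cR : I -> I -> I -> R) (uR : I -> R) (sR : I -> I -> R).
Variables (tR : I -> I -> I -> R) (vR : I -> R).
Hypothesis cRE : forall l i j, io (cR l i j) = sc_c l i j.
Hypothesis uRE : forall i, io (uR i) = sc_u i.
Hypothesis sRE : forall l h, io (sR l h) = ms_s M l h.
Hypothesis tRE : forall l i j, io (tR l i j) = ms_t M l i j.
Hypothesis vRE : forall i, io (vR i) = ms_v M i.
Hypothesis E_x : forall l i, exists a : AR, E l (wm_x Ak i) = toK a.
Hypothesis E_y : forall l i, exists a : AR, E l (wm_y Ak i) = toK a.

Lemma phi_eq r s : io r = io s -> phi r = phi s.
Proof.
move=> /eqP; rewrite -subr_eq0 -rmorphB => /eqP/ker_phi/eqP.
by rewrite rmorphB subr_eq0 => /eqP.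
Qed.

(** The transfer principle for all identities below: [io] need not be injective, but what it forgets
    [phi] forgets as well. *)
Lemma toF_eq a b : toK a = toK b -> toF a = toF b.
Proof.
move=> /(congr1 (wm_symbol Ak)); rewrite !wm_symbol_map => /mpolyP e.
apply: wm_symbol_inj; rewrite !wm_symbol_map; apply/mpolyP => m.
by have := e m; rewrite !mcoeff_map_mpoly => /phi_eq.
Qed.

Lemma toK_sum (J : Type) (r : seq J) (f : J -> AR) :
  toK (\sum_(i <- r) f i) = \sum_(i <- r) toK (f i).
Proof. by elim: r => [|i r IHr]; rewrite ?big_nil ?wm_map0 // !big_cons wm_mapD IHr. Qed.

Lemma toF_sum (J : Type) (r : seq J) (f : J -> AR) :
  toF (\sum_(i <- r) f i) = \sum_(i <- r) toF (f i).
Proof. by elim: r => [|i r IHr]; rewrite ?big_nil ?wm_map0 // !big_cons wm_mapD IHr. Qed.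

(** The product rule, whose constants lie in the image of [R], propagates integrality from the
    generators to all elements. *)
Lemma E_lift a : forall l, exists b : AR, toK b = E l (toK a).
Proof.
have EM g b : (forall l, exists a : AR, E l g = toK a) ->
    (forall l, exists c : AR, toK c = E l b) -> forall l, exists c : AR, toK c = E l (g * b).
  move=> Hg Hb l; pose g' i := sval (cid (Hg i)); pose b' i := sval (cid (Hb i)).
  exists (\sum_i \sum_j cR l i j *: (g' i * b' j)).
  rewrite ms_mul toK_sum; apply: eq_bigr => i _; rewrite toK_sum; apply: eq_bigr => j _.
  rewrite wm_mapZ cRE wm_mapM /g' /b'.
  by case: (cid (Hg i)) => x /= ->; case: (cid (Hb j)) => y /= ->.
elim/wm_ind: a => [|a b IHa IHb|c a IH|i a IH|i a IH] l.
- by exists (uR l *: 1); rewrite wm_mapZ wm_map1 ms_1 uRE.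
- have [a' ea] := IHa l; have [b' eb] := IHb l; exists (a' + b').
  by rewrite !wm_mapD ea eb -[X in E l (X + _)]scale1r ms_E_lin scale1r.
- have [a' ea] := IH l; exists (c *: a').
  by rewrite !wm_mapZ ea ms_EZ.
- by rewrite wm_mapM wm_map_x; apply: EM.
by rewrite wm_mapM wm_map_y; apply: EM.
Qed.

Definition ER l a : AR := sval (cid (E_lift a l)).

Lemma ERE l a : toK (ER l a) = E l (toK a).
Proof. exact: svalP (cid (E_lift a l)). Qed.

(** Elements of [AF] need not lift to [AR], but normal ordered monomials do: the reduced operator is
    fixed on these and extended linearly. *)
Definition EF l (w : AF) : AF :=
  mpoly_ext (fun m => toF (ER l (wm_quant AR 'X_[m]))) (wm_symbol AF w).

Lemma EF_lin l : linear (EF l).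
Proof. by move=> c u w; rewrite /EF linearP mpoly_ext_linear. Qed.

Lemma EF_0 l : EF l 0 = 0.
Proof. by rewrite /EF linear0 /mpoly_ext msupp0 big_nil. Qed.

Lemma toF_ER_lin l c a b : toF (ER l (c *: a + b)) = phi c *: toF (ER l a) + toF (ER l b).
Proof.
rewrite -wm_mapZ -wm_mapD; apply: toF_eq.
by rewrite ERE !wm_mapD !wm_mapZ !ERE ms_E_lin.
Qed.

Lemma EF_toF l a : EF l (toF a) = toF (ER l a).
Proof.
rewrite -[a](wm_symbolK (w := AR)); elim/mpolyind: (wm_symbol AR a) => [|c m w _ _ IHw].
  have -> : toF (wm_quant AR 0) = 0 by rewrite /wm_map !(linear0, rmorph0).
  rewrite EF_0; have := toF_ER_lin l (-1) 0 0; rewrite scaler0 addr0 rmorphN1 scaleN1r addNr.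
  by rewrite linear0.
rewrite linearP toF_ER_lin wm_mapD wm_mapZ EF_lin IHw; congr (_ *: _ + _).
rewrite /EF; have -> : wm_symbol AF (toF (wm_quant AR 'X_[m])) = 'X_[m].
  by rewrite wm_symbol_map wm_quantK map_mpolyX.
exact: mpoly_extX.
Qed.

Lemma AF_ind (Q : AF -> Prop) :
  (forall u w, Q u -> Q w -> Q (u + w)) -> (forall c u, Q u -> Q (c *: u)) ->
  (forall a, Q (toF a)) -> forall w, Q w.
Proof.
move=> QD QZ QF w; rewrite -[w](wm_symbolK (w := AF)).
elim/mpolyind: (wm_symbol AF w) => [|c m u _ _ IHu].
  by rewrite linear0 -(scale0r (toF 0)); apply: QZ.
rewrite linearP; apply: QD => //; apply: QZ.
have -> : wm_quant AF 'X_[m] = toF (wm_quant AR 'X_[m]).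
  by apply: wm_symbol_inj; rewrite wm_symbol_map !wm_quantK map_mpolyX.
exact: QF.
Qed.

Lemma AF_eq (f g : AF -> AF) :
  linear f -> linear g -> (forall a, f (toF a) = g (toF a)) -> forall w, f w = g w.
Proof.
move=> lf lg e w; elim/AF_ind: w => [u w eu ew|c u eu|a]; last exact: e.
  have := lf 1 u w; rewrite !scale1r => ->; have := lg 1 u w; rewrite !scale1r => ->.
  by rewrite eu ew.
have z (h : AF -> AF) : linear h -> h 0 = 0.
  by move=> lh; have := lh (-1) 0 0; rewrite scaler0 addr0 scaleN1r addNr.
have := lf c u 0; have := lg c u 0; rewrite !addr0 => -> ->.
by rewrite eu (z _ lf) (z _ lg).
Qed.

Lemma toF_comb (J : finType) (c : J -> R) (f : J -> AR) :
  toF (\sum_j c j *: f j) = \sum_j phi (c j) *: toF (f j).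
Proof. by rewrite toF_sum; apply: eq_bigr => j _; rewrite wm_mapZ. Qed.

Lemma toK_comb (J : finType) (c : J -> R) (f : J -> AR) :
  toK (\sum_j c j *: f j) = \sum_j io (c j) *: toK (f j).
Proof. by rewrite toK_sum; apply: eq_bigr => j _; rewrite wm_mapZ. Qed.

Lemma toF_comb2 (J : finType) (c : J -> J -> R) (f : J -> J -> AR) :
  toF (\sum_i \sum_j c i j *: f i j) = \sum_i \sum_j phi (c i j) *: toF (f i j).
Proof. by rewrite toF_sum; apply: eq_bigr => j _; rewrite toF_comb. Qed.

Lemma toK_comb2 (J : finType) (c : J -> J -> R) (f : J -> J -> AR) :
  toK (\sum_i \sum_j c i j *: f i j) = \sum_i \sum_j io (c i j) *: toK (f i j).
Proof. by rewrite toK_sum; apply: eq_bigr => j _; rewrite toK_comb. Qed.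

Lemma comb_linear (J : finType) (c : J -> F) (f : J -> AF -> AF) :
  (forall j, linear (f j)) -> linear (fun a => \sum_j c j *: f j a).
Proof.
move=> lf b u w; rewrite scaler_sumr -big_split; apply: eq_bigr => j _ /=.
by rewrite lf scalerDr !scalerA mulrC.
Qed.

Lemma comb2_linear (J : finType) (c : J -> J -> F) (f : J -> J -> AF -> AF) :
  (forall i j, linear (f i j)) -> linear (fun a => \sum_i \sum_j c i j *: f i j a).
Proof.
move=> lf b u w; rewrite scaler_sumr -big_split; apply: eq_bigr => j _ /=.
exact: comb_linear.
Qed.

Definition cF l i j : F := phi (cR l i j).
Definition uF i : F := phi (uR i).

Lemma F_assoc l i j h : \sum_s cF s i j * cF l s h = \sum_s cF s j h * cF l i s.
Proof.
transitivity (phi (\sum_s cR s i j * cR l s h)).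
  by rewrite rmorph_sum; apply: eq_bigr => s _ /=; rewrite rmorphM.
transitivity (phi (\sum_s cR s j h * cR l i s)); last first.
  by rewrite rmorph_sum; apply: eq_bigr => s _ /=; rewrite rmorphM.
apply: phi_eq; rewrite !rmorph_sum.
transitivity (\sum_s sc_c s i j * sc_c l s h); last rewrite sc_assoc;
  by apply: eq_bigr => s _; rewrite rmorphM /= !cRE.
Qed.

Lemma F_unitl l j : \sum_i uF i * cF l i j = (l == j)%:R.
Proof.
transitivity (phi (\sum_i uR i * cR l i j)).
  by rewrite rmorph_sum; apply: eq_bigr => s _ /=; rewrite rmorphM.
rewrite -(rmorph_nat phi); apply: phi_eq; rewrite rmorph_nat -sc_unitl rmorph_sum.
by apply: eq_bigr => s _; rewrite rmorphM /= cRE uRE.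
Qed.

Lemma F_unitr l i : \sum_j uF j * cF l i j = (l == i)%:R.
Proof.
transitivity (phi (\sum_j uR j * cR l i j)).
  by rewrite rmorph_sum; apply: eq_bigr => s _ /=; rewrite rmorphM.
rewrite -(rmorph_nat phi); apply: phi_eq; rewrite rmorph_nat -sc_unitr rmorph_sum.
by apply: eq_bigr => s _; rewrite rmorphM /= cRE uRE.
Qed.

(** Nonvanishing of the counit alone might be lost under [phi]. But the identity operator is a
    combination of the [E l]; applied to 1 this gives [\sum_i v_i u_i = 1], an identity that is
    preserved. *)
Lemma F_nontriv : exists i, uF i != 0.
Proof.
have e : phi (\sum_i vR i * uR i) = 1.
  rewrite -(rmorph1 phi); apply: phi_eq; rewrite rmorph1 rmorph_sum.
  apply/eqP; rewrite eq_sym -subr_eq0; apply/eqP.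
  have /eqP : (1 - \sum_i ms_v M i * sc_u i) *: (1 : Ak) = 0.
    rewrite scalerBl scale1r {1}(ms_span_id M 1) scaler_suml -sumrB big1 // => i _.
    by rewrite ms_1 scalerA subrr.
  rewrite scaler_eq0 oner_eq0 orbF => /eqP e; rewrite -[RHS]e; congr (_ - _).
  by apply: eq_bigr => i _; rewrite rmorphM /= vRE uRE.
apply/existsP; apply: contraT; rewrite negb_exists => /forallP z.
move/eqP: e; rewrite rmorph_sum big1 ?(eq_sym 0) ?oner_eq0 // => i _.
by have := z i; rewrite negbK rmorphM /= -/(uF i) => /eqP ->; rewrite mulr0.
Qed.

Definition F_sconsts : sconsts F := SConsts F_assoc F_unitl F_unitr F_nontriv.

Definition F_s l h : F := phi (sR l h).
Definition F_t l i j : F := phi (tR l i j).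
Definition F_v l : F := phi (vR l).
Definition F_sigma l (a : AF) : AF := \sum_h F_s l h *: EF h a.

Lemma F_sigma_lin l : linear (F_sigma l).
Proof. exact: comb_linear EF_lin. Qed.

Lemma F_sigma_toF l a : F_sigma l (toF a) = toF (\sum_h sR l h *: ER h a).
Proof. by rewrite toF_comb; apply: eq_bigr => h _; rewrite EF_toF. Qed.

Lemma toK_sigma l a : toK (\sum_h sR l h *: ER h a) = ms_sigma M l (toK a).
Proof. by rewrite toK_comb; apply: eq_bigr => h _; rewrite sRE ERE. Qed.

Lemma F_mul l a b :
  EF l (a * b) = \sum_i \sum_j cF l i j *: (EF i a * EF j b).
Proof.
move: a; apply: AF_eq.
- by move=> c u w; rewrite mulrDl -scalerAl EF_lin.
- by apply: comb2_linear => i j c u w; rewrite EF_lin mulrDl -scalerAl.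
move=> a; move: b; apply: AF_eq.
- by move=> c u w; rewrite mulrDr -scalerAr EF_lin.
- by apply: comb2_linear => i j c u w; rewrite EF_lin mulrDr -scalerAr.
move=> b; rewrite -wm_mapM EF_toF.
transitivity (toF (\sum_i \sum_j cR l i j *: (ER i a * ER j b))).
  apply: toF_eq; rewrite ERE wm_mapM ms_mul toK_comb2.
  by apply: eq_bigr => i _; apply: eq_bigr => j _; rewrite cRE wm_mapM !ERE.
rewrite toF_comb2; apply: eq_bigr => i _; apply: eq_bigr => j _.
by rewrite wm_mapM !EF_toF.
Qed.

Lemma F_1 l : EF l 1 = (uF l)%:A.
Proof.
rewrite -(wm_map1 phi AR AF) EF_toF -wm_mapZ; apply: toF_eq.
by rewrite ERE wm_mapZ wm_map1 ms_1 uRE.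
Qed.

Lemma F_E_sigma l a : \sum_i \sum_j cF l i j *: EF i (F_sigma j a) = uF l *: a.
Proof.
move: a; apply: AF_eq.
- by apply: comb2_linear => i j c u w; rewrite F_sigma_lin EF_lin.
- by move=> c u w; rewrite scalerDr !scalerA mulrC.
move=> a; rewrite -wm_mapZ.
transitivity (toF (\sum_i \sum_j cR l i j *: ER i (\sum_h sR j h *: ER h a))).
  rewrite toF_comb2; apply: eq_bigr => i _; apply: eq_bigr => j _.
  by rewrite F_sigma_toF EF_toF.
apply: toF_eq; rewrite wm_mapZ uRE -(ms_E_sigma M) toK_comb2.
by apply: eq_bigr => i _; apply: eq_bigr => j _; rewrite cRE ERE toK_sigma.
Qed.

Lemma F_sigma_E l a : \sum_i \sum_j cF l i j *: F_sigma i (EF j a) = uF l *: a.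
Proof.
move: a; apply: AF_eq.
- by apply: comb2_linear => i j c u w; rewrite EF_lin F_sigma_lin.
- by move=> c u w; rewrite scalerDr !scalerA mulrC.
move=> a; rewrite -wm_mapZ.
transitivity (toF (\sum_i \sum_j cR l i j *: (\sum_h sR i h *: ER h (ER j a)))).
  rewrite toF_comb2; apply: eq_bigr => i _; apply: eq_bigr => j _.
  by rewrite EF_toF F_sigma_toF.
apply: toF_eq; rewrite wm_mapZ uRE -(ms_sigma_E M) toK_comb2.
by apply: eq_bigr => i _; apply: eq_bigr => j _; rewrite cRE toK_sigma ERE.
Qed.

Lemma F_span_sigma v h a : F_sigma v (EF h a) = \sum_l F_t v h l *: EF l a.
Proof.
move: a; apply: AF_eq.
- by move=> c u w; rewrite EF_lin F_sigma_lin.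
- exact: comb_linear EF_lin.
move=> a; rewrite EF_toF F_sigma_toF.
transitivity (toF (\sum_l tR v h l *: ER l a)); last first.
  by rewrite toF_comb; apply: eq_bigr => l _; rewrite EF_toF.
apply: toF_eq; rewrite toK_sigma ERE ms_span_sigma toK_comb.
by apply: eq_bigr => l _; rewrite tRE ERE.
Qed.

Lemma F_span_id a : a = \sum_l F_v l *: EF l a.
Proof.
move: a; apply: AF_eq => [//||a]; first exact: comb_linear EF_lin.
transitivity (toF (\sum_l vR l *: ER l a)); last first.
  by rewrite toF_comb; apply: eq_bigr => l _; rewrite EF_toF.
apply: toF_eq; rewrite [LHS](ms_span_id M) toK_comb.
by apply: eq_bigr => l _; rewrite vRE ERE.
Qed.

Definition F_measuring : measuring F_sconsts AF :=
  @Measuring F F_sconsts AF EF F_s F_t F_v EF_lin F_mul F_1 F_E_sigma F_sigma_E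
    F_span_sigma F_span_id.

Lemma msize_map_mpoly N (w : {mpoly R[N]}) : (msize (map_mpoly phi w) <= msize w)%N.
Proof.
rewrite msizeE; apply/bigmax_leqP_seq => m; rewrite mcoeff_msupp mcoeff_map_mpoly => nz _.
apply: msize_mdeg_lt; rewrite mcoeff_msupp.
by apply: contraTneq nz => -> /=; rewrite rmorph0 eqxx.
Qed.

Lemma mcoeff_toF a m : (wm_symbol AF (toF a))@_m = phi (wm_symbol AR a)@_m.
Proof. by rewrite wm_symbol_map mcoeff_map_mpoly. Qed.

Lemma phi_comb2 (J : finType) (c x : J -> J -> R) :
  phi (\sum_i \sum_j c i j * x i j) = \sum_i \sum_j phi (c i j) * phi (x i j).
Proof.
rewrite rmorph_sum; apply: eq_bigr => i _ /=; rewrite rmorph_sum.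
by apply: eq_bigr => j _ /=; rewrite rmorphM.
Qed.

Lemma reduced_coefs_comm p (pF : p \in [pchar F]) b1 b2 (X1 X2 : I -> AR) m1 m2 l :
  (#|I| < p)%N ->
  (forall i, toK (X1 i) = E i (toK b1)) -> (forall i, toK (X2 i) = E i (toK b2)) ->
  (forall i, msize (wm_symbol AR (X1 i)) <= p)%N ->
  (forall i, msize (wm_symbol AR (X2 i)) <= p)%N ->
  phi (\sum_i \sum_j cR l i j * ((wm_symbol AR (X1 i))@_m1 * (wm_symbol AR (X2 j))@_m2)) =
  phi (\sum_i \sum_j cR l i j * ((wm_symbol AR (X2 i))@_m2 * (wm_symbol AR (X1 j))@_m1)).
Proof.
move=> lt_p e1 e2 s1 s2.
have EX b (X : I -> AR) : (forall i, toK (X i) = E i (toK b)) ->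
    forall i, EF i (toF b) = toF (X i).
  by move=> e i; rewrite EF_toF; apply: toF_eq; rewrite ERE e.
have sm b (X : I -> AR) : (forall i, toK (X i) = E i (toK b)) ->
    (forall i, msize (wm_symbol AR (X i)) <= p)%N -> small_coefs p F_measuring (toF b).
  move=> e s i; rewrite /= (EX _ _ e) wm_symbol_map.
  exact: leq_trans (msize_map_mpoly _) (s i).
have main := weyl_coefs_comm (M := F_measuring) pF lt_p m1 m2 l (sm _ _ e1 s1) (sm _ _ e2 s2).
rewrite !phi_comb2.
have eqs b b' (X X' : I -> AR) m m' : (forall i, toK (X i) = E i (toK b)) ->
    (forall i, toK (X' i) = E i (toK b')) ->
    \sum_i \sum_j cF l i j * ((wm_symbol AF (EF i (toF b)))@_m *
        (wm_symbol AF (EF j (toF b')))@_m') =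
    \sum_i \sum_j phi (cR l i j) *
      phi ((wm_symbol AR (X i))@_m * (wm_symbol AR (X' j))@_m').
  move=> e e'; apply: eq_bigr => i _; apply: eq_bigr => j _.
  by rewrite (EX _ _ e) (EX _ _ e') !mcoeff_toF rmorphM.
exact: etrans (esym (eqs _ _ _ _ _ _ e1 e2)) (etrans main (eqs _ _ _ _ _ _ e2 e1)).
Qed.

End Reduction.

(** * Commutation of the coefficients in characteristic zero *)

Section CharZero.
Variables (k : fieldType) (char0 : [pchar k] =i pred0) (n : nat).
Variables (A : weyl_model k n) (S : sconsts k) (M : measuring S A).
Local Notation I := (sc_I S).
Local Notation E := (ms_E M).
Local Notation symbol := (wm_symbol A).

Definition weyl_generator (b : A) :=
  (exists i, b = wm_x A i) \/ (exists i, b = wm_y A i).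

Definition symbol_coefs (a : A) : seq k := [seq (symbol a)@_m | m <- msupp (symbol a)].

Definition measuring_consts : seq k :=
  [seq sc_c p.1.1 p.1.2 p.2 | p : I * I * I] ++ [seq sc_u i | i : I] ++
  [seq ms_s M p.1 p.2 | p : I * I] ++ [seq ms_t M p.1.1 p.1.2 p.2 | p : I * I * I] ++
  [seq ms_v M i | i : I] ++
  flatten [seq symbol_coefs (E p.1 (wm_x A p.2)) | p : I * 'I_n] ++
  flatten [seq symbol_coefs (E p.1 (wm_y A p.2)) | p : I * 'I_n].

Theorem weyl_coefs_comm0 b1 b2 m1 m2 l :
  weyl_generator b1 -> weyl_generator b2 ->
  \sum_i \sum_j sc_c l i j * ((symbol (E i b1))@_m1 * (symbol (E j b2))@_m2) =
  \sum_i \sum_j sc_c l i j * ((symbol (E i b2))@_m2 * (symbol (E j b1))@_m1).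
Proof.
move=> gen1 gen2.
have [R [io [Ht ioS]]] := specializes_exists char0 measuring_consts.
have [x|lift liftE] := @choice _ _ (fun x y => x \in measuring_consts -> io y = x).
  have [/Ht [r er]|_] := boolP (x \in measuring_consts); first by exists r.
  by exists 0.
pose AR := weyl_alg_model R n.
pose cR l i j := lift (@sc_c _ S l i j).
pose uR i := lift (@sc_u _ S i).
pose sR l h := lift (ms_s M l h).
pose tR l i j := lift (ms_t M l i j).
pose vR i := lift (ms_v M i).
have cRE l' i j : io (cR l' i j) = sc_c l' i j.
  apply: liftE; rewrite /measuring_consts mem_cat; apply/orP; left.
  by apply/imageP; exists (l', i, j).
have uRE i : io (uR i) = sc_u i.
  apply: liftE; rewrite /measuring_consts !mem_cat; apply/or3P; constructor 2.
  by apply/imageP; exists i.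
have sRE l' h : io (sR l' h) = ms_s M l' h.
  apply: liftE; rewrite /measuring_consts !mem_cat; do 2!(apply/orP; right); apply/orP; left.
  by apply/imageP; exists (l', h).
have tRE l' i j : io (tR l' i j) = ms_t M l' i j.
  apply: liftE; rewrite /measuring_consts !mem_cat; do 3!(apply/orP; right); apply/orP; left.
  by apply/imageP; exists (l', i, j).
have vRE i : io (vR i) = ms_v M i.
  apply: liftE; rewrite /measuring_consts !mem_cat; do 4!(apply/orP; right); apply/orP; left.
  by apply/imageP; exists i.
have toK_lift a : {subset symbol_coefs a <= measuring_consts} ->
    exists a' : AR, wm_map io (A := AR) A a' = a.
  move=> sub; pose w := \sum_(m <- msupp (symbol a)) lift (symbol a)@_m *: 'X_[m].
  exists (wm_quant AR w); apply: wm_symbol_inj.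
  rewrite wm_symbol_map wm_quantK /w rmorph_sum [RHS]mpolyE.
  rewrite big_seq [RHS]big_seq; apply: eq_bigr => m m_in.
  rewrite /= map_mpolyZ map_mpolyX liftE //; apply: sub.
  by apply/mapP; exists m.
have E_x l' i : exists a : AR, E l' (wm_x A i) = wm_map io (A := AR) A a.
  have [|a <-] := toK_lift (E l' (wm_x A i)); last by exists a.
  move=> x xin; rewrite /measuring_consts !mem_cat.
  do 5!(apply/orP; right); apply/orP; left; apply/flatten_imageP.
  by exists (l', i).
have E_y l' i : exists a : AR, E l' (wm_y A i) = wm_map io (A := AR) A a.
  have [|a <-] := toK_lift (E l' (wm_y A i)); last by exists a.
  move=> x xin; rewrite /measuring_consts !mem_cat.
  do 6!(apply/orP; right); apply/flatten_imageP.
  by exists (l', i).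
have gen_lift b : weyl_generator b -> exists (b' : AR) (X : I -> AR),
    wm_map io (A := AR) A b' = b /\ forall i, wm_map io (A := AR) A (X i) = E i b.
  move=> gen.
  have [b' eb'] : exists b' : AR, wm_map io (A := AR) A b' = b.
    case: gen => [[i ->]|[i ->]]; first by exists (wm_x AR i); apply: wm_map_x.
    by exists (wm_y AR i); apply: wm_map_y.
  have [X eX] : exists X : I -> AR, forall i, wm_map io (A := AR) A (X i) = E i b.
    have [i|X eX] := @choice _ _ (fun i x => wm_map io (A := AR) A x = E i b); last by exists X.
    by case: gen => [[j ->]|[j ->]]; [have [a ->] := E_x i j | have [a ->] := E_y i j];
      exists a.
  by exists b', X.
have [b1' [X1 [eb1 eX1]]] := gen_lift _ gen1.
have [b2' [X2 [eb2 eX2]]] := gen_lift _ gen2.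
pose cc (X X' : I -> AR) m m' := \sum_i \sum_j cR l i j *
  ((wm_symbol AR (X i))@_m * (wm_symbol AR (X' j))@_m').
have ioE b b' (X X' : I -> AR) m m' : (forall i, wm_map io (A := AR) A (X i) = E i b) ->
    (forall i, wm_map io (A := AR) A (X' i) = E i b') -> io (cc X X' m m') =
    \sum_i \sum_j sc_c l i j * ((symbol (E i b))@_m * (symbol (E j b'))@_m').
  move=> e e'; rewrite /cc rmorph_sum; apply: eq_bigr => i _ /=; rewrite rmorph_sum.
  apply: eq_bigr => j _ /=; rewrite !rmorphM /= cRE -e -e' !wm_symbol_map.
  by rewrite !mcoeff_map_mpoly.
rewrite -(ioE _ _ _ _ _ _ eX1 eX2) -(ioE _ _ _ _ _ _ eX2 eX1).
apply/eqP; rewrite -subr_eq0 -rmorphB; apply: contraT => /ioS [m m0 HF].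
(* The prime must exceed [m] for the specialization to exist, [#|I|] for the index argument, and the
   sizes of all symbols involved for their coefficients to be coordinates over the center. *)
pose d := (m + #|I| + \max_i msize (wm_symbol AR (X1 i)) +
  \max_i msize (wm_symbol AR (X2 i)))%N.
have [p lt_dp pr_p] := prime_above d.
have [F pF] := closed_field_pchar pr_p.
have mF : m%:R != 0 :> F.
  rewrite -(dvdn_pcharf pF); apply/negP => /(dvdn_leq m0); rewrite leqNgt.
  by rewrite (leq_ltn_trans _ lt_dp) // /d -!addnA leq_addr.
have [phi [ker_phi]] := HF F mF; rewrite rmorphB subr_eq0.
apply: contraNT => _; apply/eqP.
apply: (reduced_coefs_comm ker_phi (weyl_alg_model F n) cRE uRE sRE tRE vRE E_x E_y pF
  (b1 := b1') (b2 := b2')).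
- by rewrite (leq_ltn_trans _ lt_dp) // /d -!addnA addnCA leq_addr.
- by move=> i; rewrite eb1.
- by move=> i; rewrite eb2.
- move=> i; apply: leq_trans (ltnW lt_dp); rewrite /d -addnA addnCA.
  apply: leq_trans (leq_addr _ _).
  exact: (leq_bigmax (F := fun i => msize (wm_symbol AR (X1 i)))).
- move=> i; apply: leq_trans (ltnW lt_dp); rewrite /d.
  apply: leq_trans (leq_addl _ _).
  exact: (leq_bigmax (F := fun i => msize (wm_symbol AR (X2 i)))).
Qed.

End CharZero.

(** * The dual of a finite dimensional Hopf algebra *)

Section HopfConsts.
Variables (k : fieldType) (H : finHopfAlgType k).
Local Notation I := 'I_(\dim {: H}).
Implicit Types (x y h : H).

Definition hbase (l : I) : H := (vbasis {: H})`_l.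
Definition hcoord (l : I) (h : H) : k := coord (vbasis {: H}) l h.

HB.instance Definition _ l := GRing.isLinear.Build k H k *%R (hcoord l)
  (fun c x y => linearP (coord (vbasis {: H}) l) c x y).

Lemma hbaseE h : h = \sum_l hcoord l h *: hbase l.
Proof. exact: coord_vbasis (memvf h). Qed.

Lemma hcoord_base l j : hcoord l (hbase j) = (l == j)%:R.
Proof. by rewrite eq_sym; apply: (coord_free j l (basis_free (vbasisP {: H}))). Qed.

Lemma linear_base (W : lmodType k) (f : H -> W) h :
  linear f -> f h = \sum_l hcoord l h *: f (hbase l).
Proof.
move=> lf; pose F : {linear H -> W} := HB.pack f (GRing.isLinear.Build k H W *:%R f lf).
rewrite -[LHS]/(F h) {1}[h]hbaseE linear_sum.
by apply: eq_bigr => l _; rewrite linearZ.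
Qed.

Definition hc (l i j : I) : k := \sum_(p <- comul (hbase l)) hcoord i p.1 * hcoord j p.2.
Definition hu (l : I) : k := counit (hbase l).

Lemma bilinear_base (W : lmodType k) (f : H -> H -> W) x y :
  bilinear_for *:%R *:%R f ->
  f x y = \sum_i \sum_j (hcoord i x * hcoord j y) *: f (hbase i) (hbase j).
Proof.
move=> bf; rewrite (linear_base x (bf.1 y)); apply: eq_bigr => i _ /=.
rewrite (linear_base y (bf.2 _)) scaler_sumr; apply: eq_bigr => j _.
by rewrite scalerA.
Qed.

(** A coproduct is a sequence known only through bilinear maps; expanding these in a basis replaces
    the sequence by coordinates. *)
Lemma sum_comul (W : lmodType k) (f : H -> H -> W) x :
  bilinear_for *:%R *:%R f ->
  \sum_(p <- comul x) f p.1 p.2 =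
  \sum_i \sum_j (\sum_(p <- comul x) hcoord i p.1 * hcoord j p.2) *:
     f (hbase i) (hbase j).
Proof.
move=> bf; under eq_bigr => p _ do rewrite (bilinear_base p.1 p.2 bf).
rewrite exchange_big; apply: eq_bigr => i _ /=; rewrite exchange_big.
by apply: eq_bigr => j _ /=; rewrite scaler_suml.
Qed.

Lemma bilinear_coord i j :
  bilinear_for *:%R *:%R (fun x y => hcoord i x * hcoord j y : k^o).
Proof.
split=> u c x y /=; first by rewrite linearP mulrDl -mulrA.
by rewrite linearP mulrDr /GRing.scale /= mulrCA.
Qed.

Lemma comul_coord i j x :
  \sum_(p <- comul x) hcoord i p.1 * hcoord j p.2 = \sum_l hcoord l x * hc l i j.
Proof. exact: linear_base (sum_comul_linear (bilinear_coord i j)). Qed.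

Lemma sum_comul_base (W : lmodType k) (f : H -> H -> W) l :
  bilinear_for *:%R *:%R f ->
  \sum_(p <- comul (hbase l)) f p.1 p.2 =
  \sum_i \sum_j hc l i j *: f (hbase i) (hbase j).
Proof. exact: sum_comul. Qed.

Lemma hc_assoc l i j m : \sum_s hc s i j * hc l s m = \sum_s hc s j m * hc l i s.
Proof.
have tf : trilinear (fun u v w => hcoord i u * hcoord j v * hcoord m w : k^o).
  by split=> u v c x y /=; rewrite linearP /GRing.scale /=; ring.
have := @comul_A k H (hbase l) _ _ tf; rewrite !big_allpairs_dep /= => e.
transitivity (\sum_(p <- comul (hbase l)) \sum_(q <- comul p.1)
    hcoord i q.1 * hcoord j q.2 * hcoord m p.2).
  under [RHS]eq_bigr => p _ do rewrite -mulr_suml comul_coord mulr_suml.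
  rewrite exchange_big; apply: eq_bigr => s _; rewrite /hc mulr_sumr.
  by apply: eq_bigr => p _ /=; rewrite mulrCA mulrA.
rewrite e; under eq_bigr => p _.
  under eq_bigr => q _ do rewrite -mulrA.
  rewrite -mulr_sumr comul_coord mulr_sumr; over.
rewrite exchange_big; apply: eq_bigr => s _; rewrite [hc l i s]/hc mulr_sumr.
by apply: eq_bigr => p _ /=; ring.
Qed.

Lemma hc_unitl l j : \sum_i hu i * hc l i j = (l == j)%:R.
Proof.
rewrite eq_sym -hcoord_base -[in RHS](counitl (hbase l)) linear_sum.
under eq_bigr => i _ do rewrite /hc mulr_sumr.
rewrite exchange_big; apply: eq_bigr => p _ /=; rewrite linearZ /=.
rewrite {2}[p.1]hbaseE linear_sum mulr_suml; apply: eq_bigr => i _.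
by rewrite linearZ /= -/(hu i) mulrCA mulrA.
Qed.

Lemma hc_unitr l i : \sum_j hu j * hc l i j = (l == i)%:R.
Proof.
rewrite eq_sym -hcoord_base -[in RHS](counitr (hbase l)) linear_sum.
under eq_bigr => j _ do rewrite /hc mulr_sumr.
rewrite exchange_big; apply: eq_bigr => p _ /=; rewrite linearZ /=.
rewrite {2}[p.2]hbaseE linear_sum mulr_suml; apply: eq_bigr => j _.
by rewrite linearZ /= -/(hu j); ring.
Qed.

Lemma hu_nontriv : exists i, hu i != 0.
Proof.
apply/existsP; apply: contraT; rewrite negb_exists => /forallP z.
have /eqP : counit (\sum_l hcoord l (1 : H) *: hbase l) = 1 by rewrite -hbaseE rmorph1.
rewrite linear_sum big1 ?(eq_sym 0) ?oner_eq0 // => i _.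
by have := z i; rewrite negbK linearZ /= -/(hu i) => /eqP ->; rewrite mulr0.
Qed.

Definition hopf_sconsts : sconsts k := SConsts hc_assoc hc_unitl hc_unitr hu_nontriv.

End HopfConsts.

Section Eval.
Variables (k : fieldType) (H : finHopfAlgType k).
Local Notation K := (scalg (hopf_sconsts H) k^o).
Implicit Types (f g : K) (x y h : H).

Definition ev f h : k := \sum_l hcoord l h * f l.
Definition functional (phi : H -> k) : K := [ffun l => phi (hbase l) : k^o].

Lemma ev_scalar f : scalar (ev f).
Proof.
move=> c x y; rewrite /ev mulr_sumr -big_split; apply: eq_bigr => l _ /=.
by rewrite linearP mulrDl -mulrA.
Qed.

HB.instance Definition _ f := GRing.isLinear.Build k H k *%R (ev f) (ev_scalar f).

Lemma evD f g h : ev (f + g) h = ev f h + ev g h.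
Proof. by rewrite /ev -big_split; apply: eq_bigr => l _; rewrite scalgDE mulrDr. Qed.

Lemma evZ c f h : ev (c *: f) h = c * ev f h.
Proof.
by rewrite /ev mulr_sumr; apply: eq_bigr => l _; rewrite scalgZE /GRing.scale /= mulrCA.
Qed.

Lemma ev_sum (J : Type) (r : seq J) (F : J -> K) h :
  ev (\sum_(i <- r) F i) h = \sum_(i <- r) ev (F i) h.
Proof.
elim: r => [|i r IHr]; rewrite ?big_nil ?big_cons ?evD ?IHr //.
by rewrite -(scale0r (0 : K)) evZ mul0r.
Qed.

Lemma ev_base f l : ev f (hbase l) = f l.
Proof.
rewrite /ev (bigD1 l) //= big1 => [|i il]; rewrite hcoord_base ?eqxx ?mul1r ?addr0 //.
by rewrite (negPf il) mul0r.
Qed.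

Lemma ev_functional (phi : H -> k) h : scalar phi -> ev (functional phi) h = phi h.
Proof.
move=> sphi; rewrite [RHS](linear_base (W := k^o) h sphi).
by apply: eq_bigr => l _; rewrite ffunE.
Qed.

Lemma ev_inj f g : (forall h, ev f h = ev g h) -> f = g.
Proof. by move=> e; apply/ffunP => l; rewrite -!ev_base. Qed.

Lemma bilinear_ev f g : bilinear_for *:%R *:%R (fun x y => ev f x * ev g y : k^o).
Proof. by split=> u c x y /=; rewrite linearP /GRing.scale /=; ring. Qed.

Lemma evM f g h : ev (f * g) h = \sum_(p <- comul h) ev f p.1 * ev g p.2.
Proof.
rewrite [RHS](linear_base h (sum_comul_linear (bilinear_ev f g))).
apply: eq_bigr => l _; rewrite (sum_comul_base l (bilinear_ev f g)) scalgME.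
by congr (_ * _); do 2!(apply: eq_bigr => ? _); rewrite !ev_base.
Qed.

Lemma ev1 h : ev 1 h = counit h.
Proof.
rewrite [in RHS](hbaseE h) linear_sum; apply: eq_bigr => l _.
by rewrite scalg1E linearZ /= [X in _ * X]mulr1.
Qed.

Definition ltrans h f : K := functional (fun x => ev f (h * x)).
Definition rtrans h f : K := functional (fun x => ev f (x * h)).

Lemma ev_ltrans h f x : ev (ltrans h f) x = ev f (h * x).
Proof.
by rewrite ev_functional // => c u v; rewrite mulrDr -scalerAr linearP.
Qed.

Lemma ev_rtrans h f x : ev (rtrans h f) x = ev f (x * h).
Proof.
by rewrite ev_functional // => c u v; rewrite mulrDl -scalerAl linearP.
Qed.

Lemma rtrans_linear h : linear (rtrans h).
Proof. by move=> c f g; apply: ev_inj => x; rewrite !(ev_rtrans, evD, evZ). Qed.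

Lemma rtrans_linearl f : linear (rtrans^~ f).
Proof.
move=> c y h; apply: ev_inj => x.
by rewrite !(ev_rtrans, evD, evZ) mulrDr -scalerAr linearP.
Qed.

Lemma rtransM y h f : rtrans y (rtrans h f) = rtrans (y * h) f.
Proof. by apply: ev_inj => x; rewrite !ev_rtrans mulrA. Qed.

Lemma rtrans1 f : rtrans 1 f = f.
Proof. by apply: ev_inj => x; rewrite ev_rtrans mulr1. Qed.

Lemma ev_comul_mul (f g : K) x h :
  \sum_(p <- comul (x * h)) ev f p.1 * ev g p.2 =
  \sum_(p <- comul x) \sum_(q <- comul h) ev f (p.1 * q.1) * ev g (p.2 * q.2).
Proof. by rewrite (@comul_M k H x h _ _ (bilinear_ev f g)) big_allpairs_dep. Qed.

Lemma rtrans_mul h f g : rtrans h (f * g) = \sum_(p <- comul h) rtrans p.1 f * rtrans p.2 g.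
Proof.
apply: ev_inj => x; rewrite ev_rtrans evM ev_comul_mul exchange_big ev_sum.
apply: eq_bigr => q _; rewrite evM; apply: eq_bigr => p _.
by rewrite !ev_rtrans.
Qed.

Lemma ltrans_mul h f g : ltrans h (f * g) = \sum_(p <- comul h) ltrans p.1 f * ltrans p.2 g.
Proof.
apply: ev_inj => x; rewrite ev_ltrans evM ev_comul_mul ev_sum.
apply: eq_bigr => q _; rewrite evM; apply: eq_bigr => p _.
by rewrite !ev_ltrans.
Qed.

End Eval.

(** * Annihilators of subalgebras of the dual *)

Section SubHopf.
Variables (k : fieldType) (H : finHopfAlgType k).
Local Notation K := (scalg (hopf_sconsts H) k^o).
Variable L : {vspace K}.
Hypothesis L1 : 1 \in L.
Hypothesis LM : forall f g, f \in L -> g \in L -> f * g \in L.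
Hypothesis L_ltrans : forall h f, f \in L -> ltrans h f \in L.
Hypothesis L_rtrans : forall h f, f \in L -> rtrans h f \in L.
Implicit Types (f g : K) (x y h : H).

Definition annih (x : H) : bool := `[< forall f, f \in L -> ev f x = 0 >].

Lemma annihP x : reflect (forall f, f \in L -> ev f x = 0) (annih x).
Proof. exact: asboolP. Qed.

Lemma annihD x y : annih x -> annih y -> annih (x + y).
Proof. by move=> /annihP Ix /annihP Iy; apply/annihP => f Lf; rewrite linearD /= Ix ?Iy ?addr0. Qed.

Lemma annihZ c x : annih x -> annih (c *: x).
Proof. by move=> /annihP Ix; apply/annihP => f Lf; rewrite linearZ /= Ix ?mulr0. Qed.

Lemma annih0 : annih 0.
Proof. by apply/annihP => f _; rewrite linear0. Qed.

Lemma annihMl h x : annih x -> annih (h * x).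
Proof.
by move=> /annihP Ix; apply/annihP => f Lf; rewrite -ev_ltrans Ix ?L_ltrans.
Qed.

Lemma annihMr h x : annih x -> annih (x * h).
Proof.
by move=> /annihP Ix; apply/annihP => f Lf; rewrite -ev_rtrans Ix ?L_rtrans.
Qed.

Lemma annih1 : ~~ annih 1.
Proof.
apply/negP => /annihP /(_ _ L1); rewrite ev1 rmorph1 => /eqP.
by rewrite oner_eq0.
Qed.

Lemma annih_counit x : annih x -> counit x = 0.
Proof. by move=> /annihP /(_ _ L1); rewrite ev1. Qed.

Local Notation J := 'I_(\dim L).

Definition lbase (j : J) : K := (vbasis L)`_j.

Lemma lbase_in j : lbase j \in L.
Proof. by apply: vbasis_mem; apply: mem_nth; rewrite size_tuple. Qed.

Definition lcoord (j : J) (f : K) : k := coord (vbasis L) j (projv L f).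

Lemma lcoord_scalar j : scalar (lcoord j).
Proof. by move=> c f g; rewrite /lcoord !linearP. Qed.

HB.instance Definition _ j := GRing.isLinear.Build k K k *%R (lcoord j) (lcoord_scalar j).

Lemma lbaseE f : f \in L -> f = \sum_j lcoord j f *: lbase j.
Proof. by move=> Lf; rewrite /lcoord (projv_id Lf); apply: coord_vbasis. Qed.

Definition hdelta (m : 'I_(\dim {: H})) : K := [ffun l => (l == m)%:R : k^o].

(** Reflexivity of a finite dimensional space: the element of [H] that represents a functional on
    the dual. *)
Definition coev (phi : K -> k) : H := \sum_m phi (hdelta m) *: hbase m.

Lemma hdeltaE f : f = \sum_m f m *: hdelta m.
Proof.
apply: ev_inj => h; rewrite ev_sum; apply: eq_bigr => m _; rewrite evZ mulrC.
congr (_ * _); rewrite /ev (bigD1 m) //= big1 => [|l lm]; rewrite ffunE ?eqxx ?mulr1 ?addr0 //.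
by rewrite (negPf lm) mulr0.
Qed.

Lemma ev_coev (phi : K -> k) f : scalar phi -> ev f (coev phi) = phi f.
Proof.
move=> sphi; pose F : {scalar K} := HB.pack phi (GRing.isLinear.Build k K k *%R phi sphi).
rewrite /coev linear_sum -[RHS]/(F f) [in RHS](hdeltaE f) linear_sum.
by apply: eq_bigr => m _; rewrite !linearZ /= ev_base mulrC.
Qed.

Definition lpoint (j : J) : H := coev (lcoord j).

Lemma ev_lpoint f j : ev f (lpoint j) = lcoord j f.
Proof. exact: ev_coev (lcoord_scalar j). Qed.

(** The points [lpoint j] are dual to the basis of [L], so this is a projection of [H] along the
    annihilator of [L]. *)
Definition lproj (x : H) : H := \sum_j ev (lbase j) x *: lpoint j.

Lemma lproj_annih x : annih (x - lproj x).
Proof.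
apply/annihP => f Lf; rewrite linearB /= /lproj linear_sum /= {1}(lbaseE Lf) ev_sum -sumrB.
by apply: big1 => j _; rewrite evZ linearZ /= ev_lpoint mulrC subrr.
Qed.

Lemma linear_lproj (W : lmodType k) (F : H -> W) x : linear F ->
  (forall x, annih x -> F x = 0) -> F x = \sum_j ev (lbase j) x *: F (lpoint j).
Proof.
move=> lF F0; pose G : {linear H -> W} := HB.pack F (GRing.isLinear.Build k H W *:%R F lF).
have /eqP := F0 _ (lproj_annih x); rewrite -[F _]/(G _) linearB subr_eq0 /= => /eqP ->.
by rewrite -[LHS]/(G _) linear_sum; apply: eq_bigr => j _; rewrite linearZ.
Qed.

Section AnnihBilinear.
Variables (W : lmodType k) (B : H -> H -> W).
Hypothesis bB : bilinear_for *:%R *:%R B.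
Hypothesis Bl : forall x y, annih x -> B x y = 0.
Hypothesis Br : forall x y, annih y -> B x y = 0.

Lemma bilinear_lproj x y :
  B x y = \sum_i \sum_j (ev (lbase i) x * ev (lbase j) y) *: B (lpoint i) (lpoint j).
Proof.
rewrite (linear_lproj x (bB.1 y)); last by move=> u /(Bl y).
apply: eq_bigr => i _ /=; rewrite (linear_lproj y (bB.2 _)); last by move=> u /(Br (lpoint i)).
by rewrite scaler_sumr; apply: eq_bigr => j _; rewrite scalerA.
Qed.

(** Modulo the annihilator the coproduct is dual to the product of [L]. *)
Lemma sum_comul_lproj x : \sum_(p <- comul x) B p.1 p.2 =
  \sum_i \sum_j ev (lbase i * lbase j) x *: B (lpoint i) (lpoint j).
Proof.
under eq_bigr => p _ do rewrite bilinear_lproj.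
rewrite exchange_big; apply: eq_bigr => i _ /=; rewrite exchange_big.
by apply: eq_bigr => j _ /=; rewrite -scaler_suml evM.
Qed.

End AnnihBilinear.

Lemma lproj_linear : linear lproj.
Proof.
move=> c x y; rewrite /lproj scaler_sumr -big_split; apply: eq_bigr => j _ /=.
by rewrite linearP scalerDl scalerA.
Qed.

HB.instance Definition _ := GRing.isLinear.Build k H H *:%R lproj lproj_linear.

Lemma lproj0 x : annih x -> lproj x = 0.
Proof. by move=> /annihP Ix; apply: big1 => j _; rewrite Ix ?scale0r ?lbase_in. Qed.

(** With [P] for [lproj], split [u (x) v] as [(u - P u) (x) v + P u (x) (v - P v) + P u (x) P v].
    Over [comul x] the last terms add up to zero, because products of elements of [L] lie in [L] and
    so vanish at [x]. *)
Lemma annih_comul x : annih x -> exists s t : seq (H * H),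
  [/\ all (fun p => annih p.1) s, all (fun p => annih p.2) t & eq_tens (comul x) (s ++ t)].
Proof.
move=> Ix; exists [seq (p.1 - lproj p.1, p.2) | p <- comul x],
  [seq (lproj p.1, p.2 - lproj p.2) | p <- comul x]; split.
- by apply/allP => _ /mapP [p _ ->]; apply: lproj_annih.
- by apply/allP => _ /mapP [p _ ->]; apply: lproj_annih.
move=> W F bF; rewrite big_cat !big_map /= -big_split /=.
pose B a b := F (lproj a) (lproj b).
have bB : bilinear_for *:%R *:%R B.
  by split=> u c a b; rewrite /B /= linearP; [apply: (bF.1 (lproj u)) | apply: (bF.2 (lproj u))].
have Bl a b : annih a -> B a b = 0 by move=> Ia; rewrite /B (lproj0 Ia) (bilin0l _ bF).
have Br a b : annih b -> B a b = 0 by move=> Ib; rewrite /B (lproj0 Ib) (bilin0r _ bF).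
have B0 : \sum_(p <- comul x) B p.1 p.2 = 0.
  rewrite (sum_comul_lproj bB Bl Br) big1 // => i _; rewrite big1 // => j _.
  by have /annihP -> := Ix; rewrite ?scale0r // LM ?lbase_in.
rewrite -[RHS]addr0 -[X in _ = _ + X]B0 -big_split; apply: eq_bigr => p _ /=.
have := bF.1 p.2 1 (p.1 - lproj p.1) (lproj p.1); rewrite !scale1r subrK => ->.
have := bF.2 (lproj p.1) 1 (p.2 - lproj p.2) (lproj p.2); rewrite !scale1r subrK => ->.
by rewrite /= !scale1r addrA.
Qed.

Local Notation E := (scalg (hopf_sconsts H) H).

Definition app (phi : E) (x : H) : H := \sum_l hcoord l x *: phi l.

Lemma app_linear phi : linear (app phi).
Proof.
move=> c x y; rewrite /app scaler_sumr -big_split; apply: eq_bigr => j _ /=.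
by rewrite linearP scalerDl scalerA.
Qed.

Lemma app_base phi l : app phi (hbase l) = phi l.
Proof.
rewrite /app (bigD1 l) //= big1 => [|i il]; rewrite hcoord_base ?eqxx ?scale1r ?addr0 //.
by rewrite (negPf il) scale0r.
Qed.

Lemma appM phi psi x : app (phi * psi) x = \sum_(p <- comul x) app phi p.1 * app psi p.2.
Proof.
have bf : bilinear_for *:%R *:%R (fun a b => app phi a * app psi b).
  split=> u c a b; rewrite /= app_linear.
    by rewrite mulrDl scalerAl.
  by rewrite mulrDr scalerAr.
rewrite [RHS](linear_base x (sum_comul_linear bf)); apply: eq_bigr => l _.
rewrite (sum_comul_base l bf) scalgME; congr (_ *: _).
by do 2!(apply: eq_bigr => ? _); rewrite !app_base.
Qed.

(* The identity is invertible in the convolution algebra Hom(H, H), with inverse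
   the antipode.  Multiplication by it preserves the finite dimensional space of
   maps that preserve annih L, which therefore contains the inverse. *)
Lemma annih_antipode x : annih x -> annih (antipode x).
Proof.
pose idE : E := [ffun l => hbase l]; pose SE : E := [ffun l => antipode (hbase l)].
have appid y : app idE y = y.
  by rewrite [RHS]hbaseE; apply: eq_bigr => l _; rewrite ffunE.
have appS y : app SE y = antipode y.
  rewrite [RHS](linear_base y (@antipode_is_linear k H)).
  by apply: eq_bigr => l _; rewrite ffunE.
have idS : idE * SE = 1.
  apply/ffunP => l; rewrite -app_base appM scalg1E -[RHS]/((counit _)%:A) -antipoder.
  by apply: eq_bigr => p _; rewrite appid appS.
have Sid : SE * idE = 1.
  apply/ffunP => l; rewrite -app_base appM scalg1E -[RHS]/((counit _)%:A) -antipodel.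
  by apply: eq_bigr => p _; rewrite appid appS.
have appD phi psi y : app (phi + psi) y = app phi y + app psi y.
  by rewrite /app -big_split; apply: eq_bigr => l _; rewrite scalgDE scalerDr.
have appZ c phi y : app (c *: phi) y = c *: app phi y.
  rewrite /app scaler_sumr; apply: eq_bigr => l _.
  by rewrite scalgZE !scalerA mulrC.
have [|||M ME] := @vspace_of_pred k E (fun phi => forall y, annih y -> annih (app phi y)).
- by move=> y _; rewrite -(scale0r (0 : E)) appZ scale0r annih0.
- by move=> phi psi Hphi Hpsi y Iy; rewrite appD annihD ?Hphi ?Hpsi.
- by move=> c phi Hphi y Iy; rewrite appZ annihZ ?Hphi.
have sub : (amull idE @: M <= M)%VS.
  apply/subvP => _ /memv_imgP [phi /ME Mphi ->]; apply/ME => y Iy.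
  have [s [t [/allP sI /allP tI e]]] := annih_comul Iy.
  rewrite lfunE /= appM.
  have bf : bilinear_for *:%R *:%R (fun a b => app idE a * app phi b).
    by split=> u c a b; rewrite /= app_linear; [rewrite mulrDl scalerAl | rewrite mulrDr scalerAr].
  rewrite (e _ _ bf) big_cat /= annihD //.
    elim: s sI {e} => [|p s IHs] sI; first by rewrite big_nil annih0.
    rewrite big_cons annihD ?IHs // => [|q qs]; last by apply: sI; rewrite inE qs orbT.
    by rewrite appid annihMr // sI ?inE ?eqxx.
  elim: t tI {e} => [|p t IHt] tI; first by rewrite big_nil annih0.
  rewrite big_cons annihD ?IHt // => [|q qt]; last by apply: tI; rewrite inE qt orbT.
  by rewrite annihMl // Mphi // tI ?inE ?eqxx.
have ker : (M :&: lker (amull idE) = 0)%VS.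
  apply/eqP; rewrite -subv0; apply/subvP => phi /memv_capP [_]; rewrite memv_ker lfunE /= memv0.
  by move=> /eqP e; rewrite -[phi]mul1r -Sid -mulrA e mulr0.
have eM : (amull idE @: M = M)%VS.
  by apply/eqP; rewrite -(dimv_leqif_eq sub) (limg_dim_eq ker).
have : 1 \in (amull idE @: M)%VS.
  rewrite eM; apply/ME => y Iy; rewrite /app.
  suff -> : \sum_l hcoord l y *: (1 : E) l = (counit y)%:A.
    by rewrite annih_counit // scale0r annih0.
  rewrite -ev1 scaler_suml; apply: eq_bigr => l _.
  by rewrite !scalg1E scalerA; congr (_ *: _); rewrite /GRing.scale /= mulr1.
case/memv_imgP => phi Mphi; rewrite lfunE /= => e.
have eS : phi = SE by rewrite -[phi]mul1r -Sid -mulrA -e mulr1.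
by rewrite -appS -eS; move=> Ix; apply: (proj1 (ME phi) Mphi).
Qed.

Section Cocommutative.
Hypothesis LC : forall f g, f \in L -> g \in L -> f * g = g * f.
Variables (W : lmodType k) (B : H -> H -> W).
Hypothesis bB : bilinear_for *:%R *:%R B.
Hypothesis Bl : forall x y, annih x -> B x y = 0.
Hypothesis Br : forall x y, annih y -> B x y = 0.

Lemma sum_comul_sym x : \sum_(p <- comul x) B p.1 p.2 = \sum_(p <- comul x) B p.2 p.1.
Proof.
have bB' : bilinear_for *:%R *:%R (fun x y => B y x).
  by split=> u; [apply: (bB.2 u) | apply: (bB.1 u)].
rewrite (sum_comul_lproj bB Bl Br).
rewrite (@sum_comul_lproj _ (fun x y => B y x) bB' (fun x y => @Br y x) (fun x y => @Bl y x)).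
rewrite exchange_big; apply: eq_bigr => i _; apply: eq_bigr => j _ /=.
by rewrite LC ?lbase_in.
Qed.

End Cocommutative.

End SubHopf.

(** * Reducedness and characters of commutative subalgebras of the dual *)

(** In a full rank factorization [X = C R] both factors can be cancelled from [C (R C) R = 0], so
    [R C = 0], and [X] has the trace of [R C]. For an idempotent the same cancellation makes [R C]
    an identity matrix of size the rank. *)
Lemma mxtrace_sq0 (F : fieldType) r (X : 'M[F]_r) : X *m X = 0 -> \tr X = 0.
Proof.
rewrite -{1 2}(mulmx_base X) -mulmxA (mulmxA (row_base X)) => e.
have {}e : row_base X *m col_base X = 0.
  apply: (row_free_inj (row_base_free X)); apply: (row_full_inj (col_base_full X)).
  by rewrite /= mul0mx mulmx0.
by rewrite -(mulmx_base X) mxtrace_mulC e mxtrace0.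
Qed.

Lemma mxtrace_idem (F : fieldType) r (X : 'M[F]_r) :
  X *m X = X -> \tr X = (\rank X)%:R.
Proof.
rewrite -{1 2}(mulmx_base X) -mulmxA (mulmxA (row_base X)) => e.
have {}e : row_base X *m col_base X = 1%:M.
  apply: (row_free_inj (row_base_free X)); apply: (row_full_inj (col_base_full X)).
  by rewrite /= mul1mx mulmx_base e.
by rewrite -{1}(mulmx_base X) mxtrace_mulC e mxtrace1.
Qed.

Lemma falg_annihilating (k : closedFieldType) (A : falgType k) (a : A) :
  exists rs : seq k, \prod_(z <- rs) (a - z%:A) = 0.
Proof.
set d := \dim {: A}; pose X := [tuple a ^+ i | i < d.+1].
have nf : ~~ free X.
  apply/negP => /eqP e; have := dimvS (subvf <<X>>%VS).
  by rewrite e size_tuple ltnn.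
have [c [c0 [i ci]]] : exists c : 'I_d.+1 -> k, \sum_i c i *: X`_i = 0 /\ exists i, c i <> 0.
  apply: contrapT => h; move/negP: nf; apply; apply/freeP => c c0 i.
  by apply: contrapT => ci; apply: h; exists c; split=> //; exists i.
pose p := \poly_(j < d.+1) (if insub j is Some i then c i else 0).
have pE (j : 'I_d.+1) : p`_j = c j by rewrite coef_poly ltn_ord valK.
have p0 : p != 0 by apply: contra_notN ci => /eqP p0; rewrite -pE p0 coef0.
have pa : horner_alg a p = 0.
  rewrite -[RHS]c0 {1}/p poly_def linear_sum; apply: eq_bigr => j _.
  by rewrite linearZ /= rmorphXn /= horner_algX nth_mktuple valK mulr_algl.
have [rs prs] := @closed_field_poly_normal k p; exists rs.
move/eqP: pa; rewrite {1}prs linearZ /= mulr_algl scaler_eq0 lead_coef_eq0 (negPf p0) /= => /eqP <-.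
rewrite rmorph_prod; apply: eq_bigr => z _ /=.
by rewrite rmorphB /= horner_algX horner_algC.
Qed.

(** Strip the factors [a - r] off an annihilating product one at a time. A factor with [r = 0] is
    absorbed by passing to [a * v]. Otherwise either [(a - r) * v] is killed by no power of [a] and
    replaces [v], or some [a ^+ m * v] is an eigenvector with the nonzero eigenvalue [r]. *)
Lemma falg_eigenvector (k : closedFieldType) (A : falgType k) (a v : A) (V : {vspace A}) :
  (forall w, w \in V -> a * w \in V) -> v \in V -> (forall m, a ^+ m * v != 0) ->
  exists r w, [/\ r != 0, w \in V, w != 0 & a * w = r *: w].
Proof.
move=> aV; have [rs ars] := falg_annihilating a.
have : (\prod_(z <- rs) (a - z%:A)) * v = 0 by rewrite ars mul0r.
have aXV m w : w \in V -> a ^+ m * w \in V.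
  by elim: m w => [|m IHm] w Vw; rewrite ?mul1r // exprS -mulrA aV ?IHm.
elim/last_ind: rs v {ars} => [|rs r IHrs] v.
  by rewrite big_nil mul1r => -> _ /(_ 0%N); rewrite mulr0 eqxx.
rewrite -cats1 big_cat big_seq1 /= -mulrA => e Vv nv.
have [r0|r0] := eqVneq r 0.
  apply: (IHrs (a * v)); rewrite ?aV //; first by move: e; rewrite r0 scale0r subr0.
  by move=> m; rewrite mulrA -exprSr.
have [[m em]|nm] := pselect (exists m, a ^+ m * ((a - r%:A) * v) = 0).
  exists r, (a ^+ m * v); split=> //; first exact: aXV.
  apply/eqP; rewrite -subr_eq0 -em mulrA -exprS exprSr mulrBl mulrBr mulr_algl -scalerAr !mulrA.
  by [].
apply: IHrs e _ _ => [|m]; last by apply/eqP => em; apply: nm; exists m.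
by rewrite mulrBl mulr_algl memvB ?memvZ ?aV.
Qed.

(* If a is nilpotent on v, the last nonzero a ^+ m * v has the eigenvalue 0. *)
Lemma falg_eigenvector0 (k : closedFieldType) (A : falgType k) (a v : A) (V : {vspace A}) :
  (forall w, w \in V -> a * w \in V) -> v \in V -> v != 0 ->
  exists r w, [/\ w \in V, w != 0 & a * w = r *: w].
Proof.
move=> aV Vv v0; have [nil|nm] := pselect (exists m, a ^+ m * v == 0); last first.
  have [|r [w [_ Vw w0 e]]] := @falg_eigenvector k A a v V aV Vv; last by exists r, w.
  by move=> m; apply/negP => em; apply: nm; exists m.
case: (ex_minnP nil) => -[|m]; first by rewrite mul1r (negPf v0).
move=> /eqP em minm; exists 0, (a ^+ m * v); split.
- by elim: m {em minm} => [|m IHm]; rewrite ?mul1r // exprS -mulrA aV.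
- by apply/negP => /minm; rewrite ltnn.
by rewrite mulrA -exprS em scale0r.
Qed.

Lemma subv_dim_eq (F : fieldType) (V : vectType F) (U W : {vspace V}) :
  (U <= W)%VS -> (\dim W <= \dim U)%N -> U = W.
Proof. by move=> sub le; apply/eqP; rewrite -(dimv_leqif_eq sub) eqn_leq dimvS. Qed.

(** * The trace form and its radical *)

Section TraceForm.
Variables (k : closedFieldType) (char0 : [pchar k] =i pred0) (H : finHopfAlgType k).
Local Notation K := (scalg (hopf_sconsts H) k^o).
Variable L : {vspace K}.
Hypothesis L1 : 1 \in L.
Hypothesis LM : forall f g, f \in L -> g \in L -> f * g \in L.
Hypothesis LC : forall f g, f \in L -> g \in L -> f * g = g * f.
Hypothesis L_ltrans : forall h f, f \in L -> ltrans h f \in L.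
Hypothesis L_rtrans : forall h f, f \in L -> rtrans h f \in L.
Implicit Types (f g a b : K) (x y h : H) (T : K -> K).
Local Notation annih := (annih L).
Local Notation lcoord := (@lcoord k H L).
Local Notation lbase := (@lbase k H L).

(** [lcoord] first projects to [L], so the trace is taken on [L] although [T] is a map of all of
    [K]. *)
Definition ltr T : k := \sum_j lcoord j (T (lbase j)).
Definition lmx T : 'M[k]_(\dim L) := \matrix_(i, j) lcoord j (T (lbase i)).

Lemma ltr_mx T : ltr T = \tr (lmx T).
Proof. by apply: eq_bigr => j _; rewrite mxE. Qed.

Lemma lmx_comp T T' : linear T -> (forall f, f \in L -> T' f \in L) ->
  lmx (T \o T') = lmx T' *m lmx T.
Proof.
move=> lT T'L; apply/matrixP => i j; rewrite !mxE /=.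
pose F : {linear K -> K} := HB.pack T (GRing.isLinear.Build k K K *:%R T lT).
rewrite {1}[T' _](lbaseE (L := L)) ?T'L ?lbase_in // -[T _]/(F _) !linear_sum.
by apply: eq_bigr => m _; rewrite !linearZ !mxE.
Qed.

Lemma ltr_comm T T' : linear T -> linear T' ->
  (forall f, f \in L -> T f \in L) -> (forall f, f \in L -> T' f \in L) ->
  ltr (T \o T') = ltr (T' \o T).
Proof. by move=> lT lT' TL T'L; rewrite !ltr_mx (lmx_comp lT T'L) (lmx_comp lT' TL) mxtrace_mulC. Qed.

Lemma eq_ltr T T' : (forall f, f \in L -> T f = T' f) -> ltr T = ltr T'.
Proof. by move=> e; apply: eq_bigr => j _; rewrite e ?lbase_in. Qed.

Lemma eq_lmx T T' : (forall f, f \in L -> T f = T' f) -> lmx T = lmx T'.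
Proof. by move=> e; apply/matrixP => i j; rewrite !mxE e ?lbase_in. Qed.

Definition mtr f : k := ltr ( *%R f).

Lemma mul_linear f : linear ( *%R f).
Proof. by move=> c a b; rewrite mulrDr scalerAr. Qed.

Lemma lmx_mul f g : g \in L -> lmx ( *%R (f * g)) = lmx ( *%R g) *m lmx ( *%R f).
Proof.
move=> Lg; have gL a : a \in L -> g * a \in L by apply: LM.
rewrite -(lmx_comp (mul_linear f) gL).
by apply: eq_lmx => a _; rewrite /= mulrA.
Qed.

Lemma mtr_scalar : scalar mtr.
Proof.
move=> c f g; rewrite /mtr /ltr mulr_sumr -big_split; apply: eq_bigr => j _ /=.
by rewrite mulrDl -scalerAl linearP.
Qed.

Lemma mtr_sq0 f : f \in L -> f * f = 0 -> mtr f = 0.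
Proof.
move=> Lf ff; rewrite /mtr ltr_mx; apply: mxtrace_sq0; rewrite -lmx_mul // ff.
by apply/matrixP => i j; rewrite !mxE mul0r linear0.
Qed.

Lemma mtr_idem e : e \in L -> e * e = e -> e != 0 -> mtr e != 0.
Proof.
move=> Le ee e0; rewrite /mtr ltr_mx mxtrace_idem -?lmx_mul ?ee //.
have /pcharf0P -> := char0; rewrite mxrank_eq0; apply: contraNneq e0 => z.
rewrite -[e]mulr1 (lbaseE L1) mulr_sumr big1 // => i _; rewrite -scalerAr.
rewrite [e * _](lbaseE (L := L)) ?LM ?lbase_in // big1 ?scaler0 // => j _.
by have /matrixP/(_ i j) := z; rewrite !mxE => ->; rewrite scale0r.
Qed.

Lemma rtrans_annih x f : f \in L -> annih x -> rtrans x f = 0.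
Proof.
move=> Lf Ix; apply: ev_inj => y; rewrite ev_rtrans.
have /annihP -> // := annihMl L_ltrans y Ix.
by rewrite /ev big1 // => l _; rewrite ffunE mulr0.
Qed.

(** On the right the product rule produces [h_2 S(h_3)], which collapses to the counit. The identity
    lets a translation of one factor become a translation of the whole product, as needed under the
    trace. *)
Lemma rtrans_mulr h f a :
  rtrans h f * a = \sum_(p <- comul h) rtrans p.1 (f * rtrans (antipode p.2) a).
Proof.
have tT : trilinear (fun u v w => rtrans u f * rtrans (v * antipode w) a).
  split=> u v c x y.
  - by rewrite rtrans_linearl mulrDl scalerAl.
  - by rewrite mulrDl -scalerAl rtrans_linearl mulrDr scalerAr.
  by rewrite linearP mulrDr -scalerAr rtrans_linearl mulrDr scalerAr.
have := @comul_A k H h _ _ tT; rewrite !big_allpairs_dep /= => e.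
transitivity (\sum_(p <- comul h) \sum_(q <- comul p.1)
    rtrans q.1 f * rtrans (q.2 * antipode p.2) a); last first.
  apply: eq_bigr => p _; rewrite rtrans_mul; apply: eq_bigr => q _.
  by rewrite rtransM.
rewrite e -[in LHS](counitr h).
pose F : {linear H -> K} := HB.pack (fun x => rtrans x f)
  (GRing.isLinear.Build k H K *:%R (fun x => rtrans x f) (rtrans_linearl f)).
rewrite -[rtrans _ f]/(F _) linear_sum mulr_suml; apply: eq_bigr => p _.
rewrite linearZ /= -scalerAl -mulr_sumr.
pose G : {linear H -> K} := HB.pack (fun x => rtrans x a)
  (GRing.isLinear.Build k H K *:%R (fun x => rtrans x a) (rtrans_linearl a)).
have -> : \sum_(q <- comul p.2) rtrans (q.1 * antipode q.2) a = G (counit p.2)%:A.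
  by rewrite -antipoder linear_sum.
by rewrite linearZ /= rtrans1 scalerAr.
Qed.

(* Cyclicity of the trace moves rtrans h1 to the right of rtrans (S h2) in
   rtrans_mulr, and S h2 * h1 sums to counit h because H / annih L is
   cocommutative. *)
Lemma mtr_rtrans h f : f \in L -> mtr (rtrans h f) = counit h * mtr f.
Proof.
move=> Lf; have lr y : linear (rtrans y) := rtrans_linear y.
have lf y : linear (fun a => f * rtrans y a) by move=> c a b; rewrite lr mul_linear.
have Ly y a : a \in L -> f * rtrans y a \in L by move=> La; rewrite LM ?L_rtrans.
pose G y : k^o := ltr (fun a => f * rtrans y a).
have lG : linear G.
  move=> c x y; rewrite /G /ltr scaler_sumr -big_split; apply: eq_bigr => j _ /=.
  by rewrite rtrans_linearl mul_linear linearP.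
pose B x y := G (antipode y * x).
have bB : bilinear_for *:%R *:%R B.
  split=> u c x y; rewrite /B /=.
    by rewrite mulrDr -scalerAr lG.
  by rewrite linearP mulrDl -scalerAl lG.
have G0 z : annih z -> G z = 0.
  by move=> Iz; rewrite /G /ltr big1 // => j _; rewrite rtrans_annih ?lbase_in // mulr0 linear0.
have Bl x y : annih x -> B x y = 0 by move=> Ix; rewrite /B G0 // annihMl.
have Br x y : annih y -> B x y = 0.
  by move=> Iy; rewrite /B G0 // annihMr // annih_antipode.
transitivity (\sum_(p <- comul h) B p.1 p.2).
  transitivity (\sum_(p <- comul h)
      ltr (rtrans p.1 \o (fun a => f * rtrans (antipode p.2) a))).
    rewrite /mtr /ltr exchange_big; apply: eq_bigr => j _ /=.
    by rewrite rtrans_mulr linear_sum.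
  apply: eq_bigr => p _; rewrite (ltr_comm (lr _) (lf _) (L_rtrans p.1) (Ly _)).
  by apply: eq_ltr => a _; rewrite /= rtransM.
rewrite (sum_comul_sym LC bB Bl Br) /B.
pose F : {linear H -> k^o} := HB.pack G (GRing.isLinear.Build k H k^o *:%R G lG).
transitivity (F (counit h)%:A); first by rewrite -antipodel linear_sum.
rewrite linearZ; congr (_ * _); apply: eq_ltr => a _.
by rewrite rtrans1.
Qed.

Definition tnull f := f \in L /\ forall a, a \in L -> mtr (f * a) = 0.

Lemma tnull_rtrans h f : tnull f -> tnull (rtrans h f).
Proof.
move=> [Lf Nf]; split=> [|a La]; first exact: L_rtrans.
pose F : {scalar K} := HB.pack mtr (GRing.isLinear.Build k K k *%R mtr mtr_scalar).
rewrite rtrans_mulr -[mtr _]/(F _) linear_sum big1 // => p _ /=.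
by rewrite mtr_rtrans ?LM ?L_rtrans // Nf ?mulr0 ?L_rtrans.
Qed.

Lemma ev_1M f g : ev (f * g) 1 = ev f 1 * ev g 1.
Proof.
by rewrite evM (@comul_1 k H _ _ (bilinear_ev f g)) big_seq1.
Qed.

Lemma LX f m : f \in L -> f ^+ m \in L.
Proof. by move=> Lf; elim: m => [|m IHm] //; rewrite exprS LM. Qed.

(* If f(1) <> 0 then some power of f generates an ideal with a nonzero idempotent,
   and in characteristic 0 its trace, the rank, does not vanish. *)
Lemma tnull_ev1 f : tnull f -> ev f 1 = 0.
Proof.
move=> [Lf Nf]; apply/eqP; apply: contraT => f1.
have [Wd WdP] : exists Wd : nat -> {vspace K}, forall m g,
    g \in Wd m <-> exists2 a, a \in L & g = f ^+ m.+1 * a.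
  exists (fun m => (amull (f ^+ m.+1) @: L)%VS) => m g; split.
    by case/memv_imgP => a La ->; exists a; rewrite // lfunE.
  by case=> a La ->; apply/memv_imgP; exists a; rewrite // lfunE.
have ex : exists d, `[< exists m, \dim (Wd m) = d >].
  by exists (\dim (Wd 0%N)); apply/asboolP; exists 0%N.
case: (ex_minnP ex) => d /asboolP [m dm] mind.
(* Least dimension forces these two ideals to be equal, so [f ^+ m.+1 = f ^+ m.+1 * f ^+ m.+1 * b]
   for some [b], and [f ^+ m.+1 * b] is idempotent. *)
have sub : (Wd (m + m.+1)%N <= Wd m)%VS.
  apply/subvP => g /WdP [a La ->]; apply/WdP; exists (f ^+ m.+1 * a).
    by rewrite LM ?LX.
  by rewrite mulrA -exprD addSn.
have le_d : (d <= \dim (Wd (m + m.+1)))%N.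
  by apply: mind; apply/asboolP; exists (m + m.+1)%N.
have eW := subv_dim_eq sub (leq_trans (eq_leq dm) le_d).
have /WdP [b Lb] : f ^+ m.+1 \in Wd (m + m.+1)%N.
  by rewrite eW; apply/WdP; exists 1; rewrite ?mulr1.
rewrite -addSn exprD => eb.
pose e := f ^+ m.+1 * b.
have Le : e \in L by rewrite LM ?LX.
have ef : e * f ^+ m.+1 = f ^+ m.+1.
  by rewrite {2}eb /e -!mulrA [b * _]LC ?LX.
have ee : e * e = e by rewrite {2}/e mulrA ef.
have e0 : e != 0.
  apply: contraNneq f1 => e0; have : ev (f ^+ m.+1) 1 = ev f 1 ^+ m.+1.
    elim: (m) => [|i IHi]; first by rewrite !expr1.
    by rewrite exprS ev_1M IHi -exprS.
  rewrite -ef e0 mul0r => z; have /eqP : ev f 1 ^+ m.+1 = 0.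
    by rewrite -z /ev big1 // => l _; rewrite ffunE mulr0.
  by rewrite expf_eq0 => /andP [].
move/eqP: (mtr_idem Le ee e0); case.
by rewrite /e exprS -mulrA Nf // LM ?LX.
Qed.

(** Every multiple of [f] by [L] has square zero, hence trace zero, so [f] lies in the radical of
    the trace form; its value at [h] is the value at 1 of a translate. *)
Lemma L_reduced f : f \in L -> f * f = 0 -> f = 0.
Proof.
move=> Lf ff; have Nf : tnull f.
  split=> // a La; apply: mtr_sq0; first exact: LM.
  by rewrite -mulrA (mulrA a) (LC La Lf) !mulrA ff !mul0r.
apply: ev_inj => h; have := tnull_ev1 (tnull_rtrans h Nf).
rewrite ev_rtrans mul1r => ->.
by rewrite /ev big1 // => l _; rewrite ffunE mulr0.
Qed.

Lemma L_not_nilpotent f m : f \in L -> f != 0 -> f ^+ m != 0.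
Proof.
move=> Lf f0; have pw i : f ^+ (2 ^ i) != 0.
  elim: i => [|i IHi]; first by rewrite expr1.
  apply: contraNneq IHi => e; apply/eqP; apply: L_reduced; rewrite ?LX //.
  by rewrite -expr2 -exprM -expnSr.
apply: contraNneq (pw m) => e.
by rewrite -(subnK (ltnW (ltn_expl m (ltnSn 1)))) exprD e mulr0.
Qed.

(** Take a nonzero [L]-stable subspace of least dimension in the eigenspace of [f]. By commutativity
    the eigenspaces in it of any [a] in [L] are stable too, so one of them is everything and [a]
    acts as a scalar. *)
Lemma L_eigenline f : f \in L -> f != 0 -> exists (r : k) (w : K), [/\ r != 0, w != 0,
  f * w = r *: w & forall a, a \in L -> exists c : k, a * w = c *: w].
Proof.
move=> Lf f0.
have [|||r [w0 [r0 Lw0 w00 fw0]]] := @falg_eigenvector k K f 1 L.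
- by move=> w; apply: LM.
- exact: L1.
- by move=> m; rewrite mulr1 L_not_nilpotent.
pose stable (V : {vspace K}) := [/\ V != 0%VS, (V <= L)%VS,
  forall w, w \in V -> f * w = r *: w & forall a w, a \in L -> w \in V -> a * w \in V].
have sub_stable (V V' : {vspace K}) a c : stable V -> a \in L ->
    (forall w, w \in V' <-> w \in V /\ a * w = c *: w) ->
    (exists2 w, w \in V' & w != 0) -> stable V' /\ (V' <= V)%VS.
  move=> [_ VL Vf Va] La V'E [w1 V'w1 w10].
  have sub : (V' <= V)%VS by apply/subvP => w /V'E [].
  split=> //; split.
  - by apply: contraNneq w10 => e; move: V'w1; rewrite e memv0.
  - exact: subv_trans sub VL.
  - by move=> w /V'E [/Vf].
  move=> b w Lb /V'E [Vw aw]; apply/V'E; split; first exact: Va.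
  by rewrite mulrA (LC La Lb) -mulrA aw scalerAr.
have ker (V : {vspace K}) a c : exists V' : {vspace K}, forall w,
    w \in V' <-> w \in V /\ a * w = c *: w.
  apply: vspace_of_pred; first by rewrite mem0v mulr0 scaler0.
    by move=> u v [Vu eu] [Vv ev]; rewrite memvD // mulrDr eu ev scalerDr.
  by move=> d u [Vu eu]; rewrite memvZ // -scalerAr eu !scalerA mulrC.
have ex : exists d, `[< exists2 V, stable V & \dim V = d >].
  have [V VE] := ker L f r; exists (\dim V); apply/asboolP; exists V => //.
  split.
  - by apply: contraNneq w00 => e; rewrite -memv0 -e; apply/VE.
  - by apply/subvP => w /VE [].
  - by move=> w /VE [].
  move=> a w La /VE [Lw fw]; apply/VE; split; first exact: LM.
  by rewrite mulrA (LC Lf La) -mulrA fw scalerAr.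
case: (ex_minnP ex) => d /asboolP [V sV dV] mind.
have [Vn0 VL Vf Va] := sV.
have V0 : vpick V != 0 by rewrite vpick0.
exists r, (vpick V); split=> //; first exact: Vf (memv_pick V).
move=> a La.
have [c [w1 [Vw1 w10 aw1]]] := falg_eigenvector0 (fun w => @Va a w La) (memv_pick V) V0.
have [V' V'E] := ker V a c.
have [|sV' sub] := sub_stable V V' a c sV La V'E; first by exists w1 => //; apply/V'E.
have le_d : (d <= \dim V')%N by apply: mind; apply/asboolP; exists V'.
have eV := subv_dim_eq sub (leq_trans (eq_leq dV) le_d).
exists c; have : vpick V \in V' by rewrite eV memv_pick.
by case/V'E.
Qed.

(* Evaluation at h is a character of L, that is, h is group-like modulo annih L. *)
Lemma L_characters f : f \in L -> f != 0 -> exists h, [/\ ev f h != 0, counit h = 1 &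
  forall a b, a \in L -> b \in L -> ev (a * b) h = ev a h * ev b h].
Proof.
move=> Lf f0; have [r [w [r0 w0 fw Lw]]] := L_eigenline Lf f0.
have [l wl] : exists l, (w l : k) != 0.
  apply/existsP; apply: contraNT w0; rewrite negb_exists => /forallP z.
  by apply/eqP/ffunP => l; rewrite ffunE; apply/eqP; have := z l; rewrite negbK.
pose phi (g : K) : k := (g * w) l / w l.
have sphi : scalar phi.
  by move=> c a b; rewrite /phi mulrDl -scalerAl scalgDE scalgZE mulrDl /GRing.scale /= -!mulrA.
have phiE a c : a * w = c *: w -> phi a = c.
  by move=> e; rewrite /phi e scalgZE /GRing.scale /= mulfK.
have evphi a c : a * w = c *: w -> ev a (coev phi) = c.
  by move=> e; rewrite (ev_coev a sphi) (phiE _ _ e).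
exists (coev phi); split.
- by rewrite (evphi _ _ fw).
- by rewrite -ev1 (evphi 1 1) // mul1r scale1r.
move=> a b La Lb; have [ca ea] := Lw _ La; have [cb eb] := Lw _ Lb.
rewrite (evphi _ _ ea) (evphi _ _ eb) (evphi _ (ca * cb)) //.
by rewrite -mulrA eb -scalerAr ea scalerA mulrC.
Qed.

End TraceForm.

(** * Hopf algebras spanned by group-like elements *)

Section GroupLike.
Variables (k : fieldType) (Q : hopfAlgType k).
Implicit Types (g h q : Q).

Definition grouplike g := counit g = 1 /\ eq_tens (comul g) [:: (g, g)].

Lemma sum_comul_grouplike g (W : lmodType k) (F : Q -> Q -> W) :
  grouplike g -> bilinear_for *:%R *:%R F -> \sum_(p <- comul g) F p.1 p.2 = F g g.
Proof. by move=> [_ e] bF; rewrite (e _ _ bF) big_seq1. Qed.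

Lemma bilinear_mull (W : lmodType k) (F : Q -> Q -> W) u v :
  bilinear_for *:%R *:%R F -> bilinear_for *:%R *:%R (fun a b => F (u * a) (v * b)).
Proof.
move=> bF; split=> w c x y; rewrite /= mulrDr -scalerAr.
  exact: (bF.1 (v * w)).
exact: (bF.2 (u * w)).
Qed.

Lemma bilinear_mulr (W : lmodType k) (F : Q -> Q -> W) u v :
  bilinear_for *:%R *:%R F -> bilinear_for *:%R *:%R (fun a b => F (a * u) (b * v)).
Proof.
move=> bF; split=> w c x y; rewrite /= mulrDl -scalerAl.
  exact: (bF.1 (w * v)).
exact: (bF.2 (w * u)).
Qed.

Lemma grouplike1 : grouplike 1.
Proof. by split; [rewrite rmorph1 | exact: comul_1]. Qed.

Lemma grouplikeM g h : grouplike g -> grouplike h -> grouplike (g * h).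
Proof.
move=> gl_g gl_h; split=> [|W F bF].
  by rewrite rmorphM /= (proj1 gl_g) (proj1 gl_h) mulr1.
rewrite (@comul_M k Q g h _ _ bF) big_allpairs_dep big_seq1 /=.
under eq_bigr => p _ do rewrite (sum_comul_grouplike gl_h (bilinear_mull p.1 p.2 bF)).
exact: sum_comul_grouplike gl_g (bilinear_mulr h h bF).
Qed.

Lemma grouplikeV g : grouplike g -> antipode g * g = 1.
Proof.
move=> gl_g; have := antipodel g; rewrite (proj1 gl_g) scale1r => <-.
rewrite (sum_comul_grouplike (F := fun a b => antipode a * b)) //.
by split=> u c x y /=; [rewrite linearP mulrDl scalerAl | rewrite mulrDr scalerAr].
Qed.

Lemma grouplikeVr g : grouplike g -> g * antipode g = 1.
Proof.
move=> gl_g; have := antipoder g; rewrite (proj1 gl_g) scale1r => <-.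
rewrite (sum_comul_grouplike (F := fun a b => a * antipode b)) //.
by split=> u c x y /=; [rewrite mulrDl scalerAl | rewrite linearP mulrDr scalerAr].
Qed.

(** From [g * antipode g = 1] the coproduct of [antipode g] is inverse to [g (x) g]; the bilinear
    map is multiplied by [antipode g] in both arguments to cancel that factor. *)
Lemma grouplike_antipode g : grouplike g -> grouplike (antipode g).
Proof.
move=> gl_g; have Vg := grouplikeV gl_g; have gV := grouplikeVr gl_g; split=> [|W F bF].
  have : counit (g * antipode g) = 1 by rewrite gV rmorph1.
  by rewrite rmorphM /= (proj1 gl_g) mul1r.
have bG := bilinear_mull (antipode g) (antipode g) bF.
rewrite big_seq1 /=; have := @comul_M k Q g (antipode g) _ _ bG.
rewrite gV (@comul_1 k Q _ _ bG) big_seq1 /= !mulr1 => ->.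
rewrite big_allpairs_dep exchange_big; apply: eq_bigr => p _ /=.
by rewrite (sum_comul_grouplike gl_g (bilinear_mulr p.1 p.2 bG)) !mulrA Vg !mul1r.
Qed.

Section GroupLikeBasis.
Variables (s : seq Q) (alpha : Q -> Q -> k).
Hypothesis sP : forall g, reflect (grouplike g) (g \in s).
Hypothesis alpha_scalar : forall g, scalar (alpha g).
Hypothesis alpha_dual : forall g h, g \in s -> h \in s -> alpha g h = (g == h)%:R.
Hypothesis s_span : forall q, q = \sum_(g : seq_sub s) alpha (val g) q *: val g.

Definition gl_group := seq_sub s.
HB.instance Definition _ := Finite.on gl_group.

Lemma gl_valP (g : gl_group) : grouplike (val g).
Proof. exact/sP/(valP g). Qed.

Definition gl_of g (gl_g : grouplike g) : gl_group := SeqSub (introT (sP g) gl_g).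

Definition gl_mul (g h : gl_group) := gl_of (grouplikeM (gl_valP g) (gl_valP h)).
Definition gl_one := gl_of grouplike1.
Definition gl_inv (g : gl_group) := gl_of (grouplike_antipode (gl_valP g)).

Lemma gl_mulA : associative gl_mul.
Proof. by move=> g h l; apply: val_inj; rewrite /= mulrA. Qed.

Lemma gl_mul1 : left_id gl_one gl_mul.
Proof. by move=> g; apply: val_inj; rewrite /= mul1r. Qed.

Lemma gl_mulV : left_inverse gl_one gl_inv gl_mul.
Proof. by move=> g; apply: val_inj; rewrite /= grouplikeV //; apply: gl_valP. Qed.

HB.instance Definition _ := Finite_isGroup.Build gl_group gl_mulA gl_mul1 gl_mulV.

Local Notation kG := (group_alg k gl_group).
Implicit Types (a b : kG).

Definition to_group_alg q : kG := [ffun g => alpha (val g) q : k^o].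
Definition of_group_alg a : Q := \sum_g (a g : k) *: val g.

Lemma to_group_algK : cancel to_group_alg of_group_alg.
Proof.
by move=> q; rewrite [RHS]s_span; apply: eq_bigr => g _; rewrite ffunE.
Qed.

Lemma to_group_alg_linear : linear to_group_alg.
Proof. by move=> c x y; apply/ffunP => g; rewrite !ffunE alpha_scalar. Qed.

HB.instance Definition _ := GRing.isLinear.Build k Q kG *:%R to_group_alg to_group_alg_linear.

Lemma to_group_alg_val (g : gl_group) : to_group_alg (val g) = group_alg_elt k g.
Proof.
apply/ffunP => h; rewrite !ffunE alpha_dual ?(valP g) ?(valP h) //.
Qed.

Lemma of_group_algK : cancel of_group_alg to_group_alg.
Proof.
move=> a; rewrite [RHS]group_algE linear_sum; apply: eq_bigr => g _.
by rewrite linearZ /= to_group_alg_val.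
Qed.

Lemma of_group_algM a b : of_group_alg (a * b) = of_group_alg a * of_group_alg b.
Proof.
rewrite /of_group_alg (sum_group_algM (fun g : gl_group => val g : Q)) mulr_suml.
apply: eq_bigr => g _; rewrite mulr_sumr; apply: eq_bigr => h _.
by rewrite -scalerAl -scalerAr scalerA.
Qed.

Lemma of_group_alg1 : of_group_alg 1 = 1.
Proof. exact: (sum_group_alg1 (fun g : gl_group => val g : Q)). Qed.

Lemma to_group_alg_monoid : monoid_morphism to_group_alg.
Proof.
split=> [|x y]; apply: (can_inj of_group_algK); first by rewrite to_group_algK of_group_alg1.
by rewrite of_group_algM !to_group_algK.
Qed.

HB.instance Definition _ :=
  GRing.isMonoidMorphism.Build Q kG to_group_alg to_group_alg_monoid.

Theorem grouplike_basis_iso : exists gT : finGroupType, hopf_isomorphic Q (group_alg k gT).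
Proof.
exists gl_group; exists to_group_alg; last first.
  by exists of_group_alg; [apply: to_group_algK | apply: of_group_algK].
split=> x.
- move=> W F bF; rewrite sum_group_alg_comul // big_map.
  have bG : bilinear_for *:%R *:%R (fun u v => F (to_group_alg u) (to_group_alg v)).
    split=> u c a b; rewrite /= linearP; first exact: (bF.1 (to_group_alg u)).
    exact: (bF.2 (to_group_alg u)).
  pose G : {linear Q -> W} := HB.pack (fun x => \sum_(p <- comul x) _)
    (GRing.isLinear.Build k Q W *:%R _ (sum_comul_linear bG)).
  transitivity (G x); last by [].
  rewrite [in RHS](s_span x) linear_sum; apply: eq_bigr => g _.
  by rewrite linearZ ffunE /= (sum_comul_grouplike (gl_valP g) bG) to_group_alg_val.
- rewrite [in RHS](s_span x) linear_sum; apply: eq_bigr => g _.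
  by rewrite linearZ /= (proj1 (gl_valP g)) mulr1 ffunE.
apply: (can_inj of_group_algK); rewrite to_group_algK [in RHS](s_span x) linear_sum.
rewrite /of_group_alg (reindex_inj invg_inj); apply: eq_bigr => g _.
by rewrite linearZ /= !ffunE invgK.
Qed.

End GroupLikeBasis.

End GroupLike.

(** * The quotient dual to a commutative subalgebra *)

Section CommutativeDual.
Variables (k : closedFieldType) (char0 : [pchar k] =i pred0) (H : finHopfAlgType k).
Local Notation K := (scalg (hopf_sconsts H) k^o).
Variable L : {vspace K}.
Hypothesis L1 : 1 \in L.
Hypothesis LM : forall f g, f \in L -> g \in L -> f * g \in L.
Hypothesis LC : forall f g, f \in L -> g \in L -> f * g = g * f.
Hypothesis L_ltrans : forall h f, f \in L -> ltrans h f \in L.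
Hypothesis L_rtrans : forall h f, f \in L -> rtrans h f \in L.

Lemma annih_idealr : idealr_closed (annih L).
Proof.
split; [exact: annih0 | exact: annih1 | ].
by move=> a u v Iu Iv; apply: annihD Iv; apply: annihMl.
Qed.

Lemma annih_right a u : annih L u -> annih L (u * a).
Proof. exact: annihMr. Qed.

HB.instance Definition _ := isIdealr.Build H (annih L) annih_idealr.
HB.instance Definition _ := isRightStable.Build H (annih L) annih_right.
HB.instance Definition _ := isHopfIdeal.Build k H (annih L)
  (annih_comul LM) (annih_counit L1) (annih_antipode L1 LM L_ltrans L_rtrans).

Definition annih_hopf_ideal : hopfIdeal H := annih L.
Local Notation I := annih_hopf_ideal.
Local Notation Q := (quot_alg I).
Local Notation pr := (@quot_proj k H I).
Implicit Types (f : K) (g h q : Q) (x : H).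

Definition evq f q : k := ev f (repr q).

Lemma evq_pr f x : f \in L -> evq f (pr x) = ev f x.
Proof.
move=> Lf; apply/eqP; rewrite -subr_eq0 -linearB /=; apply/eqP.
by have /annihP -> := repr_prB I x.
Qed.

Lemma evq_scalar f : f \in L -> scalar (evq f).
Proof.
move=> Lf c x y; rewrite -(quot_proj_repr x) -(quot_proj_repr y) -linearP.
by rewrite !evq_pr // linearP.
Qed.

Lemma evqD f f' q : evq (f + f') q = evq f q + evq f' q.
Proof. exact: evD. Qed.

Lemma evqZ c f q : evq (c *: f) q = c * evq f q.
Proof. exact: evZ. Qed.

Lemma evq_sep g h : (forall f, f \in L -> evq f g = evq f h) -> g = h.
Proof.
move=> e; rewrite -(quot_proj_repr g) -(quot_proj_repr h); apply/quot_projP.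
by apply/annihP => f Lf; rewrite linearB /= [ev f _](e f Lf) subrr.
Qed.

Lemma evq1 g : grouplike g -> evq 1 g = 1.
Proof. by move=> [cg _]; rewrite /evq ev1. Qed.

Lemma evqM f f' g : f \in L -> f' \in L -> grouplike g ->
  evq (f * f') g = evq f g * evq f' g.
Proof.
move=> Lf Lf' gl_g.
have bF : bilinear_for *:%R *:%R (fun u v : Q => evq f u * evq f' v : k^o).
  split=> u c x y /=; rewrite evq_scalar //; first by rewrite mulrDl -mulrA.
  by rewrite mulrDr mulrCA.
have := sum_comul_grouplike gl_g bF.
rewrite -{1}(quot_proj_repr g) (sum_quot_comul_pr _ bF) => <-.
by rewrite [LHS]evM; apply: eq_bigr => p _; rewrite !evq_pr.
Qed.

Lemma evq_prod (J : Type) (r : seq J) (P : pred J) (F : J -> K) g :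
  (forall j, P j -> F j \in L) -> grouplike g ->
  \prod_(j <- r | P j) F j \in L /\
  evq (\prod_(j <- r | P j) F j) g = \prod_(j <- r | P j) evq (F j) g.
Proof.
move=> FL gl_g; elim: r => [|j r [IL IE]]; first by rewrite !big_nil evq1.
by rewrite !big_cons; case: ifP => // Pj; rewrite LM ?FL // evqM ?FL // IE.
Qed.

(** Modulo the annihilator, both [comul x] and [x (x) x] are determined by pairing with pairs of
    basis elements of [L], and a character gives the same values on both. *)
Lemma grouplike_pr x : counit x = 1 ->
  (forall f f', f \in L -> f' \in L -> ev (f * f') x = ev f x * ev f' x) ->
  grouplike (pr x).
Proof.
move=> cx mx; split=> [|W F bF]; first exact: etrans (quot_counit_pr I x) cx.
rewrite (sum_quot_comul_pr _ bF) big_seq1 /=.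
have bB := bilin_pr bF.
have Bl a b : annih L a -> F (pr a) (pr b) = 0 by move=> Ia; rewrite (@pr0 k H I a Ia) (bilin0l _ bF).
have Br a b : annih L b -> F (pr a) (pr b) = 0 by move=> Ib; rewrite (@pr0 k H I b Ib) (bilin0r _ bF).
rewrite (sum_comul_lproj bB Bl Br) (bilinear_lproj bB Bl Br).
by apply: eq_bigr => i _; apply: eq_bigr => j _; rewrite mx ?lbase_in.
Qed.

Lemma grouplike_sep f : f \in L -> (forall g, grouplike g -> evq f g = 0) -> f = 0.
Proof.
move=> Lf f0; apply/eqP; apply: contraT => fn0.
have [x [nx cx mx]] := L_characters char0 L1 LM LC L_ltrans L_rtrans Lf fn0.
move: nx; rewrite -(evq_pr x Lf) f0 ?eqxx //; exact: grouplike_pr cx mx.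
Qed.

(** Lagrange interpolation: [L] separates the points of the quotient and group-likes are
    multiplicative on [L], so one multiplies functions that are 1 at [g] and 0 at one other
    point. *)
Lemma evq_dual (s : seq Q) g : grouplike g -> {in s, forall h, grouplike h} ->
  exists2 a, a \in L & forall h, h \in s -> evq a h = (g == h)%:R.
Proof.
move=> gl_g gl_s.
have sep h : exists f, h \in s -> h != g -> [/\ f \in L, evq f g = 1 & evq f h = 0].
  have [hs|_] := boolP (h \in s); last by exists 0.
  have [_|hg] := eqVneq h g; first by exists 0.
  have [f Lf nf] : exists2 f, f \in L & evq f g != evq f h.
    apply: contrapT => nex; move/eqP: hg; apply; apply/esym/evq_sep => f Lf.
    by apply/eqP; apply: contrapT => /negP nf; apply: nex; exists f.
  pose d := evq f g - evq f h; have d0 : d != 0 by rewrite subr_eq0.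
  exists (d^-1 *: (f - evq f h *: 1)) => _ _; split.
  - by rewrite memvZ // memvB // memvZ.
  - by rewrite evqZ evqD -scaleNr evqZ evq1 // mulr1 mulVf.
  by rewrite evqZ evqD -scaleNr evqZ (evq1 (gl_s _ hs)) mulr1 subrr mulr0.
have [F FP] := @choice _ _ _ sep.
exists (\prod_(h <- s | (h \in s) && (h != g)) F h).
  by apply: (proj1 (@evq_prod _ s _ F g _ gl_g)) => h /andP [hs hg]; have [] := FP h hs hg.
move=> h hs; rewrite (proj2 (@evq_prod _ s _ F h _ (gl_s h hs))); last first.
  by move=> l /andP [ls lg]; have [] := FP l ls lg.
have [<-|gh] := eqVneq g h.
  by rewrite big1 // => l /andP [ls lg]; have [_ ->] := FP l ls lg.
apply/eqP; rewrite prodf_seq_eq0; apply/hasP; exists h => //.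
have hg : h != g by rewrite eq_sym.
by rewrite hs hg /=; have [_ _ ->] := FP h hs hg.
Qed.

(** The dual functions make group-likes linearly independent; this is tested on representatives in
    [H], where the dimension is at hand. *)
Lemma grouplike_size (s : seq Q) : uniq s -> {in s, forall h, grouplike h} ->
  (size s <= \dim {: H})%N.
Proof.
move=> us gl_s; pose X := map_tuple (fun q : Q => repr q : H) (in_tuple s).
have fX : free X.
  apply/freeP => c c0 i; have si := mem_nth 0 (ltn_ord i).
  have [a La aE] := evq_dual (gl_s _ si) gl_s.
  have := congr1 (ev a) c0; rewrite linear0 linear_sum (bigD1 i) //= big1 => [|j ji].
    rewrite addr0 linearZ /= (nth_map 0) ?ltn_ord // -/(evq a _) aE ?mem_nth ?ltn_ord //.
    by rewrite eqxx mulr1.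
  rewrite linearZ /= (nth_map 0) ?ltn_ord // -/(evq a _) aE ?mem_nth ?ltn_ord //.
  by rewrite nth_uniq ?ltn_ord // eq_sym [_ == _](negPf ji) mulr0.
have := dimvS (subvf <<X>>%VS); rewrite (eqP fX) size_tuple.
by [].
Qed.

Lemma grouplike_seq : exists s : seq Q, uniq s /\ forall g, g \in s <-> grouplike g.
Proof.
pose T n := `[< exists s : seq Q, [/\ uniq s, {in s, forall h, grouplike h} & size s = n] >].
have T0 : exists n, T n by exists 0%N; apply/asboolP; exists [::].
have Tb n : T n -> (n <= \dim {: H})%N by case/asboolP => s [us gs <-]; apply: grouplike_size.
case: (ex_maxnP T0 Tb) => n /asboolP [s [us gs sn]] maxn.
exists s; split=> // g; split=> [/gs //|gl_g].
apply: contraT => ns; suff : (n < n)%N by rewrite ltnn.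
apply: maxn; apply/asboolP; exists (g :: s); split; rewrite /= ?ns ?sn //.
by move=> h; rewrite inE => /predU1P [->|/gs].
Qed.

Theorem commutative_dual_iso : exists gT : finGroupType, hopf_isomorphic Q (group_alg k gT).
Proof.
have [s [us sE]] := grouplike_seq.
have sP g : reflect (grouplike g) (g \in s) := equivP idP (sE g).
have gl_s : {in s, forall h, grouplike h} by move=> h /sP.
have dual g : exists a, g \in s -> a \in L /\ forall h, h \in s -> evq a h = (g == h)%:R.
  have [gs|_] := boolP (g \in s); last by exists 0.
  by have [a La aE] := evq_dual (gl_s _ gs) gl_s; exists a.
have [a aP] := @choice _ _ _ dual.
have aL (g : seq_sub s) : a (val g) \in L by have [] := aP _ (valP g).
have aE (g h : seq_sub s) : evq (a (val g)) (val h) = (g == h)%:R.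
  by case: g h => [g gs] [h hs]; rewrite -val_eqE /=; have [_ ->] := aP g gs.
(* The value 0 off [s] makes [alpha g] linear for every [g]. *)
pose alpha g q := if g \in s then evq (a g) q else 0.
have alphaE (g : seq_sub s) : alpha (val g) = evq (a (val g)).
  by rewrite /alpha (valP g).
(* The difference of the two sides vanishes at all group-likes, and these separate [L]. *)
have expand f : f \in L -> f = \sum_(g : seq_sub s) evq f (val g) *: a (val g).
  move=> Lf; apply/eqP; rewrite -subr_eq0; apply/eqP; apply: grouplike_sep.
    by rewrite memvB ?memv_suml // => g _; rewrite memvZ.
  move=> h /sP hs; pose h' : seq_sub s := SeqSub hs.
  rewrite evqD -scaleN1r evqZ [X in _ + _ * X]ev_sum mulN1r (bigD1 h') //= big1 => [|g gh].
    by rewrite evZ [ev (a _) _](aE h' h') eqxx mulr1 addr0 subrr.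
  by rewrite evZ [ev (a _) _](aE g h') (negPf gh) mulr0.
apply: (@grouplike_basis_iso k Q s alpha sP).
- by move=> g c x y; rewrite /alpha; case: ifP => [/aP [La _]|_]; rewrite ?evq_scalar ?mulr0 ?addr0.
- by move=> g h gs hs; rewrite /alpha gs; have [_ ->] := aP _ gs.
move=> q; apply: evq_sep => f Lf.
pose F : {scalar Q} := HB.pack (evq f) (GRing.isLinear.Build k Q k *%R (evq f) (evq_scalar Lf)).
rewrite -[RHS]/(F _) linear_sum {1}(expand f Lf) [LHS]ev_sum.
by apply: eq_bigr => g _; rewrite linearZ /= alphaE evZ mulrC.
Qed.

End CommutativeDual.

(** * Hopf actions on the Weyl algebra *)

Section WeylAction.
Variables (k : closedFieldType) (char0 : [pchar k] =i pred0) (n : nat).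
Variables (H : finHopfAlgType k) (A : weyl_model k n) (act : H -> A -> A).
Hypothesis actP : hopf_action act.
Local Notation S := (hopf_sconsts H).
Local Notation K := (scalg S k^o).
Local Notation symbol := (wm_symbol A).
Local Notation N := (n + n)%N.
Implicit Types (a b : A) (h x y : H) (f g : K).

Lemma act_base h a : act h a = \sum_l hcoord l h *: act (hbase l) a.
Proof. exact: linear_base (act_linearl actP a). Qed.

Definition act_E (l : sc_I S) a : A := act (hbase l) a.
Definition act_s (l j : sc_I S) : k := hcoord j (antipode (hbase l)).
Definition act_t (v j l : sc_I S) : k := hcoord l (antipode (hbase v) * hbase j).
Definition act_v (l : sc_I S) : k := hcoord l 1.
Definition act_sigma l a : A := \sum_j act_s l j *: act_E j a.

Lemma act_sigmaE l a : act_sigma l a = act (antipode (hbase l)) a.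
Proof. by rewrite [RHS]act_base. Qed.

Lemma act_E_lin l : linear (act_E l).
Proof. exact: act_linearr actP (hbase l). Qed.

Lemma act_E_mul l a b :
  act_E l (a * b) = \sum_i \sum_j sc_c l i j *: (act_E i a * act_E j b).
Proof.
rewrite /act_E (act_mul actP).
apply: (sum_comul_base (f := fun u v => act u a * act v b) l).
split=> u c x y /=; rewrite (act_linearl actP); first by rewrite mulrDl scalerAl.
by rewrite mulrDr scalerAr.
Qed.

Lemma act_E_1 l : act_E l 1 = (sc_u l)%:A.
Proof. exact: act_unit actP (hbase l). Qed.

Lemma act_sum (J : Type) (r : seq J) (F : J -> H) a :
  act (\sum_(i <- r) F i) a = \sum_(i <- r) act (F i) a.
Proof.
pose G : {linear H -> A} := HB.pack (act^~ a)
  (GRing.isLinear.Build k H A *:%R (act^~ a) (act_linearl actP a)).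
exact: (linear_sum G).
Qed.

Lemma act_scalar c a : act c%:A a = c *: a.
Proof.
have := act_linearl actP a c 1 0; rewrite addr0 => ->.
rewrite (act_1 actP) [act 0 a]act_base big1 ?addr0 // => l _.
by rewrite linear0 scale0r.
Qed.

Lemma act_E_sigma l a :
  \sum_i \sum_j sc_c l i j *: act_E i (act_sigma j a) = sc_u l *: a.
Proof.
rewrite -act_scalar -[(sc_u l)%:A](antipoder (hbase l)) act_sum.
under [RHS]eq_bigr => p _ do rewrite (act_M actP).
rewrite (sum_comul_base (f := fun u v => act u (act (antipode v) a)) l).
  by apply: eq_bigr => i _; apply: eq_bigr => j _; rewrite act_sigmaE.
split=> u c x y /=; first by rewrite (act_linearl actP).
by rewrite linearP (act_linearl actP) (act_linearr actP).
Qed.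

Lemma act_sigma_E l a :
  \sum_i \sum_j sc_c l i j *: act_sigma i (act_E j a) = sc_u l *: a.
Proof.
rewrite -act_scalar -[(sc_u l)%:A](antipodel (hbase l)) act_sum.
under [RHS]eq_bigr => p _ do rewrite (act_M actP).
rewrite (sum_comul_base (f := fun u v => act (antipode u) (act v a)) l).
  by apply: eq_bigr => i _; apply: eq_bigr => j _; rewrite act_sigmaE.
split=> u c x y /=; first by rewrite linearP (act_linearl actP).
by rewrite (act_linearl actP) (act_linearr actP).
Qed.

Lemma act_span_sigma (v j : sc_I S) a : act_sigma v (act_E j a) = \sum_l act_t v j l *: act_E l a.
Proof. by rewrite act_sigmaE -(act_M actP) act_base. Qed.

Lemma act_span_id a : a = \sum_l act_v l *: act_E l a.
Proof. by rewrite -[LHS](act_1 actP) act_base. Qed.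

Definition act_measuring : measuring S A :=
  @Measuring k S A act_E act_s act_t act_v act_E_lin act_E_mul act_E_1
    act_E_sigma act_sigma_E act_span_sigma act_span_id.

Definition coef a (m : 'X_{1.. n + n}) : K := functional (fun h => (symbol (act h a))@_m).

Lemma ev_coef a m h : ev (coef a m) h = (symbol (act h a))@_m.
Proof.
apply: ev_functional => c x y.
by rewrite (act_linearl actP) linearP mcoeffD mcoeffZ.
Qed.

Lemma coef_gen_comm b1 b2 m1 m2 : weyl_generator b1 -> weyl_generator b2 ->
  coef b1 m1 * coef b2 m2 = coef b2 m2 * coef b1 m1.
Proof.
move=> g1 g2; apply/ffunP => l; rewrite !scalgME.
have := weyl_coefs_comm0 char0 act_measuring m1 m2 l g1 g2.
congr (_ = _); apply: eq_bigr => i _; apply: eq_bigr => j _; by rewrite !ffunE.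
Qed.

(** Only coefficients of the generators are put in, because these are the ones known to commute;
    [coefs_in_all] recovers the coefficients of all other elements. *)
Inductive coef_alg : K -> Prop :=
| coef_alg1 : coef_alg 1
| coef_algD f g : coef_alg f -> coef_alg g -> coef_alg (f + g)
| coef_algZ (c : k) f : coef_alg f -> coef_alg (c *: f)
| coef_algM f g : coef_alg f -> coef_alg g -> coef_alg (f * g)
| coef_alg_gen b m : weyl_generator b -> coef_alg (coef b m).

Lemma coef_alg0 : coef_alg 0.
Proof. by rewrite -(scale0r 1); apply: coef_algZ; apply: coef_alg1. Qed.

Lemma coef_alg_sum (J : Type) (r : seq J) (F : J -> K) :
  (forall j, coef_alg (F j)) -> coef_alg (\sum_(j <- r) F j).
Proof.
by move=> cF; elim/big_ind: _ => [|f g|j _] //; [apply: coef_alg0 | apply: coef_algD].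
Qed.

Lemma coef_algC f g : coef_alg f -> coef_alg g -> f * g = g * f.
Proof.
have gen b m : weyl_generator b -> forall g, coef_alg g -> coef b m * g = g * coef b m.
  move=> gb g'; elim=> [|u v _ eu _ ev|c u _ eu|u v _ eu _ ev|b' m' gb'].
  - by rewrite mul1r mulr1.
  - by rewrite mulrDl mulrDr eu ev.
  - by rewrite -scalerAl -scalerAr eu.
  - by rewrite mulrA eu -mulrA ev mulrA.
  exact: coef_gen_comm.
move=> cf cg; elim: cf => [|u v _ eu _ ev|c u _ eu|u v _ eu _ ev|b m gb].
- by rewrite mul1r mulr1.
- by rewrite mulrDl mulrDr eu ev.
- by rewrite -scalerAl -scalerAr eu.
- by rewrite -mulrA ev mulrA eu -mulrA.
exact: gen.
Qed.

Definition coefs_in a := forall m, coef_alg (coef a m).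

Lemma symbol_bound a : exists D, forall l, (msize (symbol (act_E l a)) <= D)%N.
Proof.
by exists (\max_l msize (symbol (act_E l a))) => l; apply: (leq_bigmax (F := fun l => msize (symbol (act_E l a)))).
Qed.

Lemma act_E_expand a D : (forall l, (msize (symbol (act_E l a)) <= D)%N) -> forall l,
  act_E l a = \sum_(m : 'X_{1..N < D}) (symbol (act_E l a))@_m *: wm_quant A 'X_[m].
Proof.
move=> le_D l; rewrite -[LHS](wm_symbolK (w := A)) {1}(mpolywE (le_D l)) linear_sum.
by apply: eq_bigr => m _; rewrite linearZ.
Qed.

(** The finitely many [act_E l a] have symbols of bounded degree, so a functional of [act h a] is a
    finite combination of coefficients. *)
Lemma coefs_in_linear a (phi : A -> k) : coefs_in a -> scalar phi ->
  coef_alg (functional (fun h => phi (act h a))).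
Proof.
move=> ca sphi; have [D le_D] := symbol_bound a.
pose F : {scalar A} := HB.pack phi (GRing.isLinear.Build k A k *%R phi sphi).
have -> : functional (fun h => phi (act h a)) =
    \sum_(m : 'X_{1..N < D}) phi (wm_quant A 'X_[m]) *: coef a m.
  apply/ffunP => l; rewrite sum_ffunE ffunE -/(act_E l a) (act_E_expand le_D).
  rewrite -[LHS]/(F _) linear_sum; apply: eq_bigr => m _.
  by rewrite linearZ /= !ffunE mulrC.
by apply: coef_alg_sum => m; apply: coef_algZ.
Qed.

(** Expanding the left factor in monomials [s], the coefficient of [m] in [s * b'] is linear in
    [b']; the coefficient of a product is thus a finite sum of convolution products. *)
Lemma coefs_inM a b : coefs_in a -> coefs_in b -> coefs_in (a * b).
Proof.
move=> ca cb m; have [D le_D] := symbol_bound a.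
pose phi (s : 'X_{1..N < D}) b' : k := (symbol (wm_quant A 'X_[s] * b'))@_m.
have sphi s : scalar (phi s).
  by move=> c u v; rewrite /phi mulrDr -scalerAr linearP mcoeffD mcoeffZ.
have -> : coef (a * b) m = \sum_s coef a (val s) * functional (fun h => phi s (act h b)).
  apply/ffunP => l; rewrite sum_ffunE ffunE -/(act_E l (a * b)) act_E_mul.
  under [RHS]eq_bigr => s _ do rewrite scalgME.
  rewrite [RHS]exchange_big linear_sum raddf_sum; apply: eq_bigr => i _ /=.
  rewrite exchange_big linear_sum raddf_sum; apply: eq_bigr => j _ /=.
  rewrite -scaler_sumr linearZ mcoeffZ; congr (_ * _).
  rewrite {1}(act_E_expand le_D i) mulr_suml linear_sum raddf_sum.
  apply: eq_bigr => s _ /=.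
  by rewrite -scalerAl linearZ mcoeffZ !ffunE.
apply: coef_alg_sum => s; apply: coef_algM; first exact: ca.
exact: coefs_in_linear.
Qed.

Lemma coefs_in_all a : coefs_in a.
Proof.
elim/wm_ind: a => [|a b ca cb|c a ca|i a ca|i a ca].
- move=> m; suff -> : coef 1 m = (1 : {mpoly k[n + n]})@_m *: 1.
    by apply: coef_algZ; apply: coef_alg1.
  apply: ev_inj => h; rewrite ev_coef evZ ev1 (act_unit actP) linearZ wm_symbol1.
  by rewrite mcoeffZ mulrC.
- move=> m; suff -> : coef (a + b) m = coef a m + coef b m by apply: coef_algD.
  apply: ev_inj => h; rewrite evD !ev_coef -[X in act h (X + _)]scale1r (act_linearr actP).
  by rewrite scale1r linearD mcoeffD.
- move=> m; suff -> : coef (c *: a) m = c *: coef a m by apply: coef_algZ.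
  apply: ev_inj => h; rewrite evZ !ev_coef.
  have a0 : act h 0 = 0.
    by have := act_linearr actP h (-1) 0 0; rewrite scaler0 addr0 scaleN1r addNr.
  by rewrite -[c *: a]addr0 (act_linearr actP) a0 addr0 linearZ mcoeffZ.
- by apply: coefs_inM => // m; apply: coef_alg_gen; left; exists i.
by apply: coefs_inM => // m; apply: coef_alg_gen; right; exists i.
Qed.

(** A left translate of a coefficient of [b] is a linear functional of [act x b]; a right translate
    is a coefficient of [act h b]. Both leave the generators, which is why all coefficients are
    needed first. *)
Lemma coef_alg_ltrans h f : coef_alg f -> coef_alg (ltrans h f).
Proof.
move=> cf; elim: cf h => [|u v _ IHu _ IHv|c u _ IHu|u v _ IHu _ IHv|b m gb] h.
- suff -> : ltrans h 1 = counit h *: (1 : K) by apply: coef_algZ; apply: coef_alg1.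
  by apply: ev_inj => x; rewrite ev_ltrans evZ !ev1 rmorphM.
- suff -> : ltrans h (u + v) = ltrans h u + ltrans h v by apply: coef_algD.
  by apply: ev_inj => x; rewrite evD !ev_ltrans evD.
- suff -> : ltrans h (c *: u) = c *: ltrans h u by apply: coef_algZ.
  by apply: ev_inj => x; rewrite evZ !ev_ltrans evZ.
- by rewrite ltrans_mul; apply: coef_alg_sum => p; apply: coef_algM.
have -> : ltrans h (coef b m) = functional (fun x => (symbol (act h (act x b)))@_m).
  by apply/ffunP => l; rewrite !ffunE ev_coef (act_M actP).
apply: (@coefs_in_linear b (fun b' => (symbol (act h b'))@_m)); first exact: coefs_in_all.
by move=> c u v; rewrite (act_linearr actP) linearP mcoeffD mcoeffZ.
Qed.

Lemma coef_alg_rtrans h f : coef_alg f -> coef_alg (rtrans h f).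
Proof.
move=> cf; elim: cf h => [|u v _ IHu _ IHv|c u _ IHu|u v _ IHu _ IHv|b m gb] h.
- suff -> : rtrans h 1 = counit h *: (1 : K) by apply: coef_algZ; apply: coef_alg1.
  by apply: ev_inj => x; rewrite ev_rtrans evZ !ev1 rmorphM mulrC.
- suff -> : rtrans h (u + v) = rtrans h u + rtrans h v by apply: coef_algD.
  by apply: ev_inj => x; rewrite evD !ev_rtrans evD.
- suff -> : rtrans h (c *: u) = c *: rtrans h u by apply: coef_algZ.
  by apply: ev_inj => x; rewrite evZ !ev_rtrans evZ.
- by rewrite rtrans_mul; apply: coef_alg_sum => p; apply: coef_algM.
have -> : rtrans h (coef b m) = coef (act h b) m; last exact: coefs_in_all.
by apply: ev_inj => x; rewrite ev_rtrans !ev_coef (act_M actP).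
Qed.

Theorem weyl_action_factors : factors_through_group act.
Proof.
have [L LE] := vspace_of_pred coef_alg0 coef_algD coef_algZ.
have L1 : 1 \in L by apply/LE; apply: coef_alg1.
have LM f g : f \in L -> g \in L -> f * g \in L.
  by move=> /LE cf /LE cg; apply/LE; apply: coef_algM.
have LC f g : f \in L -> g \in L -> f * g = g * f.
  by move=> /LE cf /LE cg; apply: coef_algC.
have L_ltrans h f : f \in L -> ltrans h f \in L.
  by move=> /LE cf; apply/LE; apply: coef_alg_ltrans.
have L_rtrans h f : f \in L -> rtrans h f \in L.
  by move=> /LE cf; apply/LE; apply: coef_alg_rtrans.
exists (annih_hopf_ideal L1 LM L_ltrans L_rtrans); split; last first.
  exact: (commutative_dual_iso char0 L1 LM LC L_ltrans L_rtrans).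
move=> h a /annihP Ih; apply: (@wm_symbol_inj _ _ A); apply/mpolyP => m.
rewrite -ev_coef Ih ?linear0 ?mcoeff0 //.
by apply/LE; apply: coefs_in_all.
Qed.

End WeylAction.

Theorem theorem4p1 (k : closedFieldType) (char0 : [pchar k] =i pred0) (n : nat)
    (H : finHopfAlgType k) (ssH : semisimple H)
    (act : H -> weyl_alg k n -> weyl_alg k n) (actP : hopf_action act) :
  factors_through_group act.
Proof. exact: (@weyl_action_factors k char0 n H (weyl_alg_model k n) act actP). Qed.
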